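(* Let $G=\mathrm{SO}(n,1)$ with $n\ge 3$, and suppose that $G$ acts continuously on a compact connected manifold $M$, preserving a (nonzero) finite Borel measure $\mu$. Let $\tilde G$ and $\tilde M$ be the universal coverings of $G$ and $M$, consider the lifted action of $\tilde G$ on $\tilde M$, and let $\tilde\mu$ be the natural lift of $\mu$ to $\tilde M$. Suppose that the $\tilde G$-action on $\tilde M$ is measurably proper with respect to $\tilde\mu$; that is, for $\tilde\mu$-almost every $x\in\tilde M$ the stabilizer $\tilde G_x$ is compact and the orbital map $\tilde G/\tilde G_x\to\tilde M$, $g\mapsto gx$, is proper. If $\pi_1(M)$ is isomorphic to a discrete infinite subgroup $\Lambda$ of $H=\mathrm{SO}(m,1)$ or $H=\mathrm{SU}(m,1)$ for some $m\ge 2$, then $\delta(G)\le\delta(\Lambda)$, where $\delta(G)=n-1$.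
   Context: For $n\ge 2$, $\mathrm{SO}(n,1)$ denotes the identity component of the subgroup of $\mathrm{SL}_{n+1}(\mathbb{R})$ preserving the form $x_1^2+\dots+x_n^2-x_{n+1}^2$, and $\mathrm{SU}(n,1)$ the subgroup of $\mathrm{SL}_{n+1}(\mathbb{C})$ preserving $|x_1|^2+\dots+|x_n|^2-|x_{n+1}|^2$. For $H$ one of these groups and $K<H$ maximal compact, $H/K$ is real (resp. complex) hyperbolic space. It carries the $H$-invariant Riemannian distance $d$ normalized to have constant sectional curvature $-1$ in the real case and maximal sectional curvature $-1$ (values in $[-4,-1]$) in the complex case. Let $o=eK$. The critical exponent of a discrete subgroup $\Lambda<H$ is $\delta(\Lambda)=\inf\{s\ge 0\mid\sum_{\lambda\in\Lambda}e^{-s\,d(\lambda o,o)}<\infty\}$. One sets $\delta(\mathrm{SO}(n,1))=n-1$, the critical exponent of any lattice in it. A continuous action of a connected Lie group $G$ on a connected manifold $M$ lifts, by covering theory, to an action of $\tilde G$ on $\tilde M$, commuting with the deck transformation group $\pi_1(M)$. The natural lift $\tilde\mu$ of $\mu$ is the $\pi_1(M)$-invariant Borel measure on $\tilde M$ whose restriction to every open set mapped homeomorphically into $M$ by the covering map corresponds to $\mu$ under that map. *)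

(* Defs.v *)
From HB Require Import structures.
From mathcomp Require Import all_boot all_order all_algebra generic_quotient.
From mathcomp Require Import complex.
From mathcomp Require Import all_classical all_reals all_analysis.

Set Implicit Arguments.
Unset Strict Implicit.
Unset Printing Implicit Defensive.

Import Order.TTheory GRing.Theory Num.Theory.
Import numFieldNormedType.Exports.

Local Open Scope classical_set_scope.
Local Open Scope ring_scope.
Local Open Scope quotient_scope.

HB.mixin Record isTopGroup G & Group G & Topological G := {
  mulg_continuous : continuous (fun x : G * G => (x.1 * x.2)%g);
  invg_continuous : continuous (fun x : G => x^-1%g)
}.

#[short(type="topGroupType")]
HB.structure Definition TopGroup :=
  {G of Group G & Topological G & isTopGroup G}.

Record mxGroup (K : numFieldType) (N : nat) := MxGroup {
  mxgroup_set :> set 'M[K]_N;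
  mxgroup_det : forall g, mxgroup_set g -> \det g = 1;
  mxgroup_one : mxgroup_set 1%:M;
  mxgroup_mul : forall g h,
    mxgroup_set g -> mxgroup_set h -> mxgroup_set (g *m h);
  mxgroup_inv : forall g, mxgroup_set g -> mxgroup_set (invmx g) }.

Definition mxgroup_type (K : numFieldType) N (A : mxGroup K N) : Type :=
  set_type A.

Section MatrixContinuity.
Context (K : numFieldType) (T : topologicalType).

Lemma mx_continuous p q (f : T -> 'M[K]_(p, q)) :
  (forall i j, continuous (fun t => f t i j)) -> continuous f.
Proof.
move=> cf t B [P tP PB].
apply: (@filterS _ (nbhs t) _ (fun s => forall ij : 'I_p * 'I_q,
   P ij.1 ij.2 (f s ij.1 ij.2))).
  by move=> s sP; apply: PB => i j; exact: (sP (i, j)).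
apply: (@filter_forall T ('I_p * 'I_q)%type 
  (fun ij s => P ij.1 ij.2 (f s ij.1 ij.2))) => -[i j].
by apply: cf; exact: tP.
Qed.

Lemma entry_continuous p q (f : T -> 'M[K]_(p, q)) i j :
  continuous f -> continuous (fun t => f t i j).
Proof.
by move=> cf t; apply: (@continuous_comp _ _ _ f (fun M : 'M[K]_(p, q) => M i j));
  [exact: cf|exact: coord_continuous].
Qed.

Lemma fsum_continuous (I : Type) (r : seq I) (P : pred I) (f : I -> T -> K) :
  (forall i, P i -> continuous (f i)) ->
  continuous (fun t => \sum_(i <- r | P i) f i t).
Proof. by apply: continuous_big; exact: add_continuous. Qed.

Lemma fprod_continuous (I : Type) (r : seq I) (P : pred I) (f : I -> T -> K) :
  (forall i, P i -> continuous (f i)) ->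
  continuous (fun t => \prod_(i <- r | P i) f i t).
Proof. by apply: continuous_big; exact: mul_continuous. Qed.

Lemma mulmx_continuous p q r (f : T -> 'M[K]_(p, q)) (g : T -> 'M[K]_(q, r)) :
  continuous f -> continuous g -> continuous (fun t => f t *m g t).
Proof.
move=> cf cg; apply: mx_continuous => i j.
under eq_fun do rewrite mxE.
apply: fsum_continuous => k _ t.
by apply: cvgM; apply: entry_continuous.
Qed.

Lemma det_continuous p (f : T -> 'M[K]_p) :
  continuous f -> continuous (fun t => \det (f t)).
Proof.
move=> cf; rewrite /determinant; apply: fsum_continuous => s _ t.
apply: cvgM; first exact: cvg_cst.
by apply: fprod_continuous => i _; exact: entry_continuous.
Qed.

Lemma adjmx_continuous p (f : T -> 'M[K]_p) :
  continuous f -> continuous (fun t => \adj (f t)).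
Proof.
move=> cf; apply: mx_continuous => i j.
under eq_fun do rewrite mxE /cofactor.
move=> t; apply: cvgM; first exact: cvg_cst.
apply: det_continuous; apply: mx_continuous => k l.
under eq_fun do rewrite !mxE.
exact: entry_continuous.
Qed.

End MatrixContinuity.

Section MatrixGroup.
Context (K : numFieldType) (N : nat) (A : mxGroup K N).
Local Notation G := (mxgroup_type A).
Implicit Types g h : G.

HB.instance Definition _ := Topological.copy G (set_type (mxgroup_set A)).
HB.instance Definition _ := [isSub of G for @sval _ _].

Lemma mxgroupP g : mxgroup_set A (val g). Proof. exact: set_valP. Qed.

Lemma mxgroup_unit g : val g \in unitmx.
Proof. by rewrite unitmxE (mxgroup_det (mxgroupP g)) unitr1. Qed.

Definition mxgroup_mk (M : 'M[K]_N) (AM : mxgroup_set A M) : G := exist _ M (mem_set AM).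

Let one := mxgroup_mk (mxgroup_one A).
Let mul g h := mxgroup_mk (mxgroup_mul (mxgroupP g) (mxgroupP h)).
Let inv g := mxgroup_mk (mxgroup_inv (mxgroupP g)).

Fact mxgroup_mulA : associative mul.
Proof. by move=> g h k; apply: val_inj; rewrite /= mulmxA. Qed.
Fact mxgroup_mul1 : left_id one mul.
Proof. by move=> g; apply: val_inj; rewrite /= mul1mx. Qed.
Fact mxgroup_1mul : right_id one mul.
Proof. by move=> g; apply: val_inj; rewrite /= mulmx1. Qed.
Fact mxgroup_mulV : left_inverse one inv mul.
Proof. by move=> g; apply: val_inj; rewrite /= mulVmx// mxgroup_unit. Qed.
Fact mxgroup_Vmul : right_inverse one inv mul.
Proof. by move=> g; apply: val_inj; rewrite /= mulmxV// mxgroup_unit. Qed.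

HB.instance Definition _ := isGroup.Build G
  mxgroup_mulA mxgroup_mul1 mxgroup_1mul mxgroup_mulV mxgroup_Vmul.

Fact mxgroup_val_continuous : continuous (val : G -> 'M[K]_N).
Proof. exact: (@initial_continuous _ _ (set_val : set_type (mxgroup_set A) -> _)). Qed.

Fact mxgroup_mul_continuous : continuous (fun x : G * G => (x.1 * x.2)%g).
Proof.
apply: (@continuous_comp_initial _ _ _ (set_val : set_type (mxgroup_set A) -> _)).
apply: mulmx_continuous.
  by move=> x; apply: continuous_comp; [exact: cvg_fst|exact: mxgroup_val_continuous].
by move=> x; apply: continuous_comp; [exact: cvg_snd|exact: mxgroup_val_continuous].
Qed.

Fact mxgroup_inv_continuous : continuous (fun x : G => x^-1%g).
Proof.
apply: (@continuous_comp_initial _ _ _ (set_val : set_type (mxgroup_set A) -> _)).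
have -> : set_val \o (fun x : G => x^-1%g) = fun x : G => \adj (val x).
  apply/funext => x; rewrite -[LHS]/(invmx (val x)).
  by rewrite /invmx mxgroup_unit (mxgroup_det (mxgroupP x)) invr1 scale1r.
exact/adjmx_continuous/mxgroup_val_continuous.
Qed.

HB.instance Definition _ :=
  isTopGroup.Build G mxgroup_mul_continuous mxgroup_inv_continuous.

End MatrixGroup.

Section PseudoUnitary.
Context (K : numFieldType) (n : nat).

(* On real scalars `|x| ^+ 2 = x ^+ 2, so that hform is the quadratic form
   x_1^2 + ... + x_n^2 - x_{n+1}^2 when K is the field of real numbers. *)
Definition hform (x : 'cV[K]_n.+1) : K :=
  \sum_(i < n) `|x (widen_ord (leqnSn n) i) 0| ^+ 2 - `|x ord_max 0| ^+ 2.

Definition pseudo_unitary : set 'M[K]_n.+1 :=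
  [set g | \det g = 1 /\ forall x, hform (g *m x) = hform x].

Fact pseudo_unitary_det g : pseudo_unitary g -> \det g = 1.
Proof. by case. Qed.

Fact pseudo_unitary1 : pseudo_unitary 1%:M.
Proof. by split=> [|x]; rewrite ?det1 ?mul1mx. Qed.

Fact pseudo_unitaryM g h :
  pseudo_unitary g -> pseudo_unitary h -> pseudo_unitary (g *m h).
Proof.
move=> [dg qg] [dh qh]; split=> [|x]; first by rewrite det_mulmx dg dh mulr1.
by rewrite -mulmxA qg qh.
Qed.

Fact pseudo_unitaryV g : pseudo_unitary g -> pseudo_unitary (invmx g).
Proof.
move=> [dg qg]; have ug : g \in unitmx by rewrite unitmxE dg unitr1.
by split=> [|x]; rewrite ?det_inv ?dg ?invr1// -qg mulKVmx.
Qed.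

Definition identity_component : set 'M[K]_n.+1 :=
  connected_component pseudo_unitary 1%:M.

Fact identity_component_det g : identity_component g -> \det g = 1.
Proof. by move/connected_component_sub => -[]. Qed.

Fact identity_component1 : identity_component 1%:M.
Proof. exact/connected_component_refl/pseudo_unitary1. Qed.

Lemma connected_mulmxl (g : 'M[K]_n.+1) (B : set 'M[K]_n.+1) :
  connected B -> connected ((mulmx g) @` B).
Proof.
move=> cB; apply: connected_continuous_connected => //.
apply: continuous_subspaceT; apply: mulmx_continuous.
  exact: cst_continuous.
by move=> x; exact: cvg_id.
Qed.

Fact identity_componentM g h : identity_component g -> identity_component h ->
  identity_component (g *m h).
Proof.
move=> cg [B [B1 sB cB] Bh]; apply: (connected_component_trans cg).
have pg := connected_component_sub cg.
exists (mulmx g @` B); last by exists h.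
split; [by exists 1%:M => //; rewrite mulmx1| |exact: connected_mulmxl].
by move=> _ [k Bk <-]; apply: (pseudo_unitaryM _ (sB _ Bk)).
Qed.

Fact identity_componentV g : identity_component g ->
  identity_component (invmx g).
Proof.
move=> cg; have pg := connected_component_sub cg.
have ug : g \in unitmx by rewrite unitmxE pg.1 unitr1.
have [B [B1 sB cB] Bg] := cg.
exists (mulmx (invmx g) @` B).
  split; [by exists g => //; rewrite mulVmx| |exact: connected_mulmxl].
  by move=> _ [k Bk <-]; apply: (pseudo_unitaryM _ (sB _ Bk)); exact: pseudo_unitaryV.
by exists 1%:M => //; rewrite mulmx1.
Qed.

End PseudoUnitary.

(* The groups SO(n,1) (identity component) and SU(n,1). *)
Definition SO (R : realType) (n : nat) : mxGroup R n.+1 :=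
  MxGroup (@identity_component_det R n) (@identity_component1 R n)
    (@identity_componentM R n) (@identity_componentV R n).

Definition SU (R : realType) (n : nat) : mxGroup R[i] n.+1 :=
  MxGroup (@pseudo_unitary_det R[i] n) (@pseudo_unitary1 R[i] n)
    (@pseudo_unitaryM R[i] n) (@pseudo_unitaryV R[i] n).

Variant hyp_kind := RealHyp | ComplexHyp.

Definition hypGroup (R : realType) (k : hyp_kind) (m : nat) : topGroupType :=
  match k with
  | RealHyp => mxgroup_type (SO R m)
  | ComplexHyp => mxgroup_type (SU R m)
  end.

Definition hypMx (R : realType) (k : hyp_kind) (m : nat) :
    hypGroup R k m -> 'M[R[i]]_m.+1 :=
  match k with
  | RealHyp => fun g : mxgroup_type (SO R m) => map_mx (real_complex R) (val g)
  | ComplexHyp => fun g : mxgroup_type (SU R m) => val g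
  end.

Section HyperbolicGeometry.
Context (R : realType) (k : hyp_kind) (m : nat).
Local Notation H := (hypGroup R k m).
Implicit Types (g h : H) (c : R -> H) (Lambda : set H).

(* The stabilizer of the line through the last basis vector. It is the standard
   maximal compact subgroup: SO(m) if k = RealHyp, S(U(m) x U(1)) if
   k = ComplexHyp. *)
Definition hypK : set H :=
  [set g | forall i : 'I_m, hypMx g (widen_ord (leqnSn m) i) ord_max = 0].

Definition C1_fun (f : R -> R) : Prop :=
  (forall t, derivable f t 1) /\ continuous (derive1 f).

Definition C1_curve c : Prop := forall i j,
  C1_fun (fun t => complex.Re (hypMx (c t) i j)) /\
  C1_fun (fun t => complex.Im (hypMx (c t) i j)).

Definition curve_deriv c (t : R) : 'M[R[i]]_m.+1 :=
  \matrix_(i, j) (derive1 (fun s => complex.Re (hypMx (c s) i j)) t +i*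
                  derive1 (fun s => complex.Im (hypMx (c s) i j)) t)%C.

(* The H-invariant metric of H/K: the tangent space at eK is Lie(H)/Lie(K),
   identified with R^m (resp. C^m) by taking the first m entries of the last
   column, and the metric there is the standard Euclidean (resp. Hermitian) one.
   In the real case c t *m e_{m+1} is a curve in the hyperboloid, with the same
   length for hform, hence curvature -1; in the complex case this scaling gives
   curvature -4 on complex lines and -1 on totally real planes. *)
Definition curve_speed c (t : R) : R :=
  let X := invmx (hypMx (c t)) *m curve_deriv c t in
  Num.sqrt (\sum_(i < m)
    (complex.Re (X (widen_ord (leqnSn m) i) ord_max) ^+ 2 +
     complex.Im (X (widen_ord (leqnSn m) i) ord_max) ^+ 2)).

Definition curve_length c : R :=
  Rintegral lebesgue_measure `[0, 1]%classic (curve_speed c).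

(* The distance between the points gK and hK of H/K. Curves in H/K are given by
   their lifts to H, and a C^1 curve on [0, 1] in H extends to the whole line. *)
Definition hyp_dist g h : R :=
  inf [set curve_length c | c in
    [set c | [/\ C1_curve c, hypK (g^-1 * c 0%R)%g & hypK (h^-1 * c 1%R)%g]]].

Definition critical_exponent Lambda : \bar R :=
  ereal_inf [set s%:E | s in [set s : R | 0 <= s /\
    (\esum_(l in Lambda) (expR (- (s * hyp_dist l 1%g)))%:E < +oo)%E]].

End HyperbolicGeometry.

Definition delta_SO (R : realType) (n : nat) : R := n%:R - 1.

Definition subgroup (H : groupType) (L : set H) : Prop :=
  [/\ L 1%g, forall g h, L g -> L h -> L (g * h)%g & forall g, L g -> L g^-1%g].

Definition discrete_set (T : topologicalType) (L : set T) : Prop :=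
  L `<=` isolated L.

Definition homeo_on (X Y : topologicalType) (f : X -> Y) (U : set X) (V : set Y)
    : Prop :=
  [/\ open U, open V, {within U, continuous f}, set_bij U V f &
      forall W, open W -> W `<=` U -> open (f @` W)].

Definition manifold (R : realType) (d : nat) (M : topologicalType) : Prop :=
  [/\ hausdorff_space M, @second_countable M &
      forall x : M, exists (U : set M) (V : set 'rV[R]_d) (f : M -> 'rV[R]_d),
        U x /\ homeo_on f U V].

(* Paths are parametrized by [0, 1]; their values elsewhere are irrelevant. *)
Section Homotopy.
Context (R : realType) (T : topologicalType).
Implicit Types (x y : T) (f g : R -> T).

Definition is_path x y f : Prop :=
  [/\ {within `[0, 1]%classic, continuous f}, f 0 = x & f 1 = y].

Definition is_loop x f : Prop := is_path x x f.

Definition path_homotopic f g : Prop :=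
  exists F : R * R -> T,
    [/\ {within `[0, 1]%classic `*` `[0, 1]%classic, continuous F},
        forall s, s \in `[0, 1] -> F (0, s) = f s /\ F (1, s) = g s &
        forall t, t \in `[0, 1] -> F (t, 0) = f 0 /\ F (t, 1) = f 1].

Definition path_concat f g : R -> T :=
  fun t => if t <= 2^-1 then f (2 * t) else g (2 * t - 1).

Definition simply_connected : Prop :=
  [/\ [set: T] !=set0,
      forall x y, exists f, is_path x y f &
      forall x f, is_loop x f -> path_homotopic f (cst x)].

(* phi induces an isomorphism of the fundamental group at x onto L. *)
Definition pi1_isomorphic x (H : groupType) (L : set H) : Prop :=
  exists phi : (R -> T) -> H,
    [/\ forall f, is_loop x f -> L (phi f),
        forall l, L l -> exists2 f, is_loop x f & phi f = l,
        forall f g, is_loop x f -> is_loop x g ->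
          (phi f = phi g <-> path_homotopic f g) &
        forall f g, is_loop x f -> is_loop x g ->
          phi (path_concat f g) = (phi f * phi g)%g].

End Homotopy.

Definition covering (E B : topologicalType) (p : E -> B) : Prop :=
  [/\ continuous p, set_surj [set: E] [set: B] p &
      forall b, exists U : set B, [/\ open U, U b &
        exists F : set (set E), [/\ p @^-1` U = \bigcup_(V in F) V,
          trivIset F id & forall V, F V -> homeo_on p V U]]].

Definition universal_covering (R : realType) (E B : topologicalType)
    (p : E -> B) : Prop :=
  covering p /\ simply_connected R E.

Definition deck (E B : topologicalType) (p : E -> B) : set (E -> E) :=
  [set f : E -> E | p \o f = p /\ continuous f /\
    exists g, [/\ continuous g, cancel f g & cancel g f]].

Record contAction (G : topGroupType) (M : topologicalType) := ContAction {
  act_fun :> G -> M -> M;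
  act1 : forall x, act_fun 1%g x = x;
  actM : forall g h x, act_fun (g * h)%g x = act_fun g (act_fun h x);
  act_continuous : continuous (fun gx : G * M => act_fun gx.1 gx.2) }.

Definition lifted_action (G Gt : topGroupType) (M Mt : topologicalType)
    (q : Gt -> G) (p : Mt -> M) (a : contAction G M) (b : contAction Gt Mt)
    : Prop :=
  forall g x, p (b g x) = a (q g) (p x).

Section Orbits.
Context (G : topGroupType) (M : topologicalType) (a : contAction G M) (x : M).

Definition stabilizer : set G := [set g | a g x = x].

Definition same_lcoset : rel G := fun g h => `[< stabilizer (g^-1 * h)%g >].

Lemma same_lcosetP g h : reflect (a g x = a h x) (same_lcoset g h).
Proof.
apply: (iffP (asboolP _)); rewrite /stabilizer /mkset actM => E.
  by rewrite -{1}E -actM mulgV act1.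
by rewrite -E -actM mulVg act1.
Qed.

Fact same_lcoset_equiv : equiv_class_of same_lcoset.
Proof.
split=> [g|g h|h g l].
- exact/same_lcosetP.
- by apply/same_lcosetP/same_lcosetP.
- by move=> /same_lcosetP E /same_lcosetP F; apply/same_lcosetP; rewrite E.
Qed.

Canonical same_lcoset_equivRel := EquivRelPack same_lcoset_equiv.

Definition stab_quotient := quotient_topology {eq_quot same_lcoset_equivRel}.

HB.instance Definition _ := Topological.on stab_quotient.
HB.instance Definition _ := Quotient.on stab_quotient.

Definition orbital_map (c : stab_quotient) : M := a (repr c) x.

Lemma orbital_mapE g : orbital_map (\pi g) = a g x.
Proof. by apply/same_lcosetP/eqmodP; rewrite reprK. Qed.

End Orbits.

Definition proper_map (X Y : topologicalType) (f : X -> Y) : Prop :=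
  continuous f /\ forall C, compact C -> compact (f @^-1` C).

(* g_sigma_algebraType is only a measurable type for a pointed T: the base point
   of a ptopologicalType plays no other role here. *)
Notation borel T := (g_sigma_algebraType (@open T)).

Definition invariant_measure (R : realType) (G : topGroupType)
    (M : ptopologicalType) (a : contAction G M)
    (mu : {measure set (borel M) -> \bar R}) : Prop :=
  forall g (A : set (borel M)), measurable A -> mu (a g @^-1` A) = mu A.

Definition natural_lift (R : realType) (M Mt : ptopologicalType) (p : Mt -> M)
    (mu : {measure set (borel M) -> \bar R})
    (mut : {measure set (borel Mt) -> \bar R}) : Prop :=
  (forall f, deck p f -> forall A : set (borel Mt), measurable A ->
     mut (f @^-1` A) = mut A) /\
  (forall V : set Mt, homeo_on p V (p @` V) ->
     forall A : set (borel Mt), measurable A -> A `<=` V ->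
     mut A = mu (p @` A)).

Definition measurably_proper (R : realType) (G : topGroupType)
    (M : ptopologicalType) (a : contAction G M)
    (mu : {measure set (borel M) -> \bar R}) : Prop :=
  {ae mu, forall x : M, compact (stabilizer a x) /\
    proper_map (@orbital_map G M a x)}.

(* Main.v *)
(* Suppose that the critical exponent of [Lambda] is less than [N = n - 1]. A Borel
   section [M -> Mt] turns the lifted action into a cocycle [c : Gt -> M -> Lambda],
   and measurable properness says that, for almost every [x], the elements [g] with
   [c g x = 1] stay bounded. Put [F l = ln |l_mm|], which is the distance from [l o]
   to [o] up to [ln 2], so that [sum_Lambda exp (- p F) < oo] for some [1 < p < N];
   let [psi g] be the integral of [F (c g x)] over [M], and let [n_w] ([w] in [Z^N])
   be unipotent elements of [Gt] that a boost [A] expands: [A n_w A^-1 = n_(2 w)].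
   A horospherical box of side [2^r] contains [2^(r N)] points, and, up to a
   perturbation by opposite unipotents, boundedly many of them share a value of [c];
   so [exp (- F (c n_w x))] decays geometrically on average, and the mean of [psi]
   over the box grows linearly in [r].
   On the other hand hyperbolicity gives
   [|F (b l a) - F (b l) - F (l a) + F l| <= D exp (- F l)], so that left increments
   [psi (A g) - psi g] hardly change when [g] is multiplied on the right by bounded
   elements. As [A^-(i+1) n_(2 w + e) = A^-i n_w (A^-1 n_e)], the means of these
   increments over the elements [A^-i n_w] are almost independent of [i]; their sum
   over [i] telescopes, so they are almost nonpositive. Since [psi g^-1 = psi g],
   they also control the growth of the means of [psi] from [r] to [r + 1], which
   contradicts linear growth. *)
Require Import Defs.
From mathcomp Require Import all_boot all_order all_algebra.
From mathcomp Require Import complex.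
From mathcomp Require Import all_classical all_reals all_analysis.
From mathcomp Require Import measurable_realfun finmap ring lra.

Set Implicit Arguments.
Unset Strict Implicit.
Unset Printing Implicit Defensive.

Import Order.TTheory GRing.Theory Num.Theory.
Import numFieldNormedType.Exports.

Local Open Scope classical_set_scope.
Local Open Scope ring_scope.

(** * Integration of maps with finite range *)

(** Why the critical value is [N]: moving a box of side [2^r] by its own length takes about [2^r]
    unit steps, so the errors are summable in [r] only if the mean of [exp (- F (c n_w x))] decays
    faster than [2^-r]. Summability at exponent [p] gives the rate [2^(- r N / p)], which is faster
    precisely when [p < N]; the comparison also uses [1 < p], for which there is room because
    [N = n - 1 >= 2]. The obstacle is uniformity in [i]. Since [A^-i n_w = n_(w / 2^i) A^-i], about
    [2^(i N)] of these elements differ by bounded left factors, and a direct count of the values of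
    [c] would lose that factor. Opposite unipotents [m_u] behave the other way:
    [A^i m_u A^-i = m_(u / 2^i)] is bounded for [u] in a box of side [2^i], whereas [A^-i n_w m_(u /
    2^i) = n_(w / 2^i) m_u A^-i] has [u] spread out. Averaging over these [2^(i N)] perturbations
    restores the lost factor. The boosts [n_e^-1 A] come in because inversion turns
    [A^-1 n_(2 w + e)] into [(n_e^-1 A) n_w^-1]. *)

Section SimpleMaps.
Context d (X : measurableType d).

(** Fibres are used because the cocycle takes values in a group without sigma-algebra. Real
    functions of such maps are bounded, hence integrable for a finite measure. *)
Definition simple_map (T : Type) (f : X -> T) : Prop :=
  finite_set (range f) /\ forall t, measurable (f @^-1` [set t]).

Lemma simple_map_cst (T : Type) (t : T) : simple_map (fun _ => t).
Proof.
split=> [|u]; first exact: finite_image_cst.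
by rewrite preimage_cst; case: ifP => _; [exact: measurableT|exact: measurable0].
Qed.

Lemma simple_map_comp (T U : Type) (h : T -> U) (f : X -> T) :
  simple_map f -> simple_map (fun x => h (f x)).
Proof.
move=> [ff mf]; split=> [|u].
  by have := finite_image h ff; rewrite image_comp.
have -> : (fun x => h (f x)) @^-1` [set u] =
    \bigcup_(t in range f `&` h @^-1` [set u]) (f @^-1` [set t]).
  apply/seteqP; split=> [x /= hfx|x [t [_ <-]] /= <-//].
  by exists (f x) => //; split=> //; exists x.
by apply: fin_bigcup_measurable => [|t _]; [exact: finite_setIl|exact: mf].
Qed.

Lemma simple_map_pair (T U : Type) (f : X -> T) (g : X -> U) :
  simple_map f -> simple_map g -> simple_map (fun x => (f x, g x)).
Proof.
move=> [ff mf] [fg mg]; split=> [|[t u]].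
  apply: sub_finite_set (finite_setX ff fg).
  by move=> _ [x _ <-]; split; exists x.
have -> : (fun x => (f x, g x)) @^-1` [set (t, u)] =
    f @^-1` [set t] `&` g @^-1` [set u].
  by apply/seteqP; split=> [x [<- <-]|x [/= -> ->]].
exact: measurableI.
Qed.

Lemma simple_map2 (T U V : Type) (h : T -> U -> V) (f : X -> T) (g : X -> U) :
  simple_map f -> simple_map g -> simple_map (fun x => h (f x) (g x)).
Proof.
move=> sf sg.
exact: (simple_map_comp (fun tu => h tu.1 tu.2) (simple_map_pair sf sg)).
Qed.

Lemma simple_map_precomp (T : Type) (f : X -> T) (a : X -> X) :
  measurable_fun [set: X] a -> simple_map f -> simple_map (fun x => f (a x)).
Proof.
move=> ma [ff mf]; split=> [|t].
  by apply: sub_finite_set ff => _ [x _ <-]; exists (a x).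
by rewrite -[X in measurable X]setTI; exact: (ma measurableT _ (mf t)).
Qed.

Lemma simple_map_mem (A : set X) : measurable A ->
  simple_map (fun x => x \in A).
Proof.
move=> mA; split=> [|[]].
- exact: (sub_finite_set (@subsetT _ _) (@finite_finset bool _)).
- by rewrite (_ : _ @^-1` _ = A)//; apply/seteqP; split=> x /= => [/set_mem|/mem_set].
- rewrite (_ : _ @^-1` _ = ~` A); first exact: measurableC.
  by apply/seteqP; split=> x /= => [/negbT|xA]; [rewrite notin_setE|apply/negbTE; rewrite notin_setE].
Qed.

Context (R : realType) (mu : {finite_measure set X -> \bar R}).
Implicit Types f g : X -> R.

Lemma simple_map_bounded f : simple_map f -> exists B, forall x, `|f x| <= B.
Proof.
move=> [ff _]; have /finite_seqP[s sE] := finite_image (@Num.norm _ _ : R -> R) ff.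
exists (\sum_(r <- s) `|r|) => x.
have : ((@Num.norm _ _ : R -> R) @` range f) `|f x| by exists (f x) => //; exists x.
rewrite sE /= => fs; rewrite (big_rem _ fs)/= normr_id lerDl.
by apply: sumr_ge0.
Qed.

Lemma simple_map_measurable f : simple_map f -> measurable_fun [set: X] f.
Proof.
move=> [ff mf] _ B mB; rewrite setTI.
have -> : f @^-1` B = \bigcup_(t in range f `&` B) (f @^-1` [set t]).
  apply/seteqP; split=> [x /= Bfx|x [t [_ Bt]] /= -> //].
  by exists (f x) => //; split=> //; exists x.
by apply: fin_bigcup_measurable => [|t _]; [exact: finite_setIl|exact: mf].
Qed.

Lemma simple_map_integrable f : simple_map f ->
  mu.-integrable [set: X] (EFin \o f).
Proof.
move=> sf; apply: measurable_bounded_integrable => //.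
- by rewrite ltey_eq fin_num_measure.
- exact: simple_map_measurable.
- have [B fB] := simple_map_bounded sf; exists B; split; first exact: num_real.
  by move=> C BC x _; exact: le_trans (ltW BC).
Qed.

Definition integ f : R := Rintegral mu [set: X] f.

Lemma integD f g : simple_map f -> simple_map g ->
  integ (fun x => f x + g x) = integ f + integ g.
Proof. by move=> sf sg; apply: RintegralD => //; exact: simple_map_integrable. Qed.

Lemma integB f g : simple_map f -> simple_map g ->
  integ (fun x => f x - g x) = integ f - integ g.
Proof. by move=> sf sg; apply: RintegralB => //; exact: simple_map_integrable. Qed.

Lemma integZ k f : simple_map f -> integ (fun x => k * f x) = k * integ f.
Proof. by move=> sf; apply: RintegralZl => //; exact: simple_map_integrable. Qed.

Lemma integ_le f g : simple_map f -> simple_map g ->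
  (forall x, f x <= g x) -> integ f <= integ g.
Proof.
by move=> sf sg fg; apply: le_Rintegral => //; exact: simple_map_integrable.
Qed.

Lemma integ_ge0 f : (forall x, 0 <= f x) -> 0 <= integ f.
Proof. by move=> f0; apply: Rintegral_ge0. Qed.

Lemma integ_cst r : integ (fun _ => r) = r * fine (mu [set: X]).
Proof. exact: Rintegral_cst. Qed.

Lemma eq_integ f g : f =1 g -> integ f = integ g.
Proof. by move=> /funext ->. Qed.

Lemma simple_map_sum (I : finType) (F : I -> X -> R) :
  (forall i, simple_map (F i)) -> simple_map (fun x => \sum_i F i x).
Proof.
move=> sF; elim: (index_enum I) => [|i r IH].
  by under eq_fun do rewrite big_nil; exact: simple_map_cst.
under eq_fun do rewrite big_cons.
exact: (simple_map2 +%R).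
Qed.

Lemma integ_sum (I : finType) (F : I -> X -> R) :
  (forall i, simple_map (F i)) ->
  integ (fun x => \sum_i F i x) = \sum_i integ (F i).
Proof.
move=> sF.
suff [] : simple_map (fun x => \sum_(i <- index_enum I) F i x) /\
  integ (fun x => \sum_(i <- index_enum I) F i x) =
  \sum_(i <- index_enum I) integ (F i) by [].
elim: (index_enum I) => [|i r [IHs IH]].
  rewrite big_nil; split.
    by under eq_fun do rewrite big_nil; exact: simple_map_cst.
  by under eq_integ do rewrite big_nil; rewrite integ_cst mul0r.
rewrite big_cons -IH; split.
  by under eq_fun do rewrite big_cons; exact: (simple_map2 +%R).
by rewrite -integD//; apply: eq_integ => x; rewrite big_cons.
Qed.

Lemma integ_norm f : simple_map f -> `|integ f| <= integ (fun x => `|f x|).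
Proof. by move=> sf; apply: le_normr_Rintegral => //; exact: simple_map_integrable. Qed.

Lemma integ_mem (A : set X) : measurable A ->
  integ (fun x => (x \in A)%:R) = fine (mu A).
Proof.
move=> mA; have -> : (fun x => (x \in A)%:R) = \1_A :> (X -> R) by [].
by rewrite /integ /Rintegral integral_indic// setIT.
Qed.

Lemma integ_precomp f (a : X -> X) : measurable_fun [set: X] a ->
  (forall A, measurable A -> mu (a @^-1` A) = mu A) -> simple_map f ->
  integ (fun x => f (a x)) = integ f.
Proof.
move=> ma inv sf; rewrite /integ /Rintegral; congr fine.
have mf : measurable_fun [set: X] (EFin \o f : X -> \bar R).
  exact/measurable_EFinP/simple_map_measurable.
have sfa := simple_map_precomp ma sf.
have := integral_pushforward ma mf (simple_map_integrable sfa) measurableT.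
rewrite preimage_setT => <-.
pose nu := measure_function_pushforward__canonical__measure_function_Measure mu ma.
by apply: (@eq_measure_integral _ _ _ _ mu nu) => A mA _; exact: inv.
Qed.

End SimpleMaps.

(** * Cocycles with values in a hyperbolic group *)

Section Cocycle.
Context (R : realType) d (X : measurableType d).
Context (mu : {finite_measure set X -> \bar R}) (G H : groupType).
Variable act : G -> X -> X.
Hypothesis act1 : forall x, act 1%g x = x.
Hypothesis actM : forall g h x, act (g * h)%g x = act g (act h x).
Hypothesis act_measurable : forall g, measurable_fun [set: X] (act g).
Hypothesis act_invariant : forall g A, measurable A -> mu (act g @^-1` A) = mu A.
Variables (F : H -> R) (kappa : R).
Hypothesis kappa_ge0 : 0 <= kappa.
Hypothesis F_ge0 : forall l, 0 <= F l.
Hypothesis FV : forall l, F l^-1%g = F l.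
Hypothesis FM : forall a b, F (a * b)%g <= F a + F b + kappa.
Hypothesis F_cross : forall C, exists2 D : R, 0 <= D & forall a b l,
  F a <= C -> F b <= C ->
  `|F (b * l * a)%g - F (b * l)%g - F (l * a)%g + F l| <= D * expR (- F l).
Variables (L : set H) (p S : R).
Hypothesis F_summable : forall s : seq H, uniq s -> (forall l, l \in s -> L l) ->
  \sum_(l <- s) expR (- (p * F l)) <= S.
Variable c : G -> X -> H.
Hypothesis c_in : forall g x, L (c g x).
Hypothesis cM : forall g k x, c (g * k)%g x = (c k x * c g (act k x))%g.
Hypothesis c_simple : forall g, simple_map (c g).
Variables (W : set X) (mW : measurable W).

Local Notation bounded_by C h := (forall x, F (c h x) <= C).

Lemma cocycle1 x : c 1%g x = 1%g.
Proof.
have := cM 1%g 1%g x; rewrite mulg1 act1 => e.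
by apply: (mulgI (c 1%g x)); rewrite -e mulg1.
Qed.

Lemma cocycleV g x : c g^-1%g (act g x) = (c g x)^-1%g.
Proof.
have := cM g^-1%g g x; rewrite mulVg cocycle1 => e.
by apply: (mulgI (c g x)); rewrite -e mulgV.
Qed.

Lemma cocycle_bounded g : exists C, bounded_by C g.
Proof.
have [B FB] := simple_map_bounded (simple_map_comp F (c_simple g)).
by exists B => x; apply: le_trans (FB x); exact: ler_norm.
Qed.

Lemma simple_map_W g : simple_map (fun x => act g x \in W).
Proof. exact: (simple_map_precomp (act_measurable g) (simple_map_mem mW)). Qed.

Definition mean_length g : R := integ mu (fun x => F (c g x)).

(** The truncation is tested at the end point [act g x], so the substitution of [act k x] for [x]
    turns it into the truncation for [g * k]. *)
Definition decay g : R :=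
  integ mu (fun x => (act g x \in W)%:R * expR (- F (c g x))).

Definition local_slope h g : R :=
  integ mu (fun x => (act g x \in W)%:R * (F (c (h * g)%g x) - F (c g x))).

Lemma integ_act g (f : X -> R) : simple_map f ->
  integ mu (fun x => f (act g x)) = integ mu f.
Proof.
move=> sf; apply: integ_precomp => //; exact: act_invariant.
Qed.

Lemma simple_length g : simple_map (fun x => F (c g x)).
Proof. exact: simple_map_comp. Qed.

Lemma simple_decay g :
  simple_map (fun x => (act g x \in W)%:R * expR (- F (c g x))).
Proof.
exact: (simple_map2 (fun (b : bool) l => b%:R * expR (- F l)) (simple_map_W g)
  (c_simple g)).
Qed.

Lemma simple_slope h g :
  simple_map (fun x => (act g x \in W)%:R * (F (c (h * g)%g x) - F (c g x))).
Proof.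
exact: (simple_map2 (fun (b : bool) (l : H * H) => b%:R * (F l.1 - F l.2))
  (simple_map_W g) (simple_map_pair (c_simple (h * g)%g) (c_simple g))).
Qed.

Lemma mean_length_ge0 g : 0 <= mean_length g.
Proof. exact: integ_ge0. Qed.

Lemma mean_lengthV g : mean_length g^-1%g = mean_length g.
Proof.
rewrite /mean_length -(integ_act g (simple_length g^-1%g)).
by apply: eq_integ => x; rewrite cocycleV FV.
Qed.

(** After substituting [act k x] for [x], the two cocycle values differ by the left factor [c k x],
    whose length is at most [C]. *)
Lemma decay_right C g k : bounded_by C k ->
  decay g <= expR (C + kappa) * decay (g * k)%g.
Proof.
move=> kC; rewrite /decay -(integ_act k (simple_decay g)) -integZ; last first.
  exact: simple_decay.
apply: integ_le => [||x].
- by have := simple_map_precomp (act_measurable k) (simple_decay g).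
- exact: (simple_map_comp ( *%R _) (simple_decay _)).
rewrite actM mulrCA ler_wpM2l// -expRD ler_expR cM.
by have := FM (c k x) (c g (act k x)); have := kC x; lra.
Qed.

(** After the substitution by [k], the integrand combines the lengths of [b l a], [b l], [l a] and
    [l] as in [F_cross], with [a] and [b] values of [c] at [h] and [k]. The bound [expR (- F l)]
    integrates to [decay g]. *)
Lemma local_slope_right (C : R) : exists2 D : R, 0 <= D & forall g h k,
  bounded_by C h -> bounded_by C k ->
  `|local_slope h (g * k)%g - local_slope h g| <= D * decay g.
Proof.
have [D D0 FD] := F_cross C; exists D => // g h k hC kC.
rewrite /local_slope -(integ_act k (simple_slope h g)) -integB; first last.
- by have := simple_map_precomp (act_measurable k) (simple_slope h g).
- exact: simple_slope.
have s1 := simple_slope h (g * k)%g.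
have s2 := simple_map_precomp (act_measurable k) (simple_slope h g).
apply: le_trans (integ_norm _ (simple_map2 (fun u v => u - v) s1 s2)) _.
rewrite /decay -(integ_act k (simple_decay g)) -integZ; last first.
  by have := simple_map_precomp (act_measurable k) (simple_decay g).
apply: integ_le => [||x].
- exact: (simple_map_comp (@Num.norm _ _) (simple_map2 (fun u v => u - v) s1 s2)).
- exact: (simple_map_comp ( *%R _) (simple_map_precomp (act_measurable k) (simple_decay g))).
rewrite actM -mulrBr normrM ger0_norm// mulrCA ler_wpM2l//.
rewrite !cM actM.
set l := c g (act k x); set a := c h _; set b := c k x.
have -> : F (b * l * a)%g - F (b * l)%g - (F (l * a)%g - F l) =
  F (b * l * a)%g - F (b * l)%g - F (l * a)%g + F l by ring.
by apply: FD; [exact: hC|exact: kC].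
Qed.

Lemma mean_length_slope C h g : bounded_by C h ->
  `|mean_length (h * g)%g - mean_length g - local_slope h g| <=
  (C + kappa) * fine (mu (~` W)).
Proof.
move=> hC; have sF := simple_length; have sl := simple_slope h g.
have sd : simple_map (fun x => F (c (h * g)%g x) - F (c g x)).
  exact: (simple_map2 (fun u v => u - v)).
rewrite /mean_length /local_slope -integB// -integB//.
have s2 := simple_map2 (fun u v => u - v) sd sl.
apply: le_trans (integ_norm _ s2) _.
have mWc : measurable (~` W) by exact: measurableC.
have sWc := simple_map_comp (fun b : bool => b%:R : R) (simple_map_mem mWc).
rewrite -integ_mem// -(integ_act g sWc).
have s3 := simple_map_precomp (act_measurable g)
  (simple_map_comp (fun b : bool => b%:R : R) (simple_map_mem mWc)).
rewrite -integZ//; apply: integ_le => [||x].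
- exact: (simple_map_comp (@Num.norm _ _) s2).
- exact: (simple_map_comp ( *%R _) s3).
rewrite in_setC; case: (act g x \in W) => /=.
  by rewrite mul1r subrr normr0 mulr0.
rewrite mul0r subr0 mulr1 cM ler_norml; set l := c g x; set a := c h _.
have aC : F a <= C by exact: hC.
have := FM l a; have := FM (l * a)%g a^-1%g; rewrite mulgK FV.
lra.
Qed.

Context (Z : set G) (tau : G -> R) (T : R).
Hypothesis W_tame : forall x g, W x -> Z g -> c g x = 1%g -> tau g <= T.

(** Group the indices by the value of [c (g j) x]. If [j] and [j0] share a value, the cocycle
    identity gives [c = 1] for [g j * (g j0)^-1] at the point [act (g j0) x] of [W], so tameness
    leaves at most [K] indices for each value. *)
Lemma fiber_sum (J : finType) (g : J -> G) (K : nat) (x : X) :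
  (forall j j0, Z (g j * (g j0)^-1)%g) ->
  (forall j0, (#|[pred j | (tau (g j * (g j0)^-1)%g <= T)%R]| <= K)%N) ->
  \sum_j (act (g j) x \in W)%:R * expR (- (p * F (c (g j) x))) <= K%:R * S.
Proof.
move=> gZ gK.
have -> : \sum_j (act (g j) x \in W)%:R * expR (- (p * F (c (g j) x))) =
  \sum_(j | act (g j) x \in W) expR (- (p * F (c (g j) x))).
  by rewrite [RHS]big_mkcond; apply: eq_bigr => j _; case: ifP; rewrite ?mul1r ?mul0r.
pose s := undup [seq c (g j) x | j <- enum J].
have -> : \sum_(j | act (g j) x \in W) expR (- (p * F (c (g j) x))) =
  \sum_(l <- s) \sum_(j | (act (g j) x \in W) && (c (g j) x == l))
    expR (- (p * F l)).
  under [RHS]eq_bigr do rewrite big_mkcondr/=.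
  rewrite exchange_big/=; apply: eq_bigr => j _.
  rewrite (bigD1_seq (c (g j) x)) ?undup_uniq//=; last first.
    by rewrite mem_undup; apply: map_f; rewrite mem_enum.
  rewrite eqxx big1 ?addr0// => l; by rewrite eq_sym => /negbTE ->.
have S0 : \sum_(l <- s) expR (- (p * F l)) <= S.
  apply: F_summable; first exact: undup_uniq.
  by move=> l; rewrite mem_undup => /mapP[j _ ->].
apply: (@le_trans _ _ (\sum_(l <- s) K%:R * expR (- (p * F l)))); last first.
  by rewrite -mulr_sumr ler_wpM2l.
apply: ler_sum => l _; rewrite sumr_const -[leLHS]mulr_natl ler_wpM2r ?expR_ge0// ler_nat.
have [[j0 /andP[Wj0 /eqP lj0]]|no] := pselect (exists j0, (act (g j0) x \in W) && (c (g j0) x == l)).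
  apply: leq_trans (gK j0); apply: subset_leq_card; apply/fintype.subsetP => j.
  move=> /andP[_ /eqP lj]; rewrite unfold_in/=.
  apply: (@W_tame (act (g j0) x)); [exact/set_mem|exact: gZ|].
  have := cM (g j * (g j0)^-1)%g (g j0) x; rewrite mulgVK lj lj0 => e.
  by apply: (mulgI l); rewrite -e mulg1.
rewrite (eq_card0 (A := _))// => j; apply/negbTE/negP => hj; apply: no.
by exists j.
Qed.

(* Averaging over [k] is free by [decay_right]; it spreads out the translates
   that the family [g] alone would let cluster. *)
Lemma decay_sum (I V : finType) (g : I -> G) (k : V -> G) (K : nat) (C e e' : R) :
  (0 < #|V|)%N -> (forall v, bounded_by C (k v)) ->
  0 <= e -> 0 <= e' ->
  (forall t : R, 0 <= t -> expR (- t) <= e + e' * expR (- (p * t))) ->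
  (forall iv iv0 : I * V, Z (g iv.1 * k iv.2 * (g iv0.1 * k iv0.2)^-1)%g) ->
  (forall iv0 : I * V, (#|[pred iv : I * V |
     (tau (g iv.1 * k iv.2 * (g iv0.1 * k iv0.2)^-1)%g <= T)%R]| <= K * #|V|)%N) ->
  \sum_i decay (g i) <=
  expR (C + kappa) * (e * #|I|%:R + e' * (K%:R * S)) * fine (mu [set: X]).
Proof.
move=> V0 kC e0 e'0 young gZ gK.
pose J : finType := (I * V)%type; pose gk (iv : J) := (g iv.1 * k iv.2)%g.
have V0' : 0 < #|V|%:R :> R by rewrite ltr0n.
(* Every [i] is repeated once for each [v], so that [decay_right] applies to all pairs; the factor
   [#|V|] is the one in the bound [K * #|V|]. *)
rewrite -(ler_pM2l V0').
have -> : #|V|%:R * \sum_i decay (g i) = \sum_(iv : J) decay (g iv.1).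
  rewrite -(pair_bigA _ (fun i v => decay (g i)))/= mulr_sumr.
  by apply: eq_bigr => i _; rewrite sumr_const -[RHS]mulr_natl.
apply: (@le_trans _ _ (expR (C + kappa) * \sum_(iv : J) decay (gk iv))).
  by rewrite mulr_sumr; apply: ler_sum => iv _; exact: decay_right.
rewrite [leRHS]mulrCA -mulrA ler_wpM2l ?expR_ge0//.
have sW (iv : J) : simple_map (fun x =>
    (act (gk iv) x \in W)%:R * expR (- (p * F (c (gk iv) x))) : R).
  exact: (simple_map2 (fun (b : bool) l => b%:R * expR (- (p * F l)))
    (simple_map_W _) (c_simple _)).
rewrite /decay -integ_sum; last by move=> iv; exact: simple_decay.
(* By [young] each pair contributes [e], plus a term whose sum over the pairs is controlled by
   [fiber_sum]. *)
apply: (@le_trans _ _ (integ mu (fun x => e * #|J|%:R + e' *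
    \sum_(iv : J) (act (gk iv) x \in W)%:R * expR (- (p * F (c (gk iv) x)))))).
  apply: integ_le => [||x].
  - by apply: simple_map_sum => iv; exact: simple_decay.
  - exact: (simple_map_comp (fun t => e * _ + e' * t) (simple_map_sum sW)).
  rewrite mulr_sumr -[#|J|]sum1_card natr_sum mulr_sumr -big_split/=.
  apply: ler_sum => iv _.
  have := young _ (F_ge0 (c (gk iv) x)).
  by case: (_ \in _); rewrite ?mul1r ?mul0r ?mulr0 ?addr0 ?mulr1.
apply: (@le_trans _ _ (integ mu (fun x : X => e * #|J|%:R + e' *
    ((K * #|V|)%:R * S)))); last first.
  by rewrite integ_cst card_prod !natrM le_eqVlt; apply/orP; left; apply/eqP; ring.
apply: integ_le => [||x].
- exact: (simple_map_comp (fun t => e * _ + e' * t) (simple_map_sum sW)).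
- exact: simple_map_cst.
by rewrite lerD2l ler_wpM2l//; apply: fiber_sum.
Qed.

End Cocycle.

(** * Means over horospherical boxes *)

Section BoxSums.
Context (R : realType) (N : nat).
Implicit Types (u : ('I_N -> nat) -> R) (v w : 'I_N -> nat).

Definition box_sum (K : nat) u : R :=
  \sum_(w : {ffun 'I_N -> 'I_K}) u (fun j => w j).

Definition vadd v w : 'I_N -> nat := fun j => (v j + w j)%N.
Definition vscale (a : nat) v : 'I_N -> nat := fun j => (a * v j)%N.

Lemma vaddC v w : vadd v w = vadd w v.
Proof. by apply/funext => j; rewrite /vadd addnC. Qed.

Lemma vaddA v w w' : vadd v (vadd w w') = vadd (vadd v w) w'.
Proof. by apply/funext => j; rewrite /vadd addnA. Qed.

Lemma eq_box_sum K u u' :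
  (forall w, (forall j, (w j < K)%N) -> u w = u' w) -> box_sum K u = box_sum K u'.
Proof. by move=> uu'; apply: eq_bigr => w _; exact: uu'. Qed.

Lemma ler_box_sum K u u' : (forall w, u w <= u' w) -> box_sum K u <= box_sum K u'.
Proof. by move=> uu'; apply: ler_sum => w _. Qed.

Lemma box_sumB K u u' :
  box_sum K (fun w => u w - u' w) = box_sum K u - box_sum K u'.
Proof. by rewrite -sumrB. Qed.

Lemma box_sumZ K a u : box_sum K (fun w => a * u w) = a * box_sum K u.
Proof. by rewrite mulr_sumr. Qed.

Lemma box_sum_cst K a : box_sum K (fun _ => a) = (K ^ N)%:R * a.
Proof. by rewrite /box_sum sumr_const card_ffun !card_ord -[LHS]mulr_natl. Qed.

Lemma box_sum_norm K u : `|box_sum K u| <= box_sum K (fun w => `|u w|).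
Proof. exact: ler_norm_sum. Qed.

Lemma box_sum_ge0 K u : (forall w, 0 <= u w) -> 0 <= box_sum K u.
Proof. by move=> u0; apply: sumr_ge0. Qed.

Lemma exchange_box_sum K K' (f : ('I_N -> nat) -> ('I_N -> nat) -> R) :
  box_sum K (fun w => box_sum K' (f w)) =
  box_sum K' (fun e => box_sum K (fun w => f w e)).
Proof. exact: exchange_big. Qed.

(** Two uses: [b = 2] sorts the points [2 w + e] by parity, and [a = 2] cuts a box into translates
    of a box half as wide. *)
Lemma box_sum_digits a b u : (0 < b)%N ->
  box_sum (a * b) u =
  box_sum a (fun w => box_sum b (fun e => u (vadd (vscale b w) e))).
Proof.
move=> b0; rewrite /box_sum pair_bigA/=.
have lt1 (we : {ffun 'I_N -> 'I_a} * {ffun 'I_N -> 'I_b}) j :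
    (b * we.1 j + we.2 j < a * b)%N.
  rewrite (@leq_trans (b * (we.1 j).+1))//; last by rewrite mulnC leq_mul2r ltn_ord orbT.
  by rewrite mulnS addnC ltn_add2r ltn_ord.
pose h we : {ffun 'I_N -> 'I_(a * b)} := [ffun j => Ordinal (lt1 we j)].
have ltq (m : {ffun 'I_N -> 'I_(a * b)}) j : (m j %/ b < a)%N.
  by rewrite ltn_divLR// ltn_ord.
have ltr (m : {ffun 'I_N -> 'I_(a * b)}) j : (m j %% b < b)%N.
  by rewrite ltn_mod.
pose h' m : {ffun 'I_N -> 'I_a} * {ffun 'I_N -> 'I_b} :=
  ([ffun j => Ordinal (ltq m j)], [ffun j => Ordinal (ltr m j)]).
rewrite (reindex h)/=; last first.
  apply: onW_bij; exists h' => [[w e]|m].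
    congr pair; apply/ffunP => j; apply: val_inj; rewrite !ffunE/= ffunE/=.
      by rewrite mulnC divnMDl// divn_small ?addn0.
    by rewrite mulnC modnMDl modn_small.
  by apply/ffunP => j; apply: val_inj; rewrite !ffunE/= !ffunE/= mulnC -divn_eq.
apply: eq_bigr => -[w e] _; congr u; apply/funext => j.
by rewrite ffunE.
Qed.

Definition vunit (j : 'I_N) : 'I_N -> nat := fun i => (i == j : nat).

Lemma vsteps (f : ('I_N -> nat) -> R) B :
  (forall s j, `|f (vadd s (vunit j)) - f s| <= B) ->
  forall v, `|f v - f (fun _ => 0%N)| <= (\sum_j v j)%:R * B.
Proof.
move=> step v; move sv: (\sum_j v j)%N => n.
elim: n v sv => [|n IH] v sv.
  rewrite (_ : v = fun _ => 0%N) ?subrr ?normr0 ?mul0r//.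
  apply/funext => j; apply/eqP; rewrite -leqn0 -sv.
  by rewrite (bigD1 j)//= leq_addr.
have [j vj] : exists j, (0 < v j)%N.
  apply/existsP; apply/contraT => /existsPn v0.
  by move: sv; rewrite big1// => j _; apply/eqP; have := v0 j; rewrite lt0n negbK.
pose w : 'I_N -> nat := fun i => (v i - (i == j))%N.
have vE : v = vadd w (vunit j).
  apply/funext => i; rewrite /vadd /w /vunit subnK//.
  by case: eqP => // ->.
have s1 : (\sum_i vunit j i = 1)%N.
  by rewrite (bigD1 j)//= /vunit eqxx big1 ?addn0// => i /negbTE ->.
have sw : (\sum_j w j = n)%N.
  by apply: succn_inj; rewrite -sv [in RHS]vE /vadd big_split/= s1 addn1.
rewrite vE (le_trans (ler_distD (f w) _ _))//.
by rewrite -[n.+1]add1n natrD mulrDl mul1r lerD// IH.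
Qed.

End BoxSums.

Lemma geometric_drift (R : realType) (x : nat -> R) (a t : R) :
  0 <= a -> 0 < t -> t < 1 -> (forall k, `|x k.+1 - x k| <= a * t ^+ k) ->
  forall m k, `|x (k + m)%N - x k| <= a * t ^+ k / (1 - t).
Proof.
move=> a0 t0 t1 step m k.
have t1' : 0 < 1 - t by rewrite subr_gt0.
(* The exact partial sum of the geometric series makes the induction close. *)
have : `|x (k + m)%N - x k| <= a * t ^+ k * (1 - t ^+ m) / (1 - t).
  elim: m => [|m IH]; first by rewrite addn0 subrr normr0 expr0 subrr mulr0 mul0r.
  apply: le_trans (ler_distD (x (k + m)%N) _ _) _.
  have := step (k + m)%N; rewrite -addnS => st.
  apply: (le_trans (lerD st IH)).
  rewrite le_eqVlt; apply/orP; left; apply/eqP; rewrite exprD exprS.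
  by field; rewrite gt_eqF.
move/le_trans; apply.
rewrite ler_pM2r ?invr_gt0// ler_piMr// ?mulr_ge0// ?exprn_ge0 ?(ltW t0)//.
by rewrite gerBl exprn_ge0// ltW.
Qed.

Lemma geometric_small (R : realType) (t e : R) : 0 < t -> t < 1 -> 0 < e ->
  exists n0, forall n, (n0 <= n)%N -> t ^+ n < e.
Proof.
move=> t0 t1 e0.
have tc : `|t| < 1 by rewrite ger0_norm// ltW.
have := cvg_expr tc => /cvgrPdist_lt/(_ _ e0)[n0 _ nP].
by exists n0 => n /nP /=; rewrite sub0r normrN ger0_norm// exprn_ge0 ?ltW.
Qed.

(** Here [t / 2 = 2^(- q)] with [q = N / p > 1], which is why [t < 1]. The first term bounds
    [expR (- x)] when [x] exceeds [r q ln 2]; below this threshold the second does, since its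
    prefactor is [2^(r q (p - 1))] and [p > 1]. *)
Lemma young_split (R : realType) (N : nat) (p : R) : 1 < p -> p < N%:R ->
  exists t : R, [/\ 0 < t, t < 1 & forall r x, 0 <= x ->
    expR (- x) <= (t / 2) ^+ r + (t / 2) ^+ r * ((2 ^ r) ^ N)%:R * expR (- (p * x))].
Proof.
move=> p1 pN; have p0 : 0 < p by lra.
have l2 : 0 < ln 2 :> R by rewrite ln_gt0// ltr1n.
pose q := N%:R / p; have q1 : 1 < q by rewrite /q ltr_pdivlMr// mul1r.
have e2 : expR (ln 2) = 2 :> R by rewrite lnK// posrE.
pose t : R := expR ((1 - q) * ln 2); exists t; split.
- exact: expR_gt0.
- by rewrite -expR0 ltr_expR pmulr_llt0// subr_lt0.
move=> r x x0.
have -> : t / 2 = expR (- (q * ln 2)).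
  by rewrite -[X in _ / X]e2 -expRN -expRD; congr expR; ring.
have -> : ((2 ^ r) ^ N)%:R = expR (r%:R * N%:R * ln 2) :> R.
  rewrite -expnM natrX -{1}e2 -expRM_natl; congr expR.
  by rewrite natrM mulrC.
rewrite -expRM_natl.
have qp : q * p = N%:R by rewrite /q divfK// gt_eqF.
have [xr|xr] := lerP x (r%:R * (q * ln 2)); last first.
  rewrite -[leLHS]addr0 lerD ?mulr_ge0 ?expR_ge0//.
  by rewrite ler_expR mulrN lerN2 ltW.
rewrite -[leLHS]add0r lerD// ?expR_ge0// -!expRD ler_expR.
rewrite -qp mulrN.
have : 0 <= (p - 1) * (r%:R * (q * ln 2) - x) by rewrite mulr_ge0 ?subr_ge0// ltW.
by lra.
Qed.

(** * Mean slopes along a boost, and the growth of the mean length *)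

Section Dynamics.
Context (R : realType) d (X : measurableType d).
Context (mu : {finite_measure set X -> \bar R}) (G H : groupType).
Variable act : G -> X -> X.
Hypothesis act1 : forall x, act 1%g x = x.
Hypothesis actM : forall g h x, act (g * h)%g x = act g (act h x).
Hypothesis act_measurable : forall g, measurable_fun [set: X] (act g).
Hypothesis act_invariant : forall g A, measurable A -> mu (act g @^-1` A) = mu A.
Variables (F : H -> R) (kappa : R).
Hypothesis kappa_ge0 : 0 <= kappa.
Hypothesis F_ge0 : forall l, 0 <= F l.
Hypothesis FV : forall l, F l^-1%g = F l.
Hypothesis FM : forall a b, F (a * b)%g <= F a + F b + kappa.
Hypothesis F_cross : forall C, exists2 D : R, 0 <= D & forall a b l,
  F a <= C -> F b <= C ->
  `|F (b * l * a)%g - F (b * l)%g - F (l * a)%g + F l| <= D * expR (- F l).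
Variable c : G -> X -> H.
Hypothesis cM : forall g k x, c (g * k)%g x = (c k x * c g (act k x))%g.
Hypothesis c_simple : forall g, simple_map (c g).
Variable W : nat -> set X.
Hypothesis mW : forall T, measurable (W T).
Hypothesis W_full : forall e, 0 < e -> exists T, fine (mu (~` W T)) <= e.
Variables (N : nat) (t : R).
Hypotheses (t_gt0 : 0 < t) (t_lt1 : t < 1).

Local Notation ml := (mean_length mu F c).
Local Notation decay T := (decay mu act F c (W T)).
Local Notation slope T := (local_slope mu act F c (W T)).
Local Notation card r := (((2 ^ r) ^ N)%:R : R).
Local Notation bsum r := (@box_sum R N (2 ^ r)%N).
Local Notation pw A i := (A^-1 ^+ i)%g.

(** The constant may depend neither on [i], which runs through a telescoping sum, nor on [s], which
    moves the box. The rate [t / 2] leaves a factor [2^r] for the unit steps across a box. *)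
Definition decay_bound (A : G) (n : ('I_N -> nat) -> G) : Prop :=
  forall T, exists2 C : R, 0 <= C & forall i r s,
    bsum r (fun w => decay T (pw A i * n (vadd w s))%g) <= C * card r * (t / 2) ^+ r.

Let card_gt0 r : 0 < card r.
Proof. by rewrite ltr0n !expn_gt0. Qed.

Let cardS r : card r.+1 = card r * (2 ^ N)%:R.
Proof. by rewrite -natrM expnSr expnMn. Qed.

Lemma finite_bounded (J : finType) (g : J -> G) :
  exists C, forall j x, F (c (g j) x) <= C.
Proof.
have /choice[B gB] : forall j, exists C, forall x, F (c (g j) x) <= C.
  by move=> j; exact: (cocycle_bounded F c_simple).
exists (\sum_j `|B j|) => j x; apply: le_trans (gB j x) _.
by apply: le_trans (ler_norm _) _; rewrite (bigD1 j)//= lerDl sumr_ge0.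
Qed.

Section OneHorosphere.
Variables (A : G) (n : ('I_N -> nat) -> G).
Hypothesis nD : forall v w, n (vadd v w) = (n v * n w)%g.
Hypothesis nA : forall w, (A * n w)%g = (n (vscale 2 w) * A)%g.
Hypothesis dec : decay_bound A n.

Let step_dbl i w e : (pw A i.+1 * n (vadd (vscale 2 w) e))%g =
  (pw A i * n w * (A^-1 * n e))%g.
Proof.
rewrite nD expgSr !mulgA; congr (_ * _)%g.
by rewrite -!mulgA; congr (_ * _)%g; rewrite -[in LHS](mulgK A (n _)) -nA mulgA mulKg.
Qed.

Section Truncated.
Variable T : nat.

Let U i r := (card r)^-1 * bsum r (fun w => slope T A (pw A i * n w)%g).

(** Both comparisons multiply the argument of the slope on the right by bounded elements: [A^-1 n_e]
    when [i] and [r] grow together, unit translations when [r] alone grows. The total cost is a box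
    sum of [decay]. *)
Lemma slope_averages : exists2 D, 0 <= D & forall i r,
  `|U i.+1 r.+1 - U i r| <= D * t ^+ r /\ `|U i r.+1 - U i r| <= D * t ^+ r.
Proof.
have [C0 bA] := finite_bounded (fun _ : unit => A).
have [C1 bu] := finite_bounded (fun j : 'I_N => n (vunit j)).
have [C2 be] := finite_bounded (fun e : {ffun 'I_N -> 'I_2} => (A^-1 * n (fun j => e j))%g).
(* One bound for the left factor [A] and for both kinds of right factors. *)
pose B := Num.max C0 (Num.max C1 C2).
have [D D0 HD] := @local_slope_right R _ X mu G H act actM act_measurable
  act_invariant F F_cross c cM c_simple (W T) (mW T) B.
have {}bA x : F (c A x) <= B by rewrite le_max (bA tt).
have {}bu j x : F (c (n (vunit j)) x) <= B by rewrite !le_max bu orbT.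
have {}be (e : {ffun 'I_N -> 'I_2}) x : F (c (A^-1 * n (fun j => e j))%g x) <= B.
  by rewrite !le_max be !orbT.
have [C C_ge0 HC] := dec T.
have t2 r : 0 <= (t / 2) ^+ r by rewrite exprn_ge0// divr_ge0// ltW.
have tt2 r : (t / 2) ^+ r <= t ^+ r.
  by rewrite lerXn2r// ?nnegrE ?divr_ge0 ?(ltW t_gt0)// ler_pdivrMr// ler_peMr ?ltW// ltr1n.
have DC0 : 0 <= D * C by rewrite mulr_ge0.
(* [N.+1] dominates the number of coordinates and is at least 1, so one constant serves both
   estimates. *)
exists (D * C * N.+1%:R) => [|i r]; first by rewrite mulr_ge0.
have dec0 s : bsum r (fun w => D * decay T (pw A i * n (vadd w s))%g) <=
    D * C * card r * (t / 2) ^+ r.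
  by rewrite box_sumZ -!mulrA ler_wpM2l// mulrA.
split.
  have -> : U i.+1 r.+1 - U i r = (card r.+1)^-1 * bsum r (fun w => box_sum 2 (fun e =>
      slope T A (pw A i * n w * (A^-1 * n e))%g - slope T A (pw A i * n w)%g)).
    rewrite /U (_ : bsum r.+1 _ = bsum r (fun w => box_sum 2 (fun e =>
      slope T A (pw A i * n w * (A^-1 * n e))%g))); last first.
      rewrite expnSr box_sum_digits//; apply: eq_box_sum => w _.
      by apply: eq_box_sum => e _; rewrite step_dbl.
    rewrite (_ : bsum r (fun w => box_sum 2 (fun e => _ - _)) =
      bsum r (fun w => box_sum 2 (fun e =>
        slope T A (pw A i * n w * (A^-1 * n e))%g)) -
      (2 ^ N)%:R * bsum r (fun w => slope T A (pw A i * n w)%g)); last first.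
      rewrite -box_sumZ -box_sumB; apply: eq_box_sum => w _.
      by rewrite box_sumB box_sum_cst.
    by rewrite mulrBr; congr (_ - _); rewrite cardS invfM -mulrA mulKf// pnatr_eq0 expn_eq0.
  rewrite normrM gtr0_norm ?invr_gt0// mulrC ler_pdivrMr//.
  apply: le_trans (box_sum_norm _ _) _.
  apply: (@le_trans _ _ (bsum r (fun w => (2 ^ N)%:R * (D * decay T (pw A i * n (vadd w (fun _ => 0%N)))%g)))).
    apply: ler_box_sum => w; apply: le_trans (box_sum_norm _ _) _.
    rewrite -box_sum_cst; apply: ler_sum => e _.
    rewrite (_ : vadd w _ = w); first by apply: HD.
    by apply/funext => j; rewrite /vadd addn0.
  rewrite box_sumZ cardS [leRHS]mulrA [leLHS]mulrC ler_wpM2r//.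
  apply: le_trans (dec0 _) _.
  rewrite [leRHS](_ : _ = D * C * card r * (N.+1%:R * t ^+ r)); last by ring.
  rewrite ler_wpM2l ?mulr_ge0 ?(ltW (card_gt0 r))//.
  by apply: le_trans (tt2 r) _; rewrite ler_peMl ?exprn_ge0 ?(ltW t_gt0)// ler1n.
(* The larger box consists of translates by [2^r e] of the smaller one; each is reached in at most
   [N * 2^r] unit steps, and this factor [2^r] turns the rate [t / 2] into [t]. *)
have -> : U i r.+1 - U i r = (card r.+1)^-1 * box_sum 2 (fun e : 'I_N -> nat =>
    bsum r (fun w => slope T A (pw A i * n (vadd w (vscale (2 ^ r) e)))%g) -
    bsum r (fun w => slope T A (pw A i * n (vadd w (fun _ => 0%N)))%g)).
  rewrite /U (_ : bsum r.+1 _ = box_sum 2 (fun e => bsum r (fun w =>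
    slope T A (pw A i * n (vadd w (vscale (2 ^ r) e)))%g))); last first.
    rewrite expnS box_sum_digits ?expn_gt0//; apply: eq_box_sum => e _.
    by apply: eq_box_sum => w _; rewrite vaddC.
  rewrite box_sumB box_sum_cst mulrBr; congr (_ - _).
  rewrite cardS invfM -mulrA mulKf ?pnatr_eq0 ?expn_eq0//; congr (_ * _).
  apply: eq_box_sum => w _; congr (local_slope _ _ _ _ _ _ (_ * n _)%g).
  by apply/funext => j; rewrite /vadd addn0.
rewrite normrM gtr0_norm ?invr_gt0// mulrC ler_pdivrMr//.
apply: le_trans (box_sum_norm _ _) _.
rewrite (_ : _ * card r.+1 = box_sum 2 (fun _ : 'I_N -> nat =>
  D * C * N.+1%:R * t ^+ r * card r)); last by rewrite box_sum_cst cardS; ring.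
apply: ler_sum => e _; set v := vscale _ _.
pose f s := bsum r (fun w => slope T A (pw A i * n (vadd w s))%g).
have := @vsteps R N f (D * C * card r * (t / 2) ^+ r).
rewrite /f => /(_ _ v) st; apply: le_trans (st _) _.
  move=> s j; rewrite -box_sumB; apply: le_trans (dec0 s).
  apply: le_trans (box_sum_norm _ _) _; apply: ler_box_sum => w.
  by rewrite vaddA nD mulgA; exact: HD.
have sv : (\sum_j v j <= N.+1 * 2 ^ r)%N.
  apply: (@leq_trans (\sum_(j < N) 2 ^ r)); last first.
    by rewrite sum_nat_const card_ord leq_mul2r leqnSn orbT.
  by apply: leq_sum => j _; rewrite /v /vscale -[leqRHS]muln1 leq_mul2l -ltnS ltn_ord orbT.
rewrite (@le_trans _ _ ((N.+1 * 2 ^ r)%:R * (D * C * card r * (t / 2) ^+ r)))//.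
  by rewrite ler_wpM2r ?ler_nat// !mulr_ge0.
rewrite natrM natrX expr_div_n le_eqVlt; apply/orP; left; apply/eqP; field.
by rewrite expf_neq0.
Qed.

End Truncated.

(** The means change little with [i], while their sum over successive [i] telescopes and is bounded
    by a nonnegative mean length at the fixed scale [r0]. *)
Lemma slope_mean_le e : 0 < e -> exists r1, forall r, (r1 <= r)%N -> forall i,
  bsum r (fun w => ml (A * (pw A i * n w))%g - ml (pw A i * n w)%g) <= e * card r.
Proof.
move=> e0; have [CA bA] := cocycle_bounded F c_simple A.
have CAk : 0 < `|CA| + kappa + 1 by rewrite ltr_wpDl// addr_ge0.
have {}bA x : F (c A x) <= `|CA| + 1.
  by apply: le_trans (bA x) _; rewrite (le_trans (ler_norm _))// lerDl.
have [T WT] : exists T, (`|CA| + 1 + kappa) * fine (mu (~` W T)) <= e / 8.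
  have [|T WT] := W_full (e := (e / 8) / (`|CA| + kappa + 1)).
    by rewrite !divr_gt0.
  by exists T; move: WT; rewrite ler_pdivlMr// mulrC addrAC.
have [D D0 HD] := slope_averages T.
pose U i r := (card r)^-1 * bsum r (fun w => slope T A (pw A i * n w)%g).
pose Th i r := (card r)^-1 *
  bsum r (fun w => ml (A * (pw A i * n w))%g - ml (pw A i * n w)%g).
pose Psi i r := (card r)^-1 * bsum r (fun w => ml (pw A i * n w)%g).
have ThU i r : `|Th i r - U i r| <= e / 8.
  rewrite /Th /U -mulrBr -box_sumB normrM gtr0_norm ?invr_gt0// mulrC ler_pdivrMr//.
  apply: le_trans (box_sum_norm _ _) _; rewrite mulrC -box_sum_cst.
  apply: ler_box_sum => w; apply: le_trans WT.
  exact: (mean_length_slope act_measurable act_invariant FV FM cM c_simple (mW T)).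
have ThP i r : Th i.+1 r = Psi i r - Psi i.+1 r.
  rewrite /Th /Psi -mulrBr -box_sumB; congr (_ * _); apply: eq_box_sum => w _.
  by rewrite expgS !mulgA mulgV mul1g.
have Psi0 i r : 0 <= Psi i r.
  by rewrite mulr_ge0 ?invr_ge0// box_sum_ge0// => w; exact: mean_length_ge0.
pose E := D / (1 - t); have t1' : 0 < 1 - t by rewrite subr_gt0.
have E0 : 0 <= E by rewrite divr_ge0// ltW.
have drift1 i r m : `|U (i + m)%N (r + m)%N - U i r| <= E * t ^+ r.
  have := @geometric_drift R (fun k => U (i + k)%N (r + k)%N) (D * t ^+ r) t.
  move=> /(_ _ t_gt0 t_lt1 _ m 0%N); rewrite !addn0 expr0 mulr1 add0n.
  rewrite /E mulrAC; apply; first by rewrite mulr_ge0// exprn_ge0// ltW.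
  by move=> k; rewrite !addnS -mulrA -exprD; have [] := HD (i + k)%N (r + k)%N.
have drift2 i r m : `|U i (r + m)%N - U i r| <= E * t ^+ r.
  have := @geometric_drift R (fun k => U i k) D t D0 t_gt0 t_lt1.
  by move=> /(_ _ m r); rewrite /E mulrAC; apply => k; have [] := HD i k.
have [r0 Hr0] : exists r0, E * t ^+ r0 <= e / 8.
  have e1 : 0 < e / 8 / (E + 1) by rewrite !divr_gt0// ltr_wpDl.
  have [r0 /(_ r0 (leqnn _)) tr0] := geometric_small t_gt0 t_lt1 e1.
  exists r0; move: tr0; rewrite ltr_pdivlMr ?ltr_wpDl// => /ltW.
  have : 0 <= t ^+ r0 by rewrite exprn_ge0// ltW.
  by nra.
have small r : (r0 <= r)%N -> E * t ^+ r <= e / 8.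
  move=> r0r; apply: le_trans Hr0; rewrite ler_wpM2l//.
  by rewrite ler_wiXn2l// ?ltW.
exists r0 => r r0r i.
suff : Th i r <= e by rewrite /Th mulrC ler_pdivrMr.
(* Raise [i] and [r] together by [j.+1], then lower the scale to [r0] at fixed [i]. With the two
   truncation errors this makes four errors of [e / 8]. *)
have cmp j : Th i r <= Th (i + j.+1)%N r0 + e / 2.
  have := ThU i r; have := ThU (i + j.+1)%N r0.
  have := drift1 i r j.+1; have := small _ r0r.
  have := drift2 (i + j.+1)%N r0 (r + j.+1 - r0)%N.
  rewrite subnKC; last by rewrite (leq_trans r0r)// leq_addr.
  have := Hr0; rewrite !ler_norml.
  lra.
(* [J] terms dilute the boundary value [Psi i r0] to [e / 2] per term. [J] may depend on [i], since
   [r0] does not. *)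
pose J := (Num.truncn (2 * Psi i r0 / e)).+1.
have JP : Psi i r0 <= J%:R * (e / 2).
  have : 2 * Psi i r0 / e <= J%:R.
    by rewrite ltW// /J truncnS_gt.
  by rewrite ler_pdivrMr// => ?; lra.
have telescope m : \sum_(j < m) Th (i + j.+1)%N r0 = Psi i r0 - Psi (i + m)%N r0.
  elim: m => [|m IH]; first by rewrite big_ord0 addn0 subrr.
  by rewrite big_ord_recr/= IH addnS ThP; ring.
have : J%:R * Th i r <= Psi i r0 + J%:R * (e / 2).
  have : \sum_(j < J) Th i r <= \sum_(j < J) (Th (i + j.+1)%N r0 + e / 2).
    by apply: ler_sum => j _; exact: cmp.
  rewrite big_split/= telescope !sumr_const card_ord -[leLHS]mulr_natl -[X in _ + X]mulr_natl => h.
  by apply: le_trans h _; rewrite lerD2r gerBl.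
have J0 : 0 < J%:R :> R by rewrite ltr0n.
move=> h; rewrite -(ler_pM2l J0); lra.
Qed.

End OneHorosphere.

(** A form of Markov's inequality: [s * (1 - expR (s - F)) <= F], because the left side is at most
    [s] when [s <= F] and nonpositive otherwise. *)
Lemma mean_length_ge T s g : 0 <= s ->
  s * (fine (mu (W T)) - expR s * decay T g) <= ml g.
Proof.
move=> s0.
have sW := simple_map_W act_measurable (mW T) g.
have sd := simple_decay act_measurable F c_simple (mW T) g.
have sWr := simple_map_comp (fun b : bool => b%:R : R) (simple_map_mem (mW T)).
have sWg := simple_map_precomp (act_measurable g) sWr.
have sed := simple_map_comp ( *%R (expR s)) sd.
rewrite -integ_mem// -(integ_act act_measurable act_invariant g sWr).
have -> : decay T g = integ mu (fun x => (act g x \in W T)%:R * expR (- F (c g x))) by [].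
rewrite -integZ// -integB// -integZ; last exact: (simple_map2 (fun u v => u - v)).
apply: integ_le => [||x].
- exact: (simple_map_comp ( *%R s) (simple_map2 (fun u v => u - v) sWg sed)).
- exact: simple_map_comp.
case: (_ \in _) => /=; last by rewrite mul0r mulr0 subrr mulr0.
rewrite mul1r -expRD; have [sF|Fs] := lerP s (F (c g x)).
  apply: le_trans sF; rewrite ler_piMr// gerBl; exact: expR_ge0.
apply: le_trans (F_ge0 _); rewrite mulr_ge0_le0// subr_le0.
by rewrite -expR0 ler_expR subr_ge0 ltW.
Qed.

(* The mean of [mean_length] over large boxes grows linearly in [r], by counting,
   but its increments are made of left slopes and tend to zero. *)
Lemma decay_bound_contradiction (A : G) (n : ('I_N -> nat) -> G) :
  0 < fine (mu [set: X]) ->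
  (forall v w, n (vadd v w) = (n v * n w)%g) ->
  (forall w, (A * n w)%g = (n (vscale 2 w) * A)%g) ->
  decay_bound A n ->
  (forall e, decay_bound ((n e)^-1 * A)%g (fun w => (n w)^-1%g)) -> False.
Proof.
move=> m0 nD nA dA dAe; set m := fine _ in m0.
have nC v w : (n v * n w = n w * n v)%g by rewrite -nD vaddC nD.
have l2 : 0 < ln 2 :> R by rewrite ln_gt0// ltr1n.
pose Psi r := (card r)^-1 * bsum r (fun w => ml (n w)).
have Psi0 r : 0 <= Psi r.
  by rewrite mulr_ge0 ?invr_ge0// box_sum_ge0// => w; exact: mean_length_ge0.
have nVD v w : ((n (vadd v w))^-1 = (n v)^-1 * (n w)^-1)%g.
  by rewrite nD nC invgM.
have nVA e w : ((n e)^-1 * A * (n w)^-1 = (n (vscale 2 w))^-1 * ((n e)^-1 * A))%g.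
  have -> : (A * (n w)^-1 = (n (vscale 2 w))^-1 * A)%g ->
      ((n e)^-1 * A * (n w)^-1 = (n (vscale 2 w))^-1 * ((n e)^-1 * A))%g.
    move=> AV; rewrite -mulgA AV !mulgA; congr (_ * _)%g.
    by rewrite -!invgM nC.
  - by [].
  apply: (mulgI (n (vscale 2 w))); rewrite mulgA -nA -mulgA mulgV mulg1.
  by rewrite mulgA mulgV mul1g.
(* The lower bound [grow] has slope [ln 2 * m / 4 = 4 * eta] in [r], against at most [2 * eta] for
   the increments. *)
pose eta := ln 2 * m / 16; have eta0 : 0 < eta by rewrite divr_gt0 ?mulr_gt0.
have [r1 H1] := slope_mean_le nD nA dA eta0.
have /choice[r2 H2] : forall e : {ffun 'I_N -> 'I_2}, exists r2, forall r, (r2 <= r)%N ->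
    bsum r (fun w => ml ((n (fun j => e j))^-1 * A * (n w)^-1)%g - ml ((n w)^-1)%g) <=
    eta * card r.
  move=> e; have [r2 H2] := slope_mean_le nVD (nVA (fun j => e j)) (dAe (fun j => e j)) eta0.
  exists r2 => r /H2/(_ 0%N); apply: le_trans; rewrite le_eqVlt; apply/orP; left; apply/eqP.
  by apply: eq_box_sum => w _; rewrite expg0 mul1g.
pose r3 := (r1 + \sum_e r2 e)%N.
have incr r : (r3 <= r)%N -> Psi r.+1 <= Psi r + 2 * eta.
  move=> r3r.
  have r1r : (r1 <= r.+1)%N by rewrite ltnW// ltnS (leq_trans _ r3r)// leq_addr.
  have := H1 _ r1r 1%N; rewrite expg1 box_sumB.
  rewrite (_ : bsum r.+1 (fun w => ml (A * (A^-1 * n w))%g) =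
    bsum r.+1 (fun w => ml (n w))); last first.
    by apply: eq_box_sum => w _; rewrite mulgA mulgV mul1g.
  (* Inverting [A^-1 n_(2 w + e) = n_w A^-1 n_e] gives [n_e^-1 A n_w^-1], of the same mean length: a
     left slope for the inverted family. *)
  have -> : bsum r.+1 (fun w => ml (A^-1 * n w)%g) = box_sum 2 (fun e =>
      bsum r (fun w => ml ((n e)^-1 * A * (n w)^-1)%g)).
    rewrite expnSr box_sum_digits// exchange_box_sum.
    apply: eq_box_sum => e _; apply: eq_box_sum => w _.
    rewrite -(mean_lengthV act1 act_measurable act_invariant FV cM c_simple).
    congr (mean_length _ _ _ _); rewrite invgM invgK nD invgM -!mulgA; congr (_ * _)%g.
    apply: (mulgI (n (vscale 2 w))); rewrite !mulgA mulgV mul1g -nA -mulgA.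
    by rewrite mulgV mulg1.
  move=> h.
  have : box_sum 2 (fun e => bsum r (fun w => ml ((n e)^-1 * A * (n w)^-1)%g)) <=
      box_sum 2 (fun _ : 'I_N -> nat => eta * card r + bsum r (fun w => ml (n w))).
    apply: ler_sum => e _.
    have r2r : (r2 e <= r)%N.
      by rewrite (leq_trans _ r3r)// /r3 (bigD1 e)//= addnCA leq_addr.
    have := H2 e r r2r; rewrite box_sumB lerBlDr => /le_trans; apply.
    rewrite lerD2l; apply: ler_box_sum => w.
    by rewrite (mean_lengthV act1 act_measurable act_invariant FV cM c_simple).
  rewrite box_sum_cst => h'.
  rewrite /Psi [leLHS]mulrC ler_pdivrMr//.
  have -> : ((card r)^-1 * bsum r (fun w => ml (n w)) + 2 * eta) * card r.+1 =
      eta * card r.+1 + (2 ^ N)%:R * (eta * card r + bsum r (fun w => ml (n w))).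
    by rewrite cardS; field; rewrite gt_eqF.
  by move: h h'; lra.
clearbody r3.
have [T WT] : exists T, fine (mu (~` W T)) <= m / 2 by apply: W_full; rewrite divr_gt0.
have {}WT : m / 2 <= fine (mu (W T)).
  have : m = fine (mu (W T)) + fine (mu (~` W T)).
    rewrite /m -fineD ?fin_num_measure//; last exact: measurableC.
    rewrite -measureU ?setUv ?setICr//; exact: measurableC.
  by lra.
have [C C0 HC] := dA T.
have [r4 H4] := geometric_small t_gt0 t_lt1 (e := m / 4 / (C + 1))
  (divr_gt0 (divr_gt0 m0 (ltr0n _ 4)) (ltr_wpDl C0 ltr01)).
have grow r : (r4 <= r)%N -> r%:R * (ln 2 * m / 4) <= Psi r.
  (* [mean_length_ge] is applied with [s = r ln 2]: its factor [expR s = 2^r] is absorbed by the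
     rate [(t / 2)^r]. *)
  move=> /H4 tr; have s0 : 0 <= r%:R * ln 2 :> R by rewrite mulr_ge0// ltW.
  have := HC 0%N r (fun _ => 0%N); set B := bsum r _ => hB.
  have e2 : expR (r%:R * ln 2) = 2 ^+ r :> R by rewrite expRM_natl lnK// posrE.
  have : bsum r (fun w => r%:R * ln 2 * (fine (mu (W T)) - 2 ^+ r *
      decay T (pw A 0 * n (vadd w (fun _ => 0%N)))%g)) <= bsum r (fun w => ml (n w)).
    apply: ler_box_sum => w.
    have := mean_length_ge T (n w) s0; rewrite e2 expg0 mul1g.
    by rewrite (_ : vadd w _ = w)//; apply/funext => j; rewrite /vadd addn0.
  rewrite box_sumZ box_sumB box_sum_cst box_sumZ -/B => h.
  rewrite /Psi [leRHS]mulrC ler_pdivlMr//; apply: le_trans h.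
  rewrite -!mulrA ler_wpM2l// ler_wpM2l ?(ltW l2)//.
  have hB' : 2 ^+ r * B <= C * t ^+ r * card r.
    apply: (@le_trans _ _ (2 ^+ r * (C * card r * (t / 2) ^+ r))).
      by rewrite ler_wpM2l// exprn_ge0.
    rewrite expr_div_n le_eqVlt; apply/orP; left; apply/eqP; field.
    by rewrite expf_neq0.
  have tC : C * t ^+ r <= m / 4.
    move: tr; rewrite ltr_pdivlMr ?ltr_wpDl// => tr.
    have : 0 <= t ^+ r by rewrite exprn_ge0// ltW.
    by nra.
  have c0 := card_gt0 r.
  by nra.
have lin k : Psi (r3 + r4 + k)%N <= Psi (r3 + r4)%N + k%:R * (2 * eta).
  elim: k => [|k IH]; first by rewrite addn0 mul0r addr0.
  rewrite addnS -natr1 mulrDl mul1r.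
  have := incr (r3 + r4 + k)%N; rewrite -{1}addnA leq_addr => /(_ isT).
  by move: IH; lra.
pose k := (Num.truncn (Psi (r3 + r4)%N / (2 * eta))).+1.
have kP : Psi (r3 + r4)%N < k%:R * (2 * eta).
  have : Psi (r3 + r4)%N / (2 * eta) < k%:R by rewrite /k truncnS_gt.
  by rewrite ltr_pdivrMr// mulr_gt0.
clearbody k; have r4k : (r4 <= r3 + r4 + k)%N by rewrite addnAC leq_addl.
have := le_trans (grow _ r4k) (lin k).
rewrite !natrD (_ : ln 2 * m / 4 = 4 * eta); last by rewrite /eta; field.
have : 0 <= r3%:R * eta by rewrite mulr_ge0// ltW.
have : 0 <= r4%:R * eta by rewrite mulr_ge0// ltW.
by lra.
Qed.

End Dynamics.

Lemma bigcup_countable_measurable d (X : measurableType d) (I : Type)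
    (D : set I) (F : I -> set X) : countable D ->
  (forall i, D i -> measurable (F i)) -> measurable (\bigcup_(i in D) F i).
Proof.
move=> /countable_injP[f finj] mF.
have -> : \bigcup_(i in D) F i = \bigcup_n \bigcup_(i in D `&` f @^-1` [set n]) F i.
  apply/seteqP; split=> [x [i Di Fx]|x [n _ [i [Di _] Fx]]]; last by exists i.
  by exists (f i) => //; exists i.
apply: bigcupT_measurable => n.
have [[i [Di fi]]|none] := pselect (exists i, D i /\ f i = n).
  rewrite (_ : \bigcup_(_ in _) _ = F i); first exact: mF.
  apply/seteqP; split=> [x [j [Dj fj] Fx]|x Fx]; last by exists i.
  have ji : j = i by apply: finj; [exact: mem_set|exact: mem_set|rewrite fj fi].
  by rewrite -ji.
rewrite (_ : \bigcup_(_ in _) _ = set0)//.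
by apply/seteqP; split=> // x [j [Dj fj] _]; apply: none; exists j.
Qed.

(** * Sets on which the return elements are bounded *)

Section TameSets.
Context (R : realType) d (X : measurableType d).
Context (mu : {finite_measure set X -> \bar R}) (G H : groupType).
Variables (c : G -> X -> H) (Z : set G) (tau : G -> R).
Hypothesis c_simple : forall g, simple_map (c g).
Hypothesis Z_countable : countable Z.

(** Only [g] in the countable set [Z] are tested, so that the set is measurable. *)
Definition tame (T : nat) : set X :=
  [set x | forall g, Z g -> c g x = 1%g -> tau g <= T%:R].

Lemma measurable_tame T : measurable (tame T).
Proof.
have -> : tame T = \bigcap_(g in Z) [set x | c g x = 1%g -> tau g <= T%:R].
  by apply/seteqP; split=> x h g Zg; exact: h.
rewrite -[X in measurable X]setCK setC_bigcap; apply: measurableC.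
apply: bigcup_countable_measurable => // g Zg; apply: measurableC.
case: (lerP (tau g) T%:R) => tT.
  rewrite (_ : [set _ | _] = [set: X])//.
  by apply/seteqP; split.
rewrite (_ : [set _ | _] = ~` (c g @^-1` [set 1%g])).
  by apply: measurableC; have [] := c_simple g.
apply/seteqP; split=> x /=.
  by move=> h /h.
by move=> c1 /c1.
Qed.

(** The complements of the tame sets decrease to a null set, and the measure is finite. *)
Lemma tame_full :
  {ae mu, forall x, exists T : nat, forall g, Z g -> c g x = 1%g -> tau g <= T%:R} ->
  forall e, 0 < e -> exists T, fine (mu (~` tame T)) <= e.
Proof.
move=> [B [mB B0 subB]] e e0.
pose D T := ~` tame T.
have mD T : measurable (D T) by exact/measurableC/measurable_tame.
have D0 : mu (\bigcap_T D T) = 0%E.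
  apply: (subset_measure0 _ mB _ B0); first exact: bigcapT_measurable.
  move=> x Dx; apply: subB => -[T xT].
  by apply: (Dx T I) => g Zg cg; exact: xT.
have := @nonincreasing_cvg_mu _ _ _ mu D.
have Dfin : (mu (D 0%N) < +oo)%E by rewrite ltey_eq fin_num_measure.
move=> /(_ Dfin mD (bigcapT_measurable mD)).
have Dni : nonincreasing_seq D.
  move=> a b ab; apply/subsetPset => x /= nx hx; apply: nx => g Zg cg.
  by apply: le_trans (hx _ Zg cg) _; rewrite ler_nat.
move=> /(_ Dni) cv; have {cv} : (mu \o D) @ \oo --> 0%E by rewrite -D0; exact: cv.
move=> /fine_cvgP[_] /cvgrPdist_le/(_ _ e0)[T _ /(_ T (leqnn T))] /=.
rewrite sub0r normrN => h; exists T; apply: le_trans h; exact: ler_norm.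
Qed.

End TameSets.

Section CocycleContradiction.
Context (R : realType) d (X : measurableType d).
Context (mu : {finite_measure set X -> \bar R}) (G H : groupType).
Variable act : G -> X -> X.
Hypothesis act1 : forall x, act 1%g x = x.
Hypothesis actM : forall g h x, act (g * h)%g x = act g (act h x).
Hypothesis act_measurable : forall g, measurable_fun [set: X] (act g).
Hypothesis act_invariant : forall g A, measurable A -> mu (act g @^-1` A) = mu A.
Variables (F : H -> R) (kappa : R).
Hypothesis kappa_ge0 : 0 <= kappa.
Hypothesis F_ge0 : forall l, 0 <= F l.
Hypothesis FV : forall l, F l^-1%g = F l.
Hypothesis FM : forall a b, F (a * b)%g <= F a + F b + kappa.
Hypothesis F_cross : forall C, exists2 D : R, 0 <= D & forall a b l,
  F a <= C -> F b <= C ->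
  `|F (b * l * a)%g - F (b * l)%g - F (l * a)%g + F l| <= D * expR (- F l).
Variables (L : set H) (N : nat) (p S : R).
Hypotheses (p_gt1 : 1 < p) (p_ltN : p < N%:R).
Hypothesis F_summable : forall s : seq H, uniq s -> (forall l, l \in s -> L l) ->
  \sum_(l <- s) expR (- (p * F l)) <= S.
Variable c : G -> X -> H.
Hypothesis c_in : forall g x, L (c g x).
Hypothesis cM : forall g k x, c (g * k)%g x = (c k x * c g (act k x))%g.
Hypothesis c_simple : forall g, simple_map (c g).
Variables (Z : set G) (tau : G -> R).
Hypothesis Z_countable : countable Z.
Hypothesis c_tame : {ae mu, forall x, exists T : nat, forall g, Z g ->
  c g x = 1%g -> tau g <= T%:R}.

(** The order of the quantifiers matters: the family [k] may grow with [i], but its length bound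
    [C0] and the multiplicity [K] may not. *)
Definition horosphere_count (A : G) (n : ('I_N -> nat) -> G) : Prop :=
  exists C0, forall T, exists K : nat, forall i, exists (V : finType) (k : V -> G),
  [/\ (0 < #|V|)%N, forall v x, F (c (k v) x) <= C0 &
    forall r (s : 'I_N -> nat),
    let g (wv : {ffun 'I_N -> 'I_(2 ^ r)} * V) :=
      (A^-1 ^+ i * n (vadd (fun j => wv.1 j) s) * k wv.2)%g in
    forall wv0, (forall wv, Z (g wv * (g wv0)^-1)%g) /\
      (#|[pred wv | (tau (g wv * (g wv0)^-1)%g <= T)%R]| <= K * #|V|)%N].

Lemma decay_bound_count (t : R) (A : G) (n : ('I_N -> nat) -> G) :
  0 < t ->
  (forall r x, 0 <= x -> expR (- x) <= (t / 2) ^+ r +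
    (t / 2) ^+ r * ((2 ^ r) ^ N)%:R * expR (- (p * x))) ->
  horosphere_count A n -> decay_bound mu act F c (tame c Z tau) t A n.
Proof.
move=> t0 young [C0 count] T.
have [K HK] := count T%:R.
have S0 : 0 <= S by have := F_summable (s := [::]); rewrite big_nil; apply.
have m0 : 0 <= fine (mu [set: X]) by rewrite fine_ge0.
exists (expR (C0 + kappa) * (1 + K%:R * S) * fine (mu [set: X])).
  by rewrite !mulr_ge0 ?expR_ge0// addr_ge0// mulr_ge0.
move=> i r s; have [V [k [V0 kC0 gk]]] := HK i.
have t20 : 0 <= (t / 2) ^+ r by rewrite exprn_ge0// divr_ge0// ltW.
pose g (w : {ffun 'I_N -> 'I_(2 ^ r)}) := (A^-1 ^+ i * n (vadd (fun j => w j) s))%g.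
have Tt x h : tame c Z tau T x -> Z h -> c h x = 1%g -> tau h <= T%:R.
  by move=> + Zh ch; apply.
have := @decay_sum R _ X mu G H act actM act_measurable act_invariant F kappa F_ge0 FM
  L p S F_summable c c_in cM c_simple (tame c Z tau T)
  (measurable_tame tau c_simple Z_countable T) Z tau T%:R Tt _ V g k K C0
  ((t / 2) ^+ r) ((t / 2) ^+ r * ((2 ^ r) ^ N)%:R) V0 kC0 t20.
rewrite card_ffun !card_ord => /(_ (mulr_ge0 t20 (ler0n _ _)) (young r)) h.
have {}h := h (fun iv iv0 => (gk r s iv0).1 iv) (fun iv0 => (gk r s iv0).2).
apply: le_trans h _; rewrite le_eqVlt; apply/orP; left; apply/eqP; ring.
Qed.

Theorem cocycle_contradiction (A : G) (n : ('I_N -> nat) -> G) :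
  mu [set: X] != 0%E ->
  (forall v w, n (vadd v w) = (n v * n w)%g) ->
  (forall w, (A * n w)%g = (n (vscale 2 w) * A)%g) ->
  horosphere_count A n ->
  (forall e, horosphere_count ((n e)^-1 * A)%g (fun w => (n w)^-1%g)) -> False.
Proof.
move=> m0 nD nA hA hAe; have [t [t0 t1 young]] := young_split p_gt1 p_ltN.
apply: (decay_bound_contradiction act1 actM act_measurable act_invariant kappa_ge0
  F_ge0 FV FM F_cross cM c_simple (measurable_tame tau c_simple Z_countable)
  (tame_full c_simple Z_countable c_tame) t0 t1 _ nD nA).
- by rewrite fine_gt0// ltey_eq fin_num_measure// andbT lt0e m0 measure_ge0.
- exact: decay_bound_count.
- by move=> e; exact: decay_bound_count.
Qed.

End CocycleContradiction.

(** * Path lifting *)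

Section WithinContinuity.
Context (S T : topologicalType).
Implicit Types (A : set S) (f : S -> T).

Lemma within_continuousP A f : {within A, continuous f} <->
  forall x, A x -> forall O, open O -> O (f x) ->
    exists V, [/\ open V, V x & forall y, V y -> A y -> O (f y)].
Proof.
rewrite subspace_continuousP; split=> [cf x Ax O oO Ofx|cf x Ax O /=].
  have : nbhs x [set y | A y -> O (f y)] by apply: (cf x Ax); exact: open_nbhs_nbhs.
  rewrite nbhsE => -[V [oV Vx] VO].
  by exists V; split=> // y Vy Ay; exact: VO.
rewrite nbhsE => -[Q [oQ Qfx] QO].
have [V [oV Vx VO']] := cf x Ax Q oQ Qfx.
suff : nbhs x [set y | A y -> O (f y)] by [].
by rewrite nbhsE; exists V => // y Vy Ay; apply: QO; exact: VO'.
Qed.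

(** The points where [P] holds and those where it fails are both relatively open. This replaces
    subdivisions of the interval in the lifting arguments below. *)
Lemma connected_locally_constant A (P : S -> Prop) : connected A ->
  (forall x, A x -> exists V, [/\ open V, V x &
    forall y z, V y -> V z -> A y -> A z -> P y -> P z]) ->
  forall y z, A y -> A z -> P y -> P z.
Proof.
move=> cA loc y z Ay Az Py.
pose B := [set x | A x /\ P x].
suff BA : B = A by have [] : B z by rewrite BA.
have oU (Q : set S -> Prop) : open [set x | exists V, [/\ open V, V x & Q V]].
  rewrite (_ : [set _ | _] = \bigcup_(V in [set V | open V /\ Q V]) V).
    by apply: bigcup_open => V [].
  by apply/seteqP; split=> [x [V [oV Vx QV]]|x [V [oV QV] Vx]]; exists V.
apply: cA; first by exists y.
- exists [set x | exists V, [/\ open V, V x & forall w, V w -> A w -> P w]].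
    exact: oU.
  apply/seteqP; split=> [x [Ax Px]|x [Ax [V [_ Vx VP]]]]; last by split=> //; exact: VP.
  split=> //; have [V [oV Vx loc']] := loc x Ax.
  by exists V; split=> // w Vw Aw; exact: loc' Px.
- exists (~` [set x | exists V, [/\ open V, V x & forall w, V w -> A w -> ~ P w]]).
    by rewrite closedC; exact: oU.
  apply/seteqP; split=> [x [Ax Px]|x [Ax nV]]; split=> //.
    by move=> [V [_ Vx /(_ x Vx Ax)]].
  apply: contrapT => nPx; apply: nV.
  have [V [oV Vx loc']] := loc x Ax.
  by exists V; split=> // w Vw Aw Pw; apply: nPx; exact: loc' Pw.
Qed.

End WithinContinuity.

Section Gluing.
Context (R : realType) (T : topologicalType).
Implicit Types (f g : R -> T).

Lemma within_continuous_glue f g (a b c : R) : a <= b -> b <= c -> f b = g b ->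
  {within `[a, b], continuous f} -> {within `[b, c], continuous g} ->
  {within `[a, c], continuous (fun t => if t <= b then f t else g t)}.
Proof.
move=> ab bc fg cf cg.
have -> : [set` `[a, c]] = [set` `[a, b]] `|` [set` `[b, c]].
  apply/seteqP; split=> x /=; rewrite !in_itv/=.
    by move=> /andP[ax xc]; case: (lerP x b) => xb; [left|right]; rewrite ?ax ?xb ?xc ?(ltW xb).
  by move=> [] /andP[h1 h2]; rewrite ?h1 ?h2 ?(le_trans h2 bc)// ?(le_trans ab h1)//.
apply: withinU_continuous; [exact: interval_closed|exact: interval_closed| |].
  apply: (subspace_eq_continuous (f := f) _ cf) => x /set_mem/=.
  by rewrite in_itv/= => /andP[_ xb]; rewrite /from_subspace xb.
apply: (subspace_eq_continuous (f := g) _ cg) => x /set_mem/=.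
rewrite in_itv/= /from_subspace => /andP[bx _]; case: ifPn => // xb.
by have -> : x = b by apply/eqP; rewrite eq_le xb bx.
Qed.

End Gluing.

Section Lifting.
Context (R : realType) (E B : topologicalType) (p : E -> B).
Hypothesis p_cov : covering p.
Implicit Types (f g : R -> E) (al : R -> B).

Definition sheet (U : set B) (V : set E) := homeo_on p V U.

Lemma covering_sheets b : exists U : set B, [/\ open U, U b &
  exists F : set (set E), [/\ forall e, U (p e) -> exists2 V, F V & V e,
    forall V W e, F V -> F W -> V e -> W e -> V = W &
    forall V, F V -> sheet U V]].
Proof.
have [_ _ /(_ b)[U [oU Ub [F [pF tF hF]]]]] := p_cov.
exists U; split=> //; exists F; split=> //.
  move=> e Upe; have : (p @^-1` U) e by [].
  by rewrite pF => -[V FV Ve]; exists V.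
by move=> V W e FV FW Ve We; apply: tF => //; exists e.
Qed.

Lemma sheet_open U V : sheet U V -> open V. Proof. by case. Qed.

Lemma sheet_inj U V e e' : sheet U V -> V e -> V e' -> p e = p e' -> e = e'.
Proof. by move=> [_ _ _ [_ inj _] _] Ve Ve'; apply: inj; exact: mem_set. Qed.

Lemma sheet_surj U V b : sheet U V -> U b -> exists2 e, V e & p e = b.
Proof. by move=> [_ _ _ [_ _ sur] _] /sur[e Ve <-]; exists e. Qed.

Lemma sheet_in U V e : sheet U V -> V e -> U (p e).
Proof. by move=> [_ _ _ [fs _ _] _]; exact: fs. Qed.

Lemma sheet_image_open U V O : sheet U V -> open O -> open (p @` (O `&` V)).
Proof.
move=> [oV _ _ _ im] oO; apply: im; [exact: openI|exact: subIsetr].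
Qed.

(** Near a given point [f] and [g] each stay in one sheet. If they agree somewhere nearby, the
    sheets coincide, and [p] is injective on a sheet. *)
Lemma lift_unique (S : topologicalType) (A : set S) (f g : S -> E) : connected A ->
  {within A, continuous f} -> {within A, continuous g} ->
  (forall s, A s -> p (f s) = p (g s)) ->
  forall s t, A s -> A t -> f s = g s -> f t = g t.
Proof.
move=> cA /within_continuousP cf /within_continuousP cg pfg.
apply: (connected_locally_constant cA) => x Ax.
have [U [oU Ux [F [cov tr hF]]]] := covering_sheets (p (f x)).
have [V FV Vf] := cov _ Ux.
have [W FW Wg] := cov (g x) ltac:(by rewrite -pfg).
have [V1 [oV1 V1x V1f]] := cf _ Ax V (sheet_open (hF _ FV)) Vf.
have [W1 [oW1 W1x W1g]] := cg _ Ax W (sheet_open (hF _ FW)) Wg.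
exists (V1 `&` W1); split; [exact: openI|by []|].
move=> y z [V1y W1y] [V1z W1z] Ay Az fgy.
have VW : V = W by apply: (tr _ _ (f y)) => //; [exact: V1f|rewrite fgy; exact: W1g].
apply: (sheet_inj (hF _ FV)); [exact: V1f|by rewrite VW; exact: W1g|exact: pfg].
Qed.

Lemma lift_stay (S : topologicalType) (A : set S) (f : S -> E) U F V : connected A ->
  {within A, continuous f} ->
  (forall e, U (p e) -> exists2 V, F V & V e) ->
  (forall V W e, F V -> F W -> V e -> W e -> V = W) ->
  (forall V, F V -> sheet U V) -> F V ->
  (forall s, A s -> U (p (f s))) ->
  forall s t, A s -> A t -> V (f s) -> V (f t).
Proof.
move=> cA /within_continuousP cf cov tr hF FV Uf.
apply: (connected_locally_constant cA) => x Ax.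
have [W FW Wf] := cov _ (Uf _ Ax).
have [W1 [oW1 W1x W1f]] := cf _ Ax W (sheet_open (hF _ FW)) Wf.
exists W1; split=> // y z W1y W1z Ay Az Vy.
by rewrite (tr _ _ _ FV FW Vy (W1f _ W1y Ay)); exact: W1f.
Qed.

(** Continuity comes from openness of [p] on the sheet: an open part of the sheet has an open image,
    whose preimage by [al] is relatively open in [A]. *)
Lemma sheet_section_continuous (S : topologicalType) (A : set S) (f : S -> E)
    (al : S -> B) U V : sheet U V ->
  {within A, continuous al} -> (forall s, A s -> V (f s) /\ p (f s) = al s) ->
  {within A, continuous f}.
Proof.
move=> hV /within_continuousP cal fV; apply/within_continuousP => x Ax O oO Of.
have [Vfx pfx] := fV _ Ax.
have [W [oW Wx Wal]] := cal _ Ax _ (sheet_image_open hV oO) ltac:(by exists (f x)).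
exists W; split=> // y Wy Ay; have [e [? Ve] pe] := Wal _ Wy Ay.
have [Vfy pfy] := fV _ Ay.
by rewrite -(sheet_inj hV Ve Vfy)// pe pfy.
Qed.

Lemma lift_exists al e : {within `[0, 1], continuous al} -> p e = al 0 ->
  exists f, [/\ {within `[0, 1], continuous f}, f 0 = e &
    forall t, t \in `[0, 1] -> p (f t) = al t].
Proof.
move=> cal pe.
(* The existence of a lift on [[0, s]] is a property of [s] that passes between nearby points:
   restrict to the left, and continue inside one sheet to the right. *)
pose P (s : R) := exists f, [/\ {within `[0, s], continuous f}, f 0 = e &
    forall t, t \in `[0, s] -> p (f t) = al t].
suff : P 1 by [].
have I0 : [set` `[0, 1 : R]] 0 by rewrite /= in_itv/= lexx ler01.
have I1 : [set` `[0, 1 : R]] 1 by rewrite /= in_itv/= lexx ler01.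
have P0 : P 0.
  exists (fun _ => e); split=> //; first exact: cst_continuous.
  by move=> t; rewrite in_itv/= -eq_le => /eqP <-.
move/within_continuousP : (cal) => cal'.
apply: (connected_locally_constant (@segment_connected R 0 1) _ I0 I1 P0) => x xI.
have [U [oU Ux [F [cov tr hF]]]] := covering_sheets (al x).
have [Q [oO Ox OU]] := cal' _ xI U oU Ux.
have [d /= d0 dO] : exists2 d : R, 0 < d & ball x d `<=` Q.
  have /nbhs_ballP[d /= d0 dO] : nbhs x Q by exact: open_nbhs_nbhs.
  by exists d.
exists (ball x d); split; [exact: ball_open|exact: ballxx|].
move=> y z xy xz yI zI [f [cf f0 pf]].
move: yI zI; rewrite /= !in_itv/= => /andP[y0 y1] /andP[z0 z1].
have [zy|yz] := leP z y.
  exists f; split=> //.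
    apply: continuous_subspaceW cf => t /=; rewrite !in_itv/= => /andP[-> tz].
    by rewrite (le_trans tz).
  by move=> t; rewrite in_itv/= => /andP[t0 tz]; apply: pf; rewrite in_itv/= t0 (le_trans tz).
have mid t : y <= t -> t <= z -> U (al t).
  move=> yt tz; apply: OU.
    apply: dO; move: xy xz; rewrite /ball/= !ltr_distlC => /andP[a b] /andP[c e'].
    by rewrite (lt_le_trans a)// (le_lt_trans tz).
  by rewrite /= in_itv/= (le_trans y0)//= (le_trans tz).
have pfy : p (f y) = al y by apply: pf; rewrite in_itv/= y0 lexx.
have [V FV Vfy] := cov (f y) ltac:(by rewrite pfy; exact: mid (ltW yz)).
have /choice[g gP] : forall t, exists e', y <= t <= z -> V e' /\ p e' = al t.
  move=> t; case: (boolP (y <= t <= z)) => [/andP[yt tz]|_]; last by exists e.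
  by have [e' Ve' pe'] := sheet_surj (hF _ FV) (mid _ yt tz); exists e'.
have gy : f y = g y.
  have [Vg pg] := gP y ltac:(by rewrite lexx ltW).
  by apply: (sheet_inj (hF _ FV)) => //; rewrite pg.
exists (fun t => if t <= y then f t else g t); split.
- apply: within_continuous_glue => //; first exact: ltW.
  apply: (sheet_section_continuous (hF _ FV) (al := al)).
    apply: continuous_subspaceW cal => t /=; rewrite !in_itv/= => /andP[yt tz].
    by rewrite (le_trans y0)//= (le_trans tz).
  by move=> t /=; rewrite in_itv/=; exact: gP.
- by rewrite y0.
- move=> t; rewrite in_itv/= => /andP[t0 tz]; case: leP => ty.
    by apply: pf; rewrite in_itv/= t0.
  by have [] := gP t; rewrite ?tz ?(ltW ty).
Qed.

(* The lifts of the paths of a homotopy move continuously with the parameter, so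
   their endpoints, which lie over a fixed point, are constant. *)
Lemma homotopic_lifts_end (h : R * R -> B) (f : R -> R -> E) e :
  {within `[0, 1]%classic `*` `[0, 1]%classic, continuous h} ->
  (forall t, t \in `[0, 1] -> [/\ {within `[0, 1], continuous (f t)}, f t 0 = e &
    forall s, s \in `[0, 1] -> p (f t s) = h (t, s)]) ->
  (forall t, t \in `[0, 1] -> h (t, 1) = h (0, 1)) ->
  f 1 1 = f 0 1.
Proof.
move=> /within_continuousP ch fP h1.
have I0 : [set` `[0, 1 : R]] 0 by rewrite /= in_itv/= lexx ler01.
have I1 : [set` `[0, 1 : R]] 1 by rewrite /= in_itv/= lexx ler01.
have cI := @segment_connected R 0 1.
(* Continuity in [t] of [f t s] is propagated along [s] from [s = 0], where all the lifts start at
   [e]. *)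
have key t0 : t0 \in `[0, 1] -> forall s, s \in `[0, 1] ->
    forall O, open O -> O (f t0 s) ->
    exists V, [/\ open V, V t0 & forall t, V t -> t \in `[0, 1] -> O (f t s)].
  move=> t0I s sI; pose P s := forall O, open O -> O (f t0 s) ->
    exists V, [/\ open V, V t0 & forall t, V t -> t \in `[0, 1] -> O (f t s)].
  suff : P s by [].
  have P0 : P 0.
    move=> O oO Of; exists [set: R]; split=> //; first exact: openT.
    move=> t _ tI; have [_ -> _] := fP t tI.
    by move: Of; have [_ -> _] := fP t0 t0I.
  have [cf0 _ pf0] := fP t0 t0I.
  apply: (connected_locally_constant cI _ I0 sI P0) => x xI.
  have [U [oU Ux [F [cov tr hF]]]] := covering_sheets (h (t0, x)).
  have [Q [oO Ox OU]] := ch (t0, x) (conj t0I xI) U oU Ux.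
  have [d /= d0 dO] : exists2 d : R, 0 < d & ball t0 d `*` ball x d `<=` Q.
    have /nbhs_ballP[d /= d0 dO] : nbhs (t0, x) Q by exact: open_nbhs_nbhs.
    by exists d => // -[a b] [? ?]; exact: dO.
  exists (ball x d); split; [exact: ball_open|exact: ballxx|].
  move=> y z xy xz yI zI Py W oW Wz.
  have hU t s' : ball t0 d t -> ball x d s' -> t \in `[0, 1] -> s' \in `[0, 1] ->
    U (h (t, s')) by move=> bt bs tI s'I; apply: OU; [exact: dO|].
  pose J : set R := ball x d `&` [set` `[0, 1]].
  have cJ : connected J.
    apply/connected_intervalP => a b /= [xa aI] [xb bI] c /andP[ac cb].
    move: xa xb aI bI; rewrite /ball/= !ltr_distlC !in_itv/=.
    move=> /andP[? ?] /andP[? ?] /andP[? ?] /andP[? ?].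
    split; first by rewrite /ball/= ltr_distlC (lt_le_trans _ ac)//= (le_lt_trans cb).
    by rewrite /= in_itv/= (le_trans _ ac)//= (le_trans cb).
  have [V FV Vy] := cov (f t0 y) ltac:(by rewrite pf0//; exact: hU (ballxx _ _) _ _ _).
  have stay t : ball t0 d t -> t \in `[0, 1] -> V (f t y) -> V (f t z).
    move=> bt tI; have [cft _ pft] := fP t tI.
    apply: (@lift_stay _ J (f t) U F V cJ _ cov tr hF FV) => //.
      by apply: continuous_subspaceW cft => ? [].
    by move=> s' [? ?]; rewrite pft//; exact: hU.
  have Vz : V (f t0 z) by apply: stay => //; exact: ballxx.
  have [V1 [oV1 V1t0 V1f]] := Py V (sheet_open (hF _ FV)) Vy.
  have oWV := sheet_image_open (hF _ FV) oW.
  have [V2 [oV2 V2z V2h]] := ch (t0, z) (conj t0I zI) _ oWV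
    ltac:(by exists (f t0 z) => //; rewrite pf0).
  have [d2 /= d20 d2O] : exists2 d : R, 0 < d & ball t0 d `*` ball z d `<=` V2.
    have /nbhs_ballP[d2 /= d20 d2O] : nbhs (t0, z) V2 by exact: open_nbhs_nbhs.
    by exists d2 => // -[a b] [? ?]; exact: d2O.
  exists (V1 `&` (ball t0 d `&` ball t0 d2)); split.
  - by apply: openI => //; apply: openI; exact: ball_open.
  - by split=> //; split; exact: ballxx.
  move=> t [V1t [bt bt2]] tI.
  have Vt : V (f t z) by apply: stay => //; exact: V1f.
  have [e' [We' Ve'] pe'] := V2h (t, z) (d2O (t, z) (conj bt2 (ballxx _ d20))) (conj tI zI).
  have [_ _ pft] := fP t tI.
  by rewrite -(sheet_inj (hF _ FV) Ve' Vt)// pe' pft.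
apply: (connected_locally_constant (P := fun t => f t 1 = f 0 1) cI _ I0 I1) => // x xI.
have [U [oU Ux [F [cov tr hF]]]] := covering_sheets (p (f x 1)).
have [V FV Vx] := cov _ Ux.
have [V1 [oV1 V1x V1f]] := key x xI 1 I1 V (sheet_open (hF _ FV)) Vx.
exists V1; split=> // y z V1y V1z yI zI <-.
apply: (sheet_inj (hF _ FV)); [exact: V1f|exact: V1f|].
have [_ _ pfy] := fP y yI; have [_ _ pfz] := fP z zI.
by rewrite pfy// pfz// h1// [RHS]h1.
Qed.

End Lifting.

(** * The fundamental group and the deck cocycle *)

Lemma within_continuous_comp (S T U : topologicalType) (A : set S) (B : set T)
    (h : S -> T) (f : T -> U) :
  {within A, continuous h} -> (forall x, A x -> B (h x)) ->
  {within B, continuous f} -> {within A, continuous (fun x => f (h x))}.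
Proof.
move=> /within_continuousP ch AB /within_continuousP cf.
apply/within_continuousP => x Ax O oO Of.
have [V [oV Vx VO]] := cf _ (AB _ Ax) O oO Of.
have [W [oW Wx WV]] := ch _ Ax V oV Vx.
by exists W; split=> // y Wy Ay; apply: VO; [exact: WV|exact: AB].
Qed.

Section Paths.
Context (R : realType) (T : topologicalType).
Implicit Types (f g : R -> T) (x y z : T).

Definition path_rev f : R -> T := fun t => f (1 - t).

Lemma path_rev_is_path x y f : is_path x y f -> is_path y x (path_rev f).
Proof.
move=> [cf f0 f1]; split; rewrite /path_rev ?subrr ?subr0//.
have c1 : {within `[0, 1], continuous (fun t : R => 1 - t)}.
  by apply: continuous_subspaceT => t; apply: cvgB; [exact: cvg_cst|exact: cvg_id].
apply: (within_continuous_comp c1 _ cf).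
by move=> t /=; rewrite !in_itv/= => /andP[? ?]; apply/andP; split; lra.
Qed.

Lemma path_concat_is_path x y z f g : is_path x y f -> is_path y z g ->
  is_path x z (path_concat f g).
Proof.
move=> [cf f0 f1] [cg g0 g1]; rewrite /path_concat; split.
- apply: (@within_continuous_glue _ _ (fun t => f (2 * t)) (fun t => g (2 * t - 1)));
    rewrite ?invr_ge0//.
  + by rewrite invf_le1// ler1n.
  + by rewrite divff// subrr f1 g0.
  + have c1 : {within `[0, 2^-1], continuous (fun t : R => 2 * t)}.
      by apply: continuous_subspaceT => t; apply: cvgM; [exact: cvg_cst|exact: cvg_id].
    apply: (within_continuous_comp c1 _ cf).
    by move=> t /=; rewrite !in_itv/= => /andP[? ?]; apply/andP; split; lra.
  + have c1 : {within `[2^-1, 1], continuous (fun t : R => 2 * t - 1)}.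
      apply: continuous_subspaceT => t; apply: cvgB; last exact: cvg_cst.
      by apply: cvgM; [exact: cvg_cst|exact: cvg_id].
    apply: (within_continuous_comp c1 _ cg).
    by move=> t /=; rewrite !in_itv/= => /andP[? ?]; apply/andP; split; lra.
- by rewrite ifT ?mulr0// invr_ge0.
- rewrite ifF; first by rewrite mulr1 (_ : 2 - 1 = 1)//; lra.
  by apply/negbTE; rewrite -ltNge invf_lt1// ltr1n.
Qed.

Lemma path_cst x : is_path x x (fun _ : R => x).
Proof. by split=> //; exact: cst_continuous. Qed.

Lemma path_concat_ext f f' g g' :
  (forall t, t \in `[0, 1] -> f t = f' t) -> (forall t, t \in `[0, 1] -> g t = g' t) ->
  forall t, t \in `[0, 1] -> path_concat f g t = path_concat f' g' t.
Proof.
move=> ff' gg' t; rewrite in_itv/= => /andP[t0 t1]; rewrite /path_concat.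
by case: leP => th; [apply: ff'|apply: gg']; rewrite in_itv/=; apply/andP; split; lra.
Qed.

End Paths.

Lemma is_path_image (R : realType) (T U : topologicalType) (h : T -> U) x y
  (f : R -> T) : continuous h -> is_path x y f -> is_path (h x) (h y) (h \o f).
Proof.
move=> ch [cf f0 f1]; split; rewrite /= ?f0 ?f1//.
by apply: (within_continuous_comp cf (B := [set: T]) (f := h)) => //; exact: continuous_subspaceT.
Qed.

Lemma comp_path_concat (R : realType) (T U : topologicalType) (h : T -> U)
  (f g : R -> T) : h \o path_concat f g = path_concat (h \o f) (h \o g).
Proof. by apply/funext => t; rewrite /path_concat/=; case: ifP. Qed.

Section FundamentalGroup.
Context (R : realType) (M Mt : topologicalType) (p : Mt -> M).
Hypothesis p_univ : universal_covering R p.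
Context (H : groupType) (L : set H) (x0 : M) (phi : (R -> M) -> H).
Hypothesis phi_in : forall f, is_loop x0 f -> L (phi f).
Hypothesis phi_eq : forall f g, is_loop x0 f -> is_loop x0 g ->
  (phi f = phi g <-> path_homotopic f g).
Hypothesis phiM : forall f g, is_loop x0 f -> is_loop x0 g ->
  phi (path_concat f g) = (phi f * phi g)%g.

Let p_cov : covering p. Proof. by case: p_univ. Qed.
Let p_cont : continuous p. Proof. by case: p_cov. Qed.

Lemma phi_ext f g : is_loop x0 f -> is_loop x0 g ->
  (forall t, t \in `[0, 1] -> f t = g t) -> phi f = phi g.
Proof.
move=> lf lg fg; apply/phi_eq => //; have [cf _ _] := lf.
exists (fun ts => f ts.2); split=> [|s sI|t tI].
- have c1 : {within `[0, 1]%classic `*` `[0, 1]%classic, continuous (fun ts : R * R => ts.2)}.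
    by apply: continuous_subspaceT => ts; exact: cvg_snd.
  apply: (within_continuous_comp c1 _ cf).
  by move=> [t s] [].
- by split=> //=; exact: fg.
- by case: lf => _ -> ->.
Qed.

Lemma phi_cst : phi (fun _ => x0) = 1%g.
Proof.
have l0 : is_loop x0 (fun _ : R => x0) by exact: path_cst.
have := phiM l0 l0.
have -> : path_concat (fun _ : R => x0) (fun _ => x0) = fun _ => x0.
  by apply/funext => t; rewrite /path_concat; case: ifP.
by move=> e; apply: (mulgI (phi (fun _ => x0))); rewrite -e mulg1.
Qed.

Lemma phi_null z (f : R -> Mt) : p z = x0 -> is_loop z f -> phi (p \o f) = 1%g.
Proof.
move=> pz lf; have [_ [_ _ /(_ z f lf)[F [cF F0 F1]]]] := p_univ.
rewrite -phi_cst; apply/phi_eq.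
- by rewrite -pz; exact: is_path_image.
- exact: path_cst.
- exists (fun ts => p (F ts)); split=> [|s sI|t tI].
  + by apply: (within_continuous_comp cF (B := [set: Mt]) (f := p)) => //; exact: continuous_subspaceT.
  + by have [-> ->] := F0 s sI; rewrite pz.
  + by have [-> ->] := F1 t tI.
Qed.

(** Closing both paths with the reverse of [g] yields loops of the simply connected space [Mt],
    whose images [phi] sends to 1. *)
Lemma phi_same_ends z w (f g : R -> Mt) : p z = x0 -> p w = x0 ->
  is_path z w f -> is_path z w g -> phi (p \o f) = phi (p \o g).
Proof.
move=> pz pw pf pg.
have loop (h : R -> Mt) : is_path z w h -> is_loop x0 (p \o h).
  by move=> /(is_path_image p_cont); rewrite pz pw.
have lgr : is_loop x0 (p \o path_rev g).
  by have := is_path_image p_cont (path_rev_is_path pg); rewrite pz pw.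
apply: (mulIg (phi (p \o path_rev g))).
rewrite -!phiM//; try exact: loop.
rewrite -(comp_path_concat p f) -(comp_path_concat p g) !(phi_null pz)//.
  exact: path_concat_is_path pg (path_rev_is_path pg).
exact: path_concat_is_path pf (path_rev_is_path pg).
Qed.

(** Equal values of [phi] give a homotopy downstairs. Its rows, lifted from [z], all have the same
    end point, and the first and last rows lift to [f] and [f']. *)
Lemma phi_injective z w w' (f f' : R -> Mt) : p z = x0 -> p w = x0 -> p w' = x0 ->
  is_path z w f -> is_path z w' f' -> phi (p \o f) = phi (p \o f') -> w = w'.
Proof.
move=> pz pw pw' pf pf' /phi_eq.
have loop (h : R -> Mt) v : p v = x0 -> is_path z v h -> is_loop x0 (p \o h).
  by move=> pv /(is_path_image p_cont); rewrite pz pv.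
move=> /(_ (loop _ _ pw pf) (loop _ _ pw' pf'))[F [cF F0 F1]].
have I0 : (0 : R) \in `[0, 1] by rewrite in_itv/= lexx ler01.
have I1 : (1 : R) \in `[0, 1] by rewrite in_itv/= lexx ler01.
have [cf f0 f1] := pf; have [cf' f'0 f'1] := pf'.
have /choice[G GP] : forall t, exists g : R -> Mt, t \in `[0, 1] ->
    [/\ {within `[0, 1], continuous g}, g 0 = z &
    forall s, s \in `[0, 1] -> p (g s) = F (t, s)].
  move=> t; case: (boolP (t \in `[0, 1])) => tI; last by exists f.
  have cFt : {within `[0, 1], continuous (fun s => F (t, s))}.
    have c1 : {within `[0, 1], continuous (fun s : R => (t, s))}.
      by apply: continuous_subspaceT => s; exact: (cvg_pair (cvg_cst t) cvg_id).
    by apply: (within_continuous_comp c1 _ cF).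
  have [|g [cg g0 pg]] := lift_exists p_cov cFt (e := z).
    by have [-> _] := F1 t tI; rewrite /= f0.
  by exists g.
have h1 t : t \in `[0, 1] -> F (t, 1) = F (0, 1).
  by move=> tI; have [_ ->] := F1 t tI; have [_ ->] := F1 0 I0.
have E := homotopic_lifts_end p_cov cF GP h1.
have cI := @segment_connected R 0 1.
have [cG0 G00 pG0] := GP 0 I0; have [cG1 G10 pG1] := GP 1 I1.
have <- : G 0 1 = w.
  rewrite -f1; apply: (lift_unique p_cov cI cG0 cf _ I0 I1); last by rewrite G00 f0.
  by move=> s sI; rewrite pG0//; have [-> _] := F0 s sI.
rewrite -E -f'1; apply: (lift_unique p_cov cI cG1 cf' _ I0 I1); last by rewrite G10 f'0.
by move=> s sI; rewrite pG1//; have [_ ->] := F0 s sI.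
Qed.

Variables (xt0 : Mt) (sigma : M -> Mt).
Hypotheses (p_xt0 : p xt0 = x0) (p_sigma : forall m, p (sigma m) = m).

Lemma Mt_path y z : exists f : R -> Mt, is_path y z f.
Proof. by have [_ [_ + _]] := p_univ; exact. Qed.

Definition joining y z : R -> Mt := sval (cid (Mt_path y z)).

Lemma joiningP y z : is_path y z (joining y z).
Proof. by rewrite /joining; case: cid. Qed.

Definition base_path m := joining xt0 (sigma m).

(** The reversed base path is lifted from [y] instead of from [sigma (p y)]; it ends over [x0], and
    at [xt0] itself if [y] is the preferred lift. *)
Lemma return_path y : exists f : R -> Mt, [/\ {within `[0, 1], continuous f},
  f 0 = y & forall t, t \in `[0, 1] -> p (f t) = p (path_rev (base_path (p y)) t)].
Proof.
have bp := path_rev_is_path (joiningP xt0 (sigma (p y))).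
have [c0 b0 _] := is_path_image p_cont bp.
by apply: (lift_exists p_cov c0); rewrite b0 p_sigma.
Qed.

Definition returning y := sval (cid (return_path y)).

Definition landing y := returning y 1.

Let I0 : (0 : R) \in `[0, 1]. Proof. by rewrite in_itv/= lexx ler01. Qed.
Let I1 : (1 : R) \in `[0, 1]. Proof. by rewrite in_itv/= lexx ler01. Qed.

Lemma returningP y : is_path y (landing y) (returning y).
Proof. by rewrite /landing /returning; case: cid => f [? ? ?]; split. Qed.

Lemma p_returning y t : t \in `[0, 1] ->
  p (returning y t) = p (path_rev (base_path (p y)) t).
Proof. by rewrite /returning; case: cid => f [? ? h] /=; exact: h. Qed.

Lemma p_landing y : p (landing y) = x0.
Proof.
rewrite /landing p_returning// /path_rev subrr /base_path.
by have [_ -> _] := joiningP xt0 (sigma (p y)).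
Qed.

(* [class y] is the element of the fundamental group that carries the preferred
   lift [sigma (p y)] to [y], read through [phi]. *)
Definition class y : H := phi (p \o joining xt0 (landing y)).

Definition transport (al : R -> M) : H :=
  phi (path_concat (p \o base_path (al 0))
    (path_concat al (p \o path_rev (base_path (al 1))))).

(** Going back from the landing point of [y] to [y], along [d], and on to the landing point of [z]
    is a path whose projection on [[0, 1]] is the loop defining [transport]. *)
Lemma class_transport y z (d : R -> Mt) : is_path y z d ->
  class z = (class y * transport (p \o d))%g.
Proof.
move=> pd.
have loop (f : R -> Mt) u v : p u = x0 -> p v = x0 -> is_path u v f -> is_loop x0 (p \o f).
  by move=> pu pv /(is_path_image p_cont); rewrite pu pv.
have pe := path_concat_is_path (path_rev_is_path (returningP y))
  (path_concat_is_path pd (returningP z)).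
set e := path_concat _ _ in pe.
have -> : class z = (class y * phi (p \o e))%g.
  rewrite /class -phiM; last 2 first.
  - by apply: loop (joiningP _ _) => //; exact: p_landing.
  - by apply: loop pe; exact: p_landing.
  rewrite -(comp_path_concat p); apply: (phi_same_ends (z := xt0) (w := landing z)) => //.
  - exact: p_landing.
  - exact: joiningP.
  - exact: path_concat_is_path (joiningP _ _) pe.
congr (_ * _)%g; rewrite /transport; have [_ d0 d1] := pd; rewrite /= d0 d1.
apply: phi_ext.
- by apply: loop pe; exact: p_landing.
- have bpy := is_path_image p_cont (joiningP xt0 (sigma (p y))).
  have bpz := is_path_image p_cont (path_rev_is_path (joiningP xt0 (sigma (p z)))).
  rewrite !p_sigma p_xt0 in bpy bpz.
  exact: path_concat_is_path bpy (path_concat_is_path (is_path_image p_cont pd) bpz).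
rewrite /e !(comp_path_concat p); apply: path_concat_ext => t tI.
  rewrite /= /path_rev p_returning; last first.
    by move: tI; rewrite !in_itv/= => /andP[? ?]; apply/andP; split; lra.
  by rewrite /path_rev subKr.
apply: path_concat_ext => // s sI; exact: p_returning.
Qed.

Lemma class_sigma m : class (sigma m) = 1%g.
Proof.
have lm : landing (sigma m) = xt0.
  have bp := path_rev_is_path (joiningP xt0 (sigma m)).
  have [c0 b0 b1] := bp; have [c1 r0 _] := returningP (sigma m).
  rewrite /landing -b1.
  apply: (lift_unique p_cov (@segment_connected R 0 1) c1 c0 _ I0 I1).
    by move=> s sI; rewrite p_returning// p_sigma.
  by rewrite r0 b0.
by rewrite /class lm; apply: (phi_null (z := xt0)) => //; exact: joiningP.
Qed.

(** By [phi_injective] the landing points agree; the reversed return paths are then lifts of one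
    base path from one point, so their ends [y] and [y'] agree. *)
Lemma class_injective y y' : p y = p y' -> class y = class y' -> y = y'.
Proof.
move=> pyy' cyy'.
have lyy' : landing y = landing y'.
  exact: (phi_injective p_xt0 (p_landing _) (p_landing _) (joiningP _ _) (joiningP _ _)).
have [cy ry0 ry1] := path_rev_is_path (returningP y).
have [cy' ry0' ry1'] := path_rev_is_path (returningP y').
rewrite -ry1 -ry1'.
apply: (lift_unique p_cov (@segment_connected R 0 1) cy cy' _ I0 I1).
  move=> s sI.
  have s'I : 1 - s \in `[0, 1].
    by move: sI; rewrite /= !in_itv/= => /andP[? ?]; apply/andP; split; lra.
  by rewrite /path_rev !p_returning ?pyy'.
by rewrite ry0 ry0'.
Qed.

Lemma class_in y : L (class y).
Proof.
apply: phi_in.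
by have := is_path_image p_cont (joiningP xt0 (landing y)); rewrite p_xt0 p_landing.
Qed.

(** Two paths with the same projection are translates by a deck transformation; this compares their
    ends without constructing that transformation. *)
Lemma class_relative y z y' z' (d d' : R -> Mt) : is_path y z d ->
  is_path y' z' d' -> p \o d = p \o d' ->
  ((class y)^-1 * class z)%g = ((class y')^-1 * class z')%g.
Proof.
by move=> pd pd' dd'; rewrite (class_transport pd) (class_transport pd') dd' !mulKg.
Qed.

End FundamentalGroup.

(** * Finite covers of the manifold by evenly covered sets *)

Section Restriction.
Context (E B : topologicalType) (p : E -> B).

Lemma homeo_on_restrict V U W : homeo_on p V U -> open W -> W `<=` U ->
  homeo_on p (V `&` p @^-1` W) W.
Proof.
move=> hV oW WU; have [oV oU cp bij im] := hV.
have oVW : open (V `&` p @^-1` W).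
  rewrite openE => x [Vx Wpx].
  have [Q [oQ Qx QW]] := (within_continuousP V p).1 cp x Vx W oW Wpx.
  rewrite /interior nbhsE; exists (V `&` Q); first by split; [exact: openI|].
  by move=> y [Vy Qy]; split=> //; exact: QW.
split=> //.
- by apply: continuous_subspaceW cp; exact: subIsetl.
- split=> [x [] //|x y /set_mem[Vx _] /set_mem[Vy _]|b Wb].
    exact: (sheet_inj hV).
  have [e Ve pe] := sheet_surj hV (WU _ Wb).
  by exists e => //; split=> //; rewrite /= pe.
- by move=> Q oQ QV; apply: im => //; apply: subset_trans QV _; exact: subIsetl.
Qed.

End Restriction.

Definition path_connected (R : realType) (T : topologicalType) (W : set T) : Prop :=
  forall x y, W x -> W y -> exists f : R -> T, is_path x y f /\
    forall t, t \in `[0, 1] -> W (f t).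

Section NiceNeighbourhoods.
Context (R : realType) (M : ptopologicalType) (Mt : topologicalType) (p : Mt -> M).
Hypothesis p_cov : covering p.

(** [W] corresponds to a ball in a chart, and balls of ['rV[R]_d] are convex: segments pulled back
    by the chart join its points. *)
Lemma manifold_neighbourhood d (x : M) (U0 : set M) :
  manifold R d M -> open U0 -> U0 x ->
  exists W : set M, [/\ open W, W x, W `<=` U0 & path_connected R W].
Proof.
move=> [_ _ /(_ x)[U1 [V1 [f [U1x hf]]]]] oU0 U0x.
have [oU1 oV1 cf bij im] := hf.
have oI : open (f @` (U1 `&` U0)).
  by apply: im; [exact: openI|exact: subIsetl].
have [r /= r0 rI] : exists2 r : R, 0 < r & ball (f x) r `<=` f @` (U1 `&` U0).
  have /nbhs_ballP[r /= r0 rI] : nbhs (f x) (f @` (U1 `&` U0)).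
    by apply: open_nbhs_nbhs; split=> //; exists x.
  by exists r.
have bV1 : ball (f x) r `<=` V1.
  by move=> v /rI [u [U1u _] <-]; exact: (sheet_in hf).
have := homeo_on_restrict hf (ball_open (f x) r) bV1.
set W := U1 `&` _ => hW; exists W; split.
- exact: sheet_open hW.
- by split=> //; exact: ballxx.
- move=> m [U1m /rI [u [U1u U0u] fum]].
  by rewrite -(sheet_inj hf U1u U1m fum).
move=> m m' Wm Wm'.
have bm := sheet_in hW Wm; have bm' := sheet_in hW Wm'.
pose l t : 'rV[R]_d := (1 - t) *: f m + t *: f m'.
have bl t : t \in `[0, 1] -> ball (f x) r (l t).
  rewrite in_itv/= => /andP[t0 t1]; move: bm bm'; rewrite -!ball_normE/= => bm bm'.
  rewrite (_ : f x - l t = (1 - t) *: (f x - f m) + t *: (f x - f m')); last first.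
    rewrite /l !scalerBr addrACA -scalerDl subrK scale1r opprD; congr (_ + _).
  apply: le_lt_trans (ler_normD _ _) _; rewrite !normrZ ger0_norm ?subr_ge0//.
  rewrite (ger0_norm t0).
  have [->|tn] := eqVneq t 0; first by rewrite subr0 mul1r mul0r addr0.
  have t0' : 0 < t by rewrite lt_neqAle eq_sym tn.
  have : t * `|f x - f m'| < t * r by rewrite ltr_pM2l.
  have : (1 - t) * `|f x - f m| <= (1 - t) * r by rewrite ler_wpM2l ?subr_ge0// ltW.
  by lra.
have /choice[g gP] : forall t, exists e, t \in `[0, 1] -> W e /\ f e = l t.
  move=> t; case: (boolP (t \in `[0, 1])) => tI; last by exists m.
  by have [e We fe] := sheet_surj hW (bl t tI); exists e.
have I0 : (0 : R) \in `[0, 1] by rewrite in_itv/= lexx ler01.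
have I1 : (1 : R) \in `[0, 1] by rewrite in_itv/= lexx ler01.
exists g; split; last by move=> t /gP[].
split.
- apply: (sheet_section_continuous hW (al := l)); last exact: gP.
  apply: continuous_subspaceT => t; apply: cvgD.
    by apply: cvgZ; [apply: cvgB; [exact: cvg_cst|exact: cvg_id]|exact: cvg_cst].
  by apply: cvgZ; [exact: cvg_id|exact: cvg_cst].
- have [Wg fg] := gP 0 I0; apply: (sheet_inj hW Wg Wm).
  by rewrite fg /l subr0 scale1r scale0r addr0.
- have [Wg fg] := gP 1 I1; apply: (sheet_inj hW Wg Wm').
  by rewrite fg /l subrr scale1r scale0r add0r.
Qed.

(** The shrinking of [W i] to [U i], with closure inside [W i], comes from regularity of the compact
    Hausdorff space [M]. It yields both the compact [domain] and the local finiteness of the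
    class. *)
Lemma evenly_covered_cover d : manifold R d M -> compact [set: M] ->
  exists (k : nat) (U W : nat -> set M) (V : nat -> set Mt) (s : nat -> M -> Mt),
  [/\ forall i, open (U i), forall i, closure (U i) `<=` W i,
      forall i, path_connected R (W i),
      forall i e, W i (p e) -> exists2 S, homeo_on p S (W i) & S e &
      (forall i, homeo_on p (V i) (W i)) /\
      (forall i m, W i m -> V i (s i m) /\ p (s i m) = m) /\
      forall m, exists2 i, (i < k)%N & U i m].
Proof.
move=> mM cM.
have hM : hausdorff_space M by case: mM.
have local x : exists UWVs : set M * set M * set Mt * (M -> Mt),
    let: (U, W, V, s) := UWVs in
    [/\ open U, U x, closure U `<=` W, path_connected R W &
     (forall e, W (p e) -> exists2 S, homeo_on p S W & S e) /\
     homeo_on p V W /\ forall m, W m -> V (s m) /\ p (s m) = m].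
  have [U0 [oU0 U0x [F [cov _ hF]]]] := covering_sheets p_cov x.
  have [W [oW Wx WU0 pcW]] := manifold_neighbourhood mM oU0 U0x.
  have sheets e : W (p e) -> exists2 S, homeo_on p S W & S e.
    move=> We; have [S FS Se] := cov e (WU0 _ We).
    by exists (S `&` p @^-1` W) => //; apply: homeo_on_restrict (hF _ FS) oW WU0.
  have [e _ pe] : exists2 e, [set: Mt] e & p e = x.
    by have [_ sur _] := p_cov; exact: sur.
  have [V hV _] := sheets e ltac:(by rewrite pe).
  have /choice[s sP] : forall m, exists e', W m -> V e' /\ p e' = m.
    move=> m; have [Wm|nWm] := pselect (W m); last by exists e.
    by have [e' Ve' pe'] := sheet_surj hV Wm; exists e'.
  have [C Cx CW] := compact_regular hM cM (x := x) filterT (open_nbhs_nbhs (conj oW Wx)).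
  exists (C°, W, V, s); split=> //; first exact: open_interior.
  by apply: subset_trans CW; apply: closure_subset; exact: interior_subset.
have /choice[D DP] := local.
have := cM; rewrite compact_cover => /(_ M setT (fun x => (D x).1.1.1)).
have oD x : [set: M] x -> open (D x).1.1.1.
  by move=> _; have := DP x; case: (D x) => [[[U W] V] s] [].
have cD : [set: M] `<=` cover setT (fun x => (D x).1.1.1).
  by move=> x _; exists x => //; have := DP x; case: (D x) => [[[U W] V] s] [].
move=> /(_ oD cD)[S _ covS].
(* Beyond the size of the list [x_ i] is [point], where the local data exist too, so the properties
   hold for every [i] and only the covering needs [i < k]. *)
pose x_ i := nth (point : M) (enum_fset S) i.
pose DD i := D (x_ i).
exists (size (enum_fset S)), (fun i => (DD i).1.1.1), (fun i => (DD i).1.1.2),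
  (fun i => (DD i).1.2), (fun i => (DD i).2).
have DPi i := DP (x_ i).
split=> [i|i|i|i|]; try by have := DPi i; rewrite /DD; case: (D _) => [[[U W] V] s] [? ? ? ? [? [? ?]]].
split; [|split] => [i|i|m]; try by have := DPi i; rewrite /DD; case: (D _) => [[[U W] V] s] [? ? ? ? [? [? ?]]].
have [x xS Ux] := covS m I.
exists (index x (enum_fset S)); first by rewrite index_mem.
by rewrite /DD /x_ nth_index.
Qed.

End NiceNeighbourhoods.

Lemma preimage_open (S T : topologicalType) (f : S -> T) (Q : set T) :
  continuous f -> open Q -> open (f @^-1` Q).
Proof. by move/continuousP; exact. Qed.

Lemma open_borel (T : ptopologicalType) (Q : set T) :
  open Q -> measurable (Q : set (borel T)).
Proof. by move=> oQ; apply: sub_gen_smallest. Qed.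

(** * A Borel section and the deck cocycle *)

Section Cover.
Context (R : realType) (M Mt : ptopologicalType) (p : Mt -> M).
Hypothesis p_univ : universal_covering R p.
Context (H : groupType) (L : set H) (x0 : M) (phi : (R -> M) -> H).
Hypothesis phi_in : forall f, is_loop x0 f -> L (phi f).
Hypothesis phi_eq : forall f g, is_loop x0 f -> is_loop x0 g ->
  (phi f = phi g <-> path_homotopic f g).
Hypothesis phiM : forall f g, is_loop x0 f -> is_loop x0 g ->
  phi (path_concat f g) = (phi f * phi g)%g.
Variables (xt0 : Mt) (p_xt0 : p xt0 = x0).
Variables (k : nat) (U W : nat -> set M) (V : nat -> set Mt) (s : nat -> M -> Mt).
Hypothesis oU : forall i, open (U i).
Hypothesis UW : forall i, closure (U i) `<=` W i.
Hypothesis pcW : forall i, path_connected R (W i).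
Hypothesis evW : forall i e, W i (p e) -> exists2 S, homeo_on p S (W i) & S e.
Hypothesis hV : forall i, homeo_on p (V i) (W i).
Hypothesis sP : forall i m, W i m -> V i (s i m) /\ p (s i m) = m.
Hypothesis Ucov : forall m, exists2 i, (i < k)%N & U i m.

Let p_cov : covering p. Proof. by case: p_univ. Qed.
Let p_cont : continuous p. Proof. by case: p_cov. Qed.

Definition piece i : set M := U i `&` \bigcap_(j in `I_i) ~` U j.

Lemma pieceW i m : piece i m -> W i m.
Proof. by move=> [Um _]; apply: UW; exact: subset_closure. Qed.

Lemma piece_exists m : exists i, (i < k)%N /\ piece i m.
Proof.
have ex : exists i, (i < k)%N && `[< U i m >].
  by have [i ik Um] := Ucov m; exists i; rewrite ik; exact/asboolP.
case: (ex_minnP ex) => i /andP[ik /asboolP Um] imin.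
exists i; split=> //; split=> // j /= ji Uj.
have := imin j; rewrite (ltn_trans ji ik) asboolT// => /(_ isT).
by rewrite leqNgt ji.
Qed.

Lemma piece_unique i j m : piece i m -> piece j m -> i = j.
Proof.
move=> [Ui ni] [Uj nj]; have [ij|ji|//] := ltngtP i j.
  by case: (nj i ij).
by case: (ni j ji).
Qed.

Definition pindex m := sval (cid (piece_exists m)).

Lemma pindexP m : (pindex m < k)%N /\ piece (pindex m) m.
Proof. by rewrite /pindex; case: cid. Qed.

Lemma pindexE i m : piece i m -> pindex m = i.
Proof. by move=> pim; apply: piece_unique pim; have [] := pindexP m. Qed.

Definition sigma m := s (pindex m) m.

Lemma p_sigma m : p (sigma m) = m.
Proof. by have [_ /pieceW/sP[]] := pindexP m. Qed.

Lemma section_continuous i : {within W i, continuous (s i)}.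
Proof.
apply: (sheet_section_continuous (hV i) (al := id)); last exact: sP.
by apply: continuous_subspaceT => x; exact: cvg_id.
Qed.

Local Notation cls := (class p_univ phi xt0 p_sigma).

(** A path in [W i] lifts both to [S] and to the sheet of the section [s i]. The second lift joins
    two points of class 1, so the first does not change the class. *)
Lemma class_sheet i S y y' : homeo_on p S (W i) -> S y -> S y' ->
  piece i (p y) -> piece i (p y') -> cls y = cls y'.
Proof.
move=> hS Sy Sy' py py'.
have [al [[cal al0 al1] alW]] := pcW (pieceW py) (pieceW py').
have I0 : (0 : R) \in `[0, 1] by rewrite in_itv/= lexx ler01.
have I1 : (1 : R) \in `[0, 1] by rewrite in_itv/= lexx ler01.
have /choice[d dP] : forall t, exists e, (t \in `[0, 1] -> S e /\ p e = al t) /\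
    (t \notin `[0, 1] -> e = y).
  move=> t; case: (boolP (t \in `[0, 1])) => tI; last by exists y.
  by have [e Se pe] := sheet_surj hS (alW t tI); exists e.
pose d' t := if t \in `[0, 1] then s i (al t) else y.
have pd : is_path y y' d.
  split.
  - by apply: (sheet_section_continuous hS cal) => t; have [] := dP t.
  - by have [/(_ I0)[Sd pd] _] := dP 0; apply: (sheet_inj hS Sd Sy); rewrite pd.
  - by have [/(_ I1)[Sd pd] _] := dP 1; apply: (sheet_inj hS Sd Sy'); rewrite pd.
have pd' : is_path (sigma (p y)) (sigma (p y')) d'.
  rewrite /sigma (pindexE py) (pindexE py') /d'; split.
  - apply: (sheet_section_continuous (hV i) cal) => t tI.
    by rewrite ifT//; exact: sP (alW t tI).
  - by rewrite I0 al0.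
  - by rewrite I1 al1.
have dd' : p \o d = p \o d'.
  apply/funext => t; rewrite /d' /=; have [dI dN] := dP t.
  case: ifPn => tI; last by rewrite dN.
  by have [_ ->] := dI tI; have [_ ->] := sP (alW t tI).
have := class_relative p_univ phi_eq phiM p_xt0 p_sigma pd pd' dd'.
rewrite !(class_sigma p_univ phi_eq phiM p_xt0) mulg1 invg1 => h.
by apply: (mulgI (cls y)^-1%g); rewrite h mulVg.
Qed.

(** For each [i < k], either [p y0] lies in [W i] and a sheet is a neighbourhood with one value
    above [piece i], or [p y0] is outside the closure of [U i] and nearby points avoid the piece. *)
Lemma class_locally_finite y0 : exists Q : set Mt,
  [/\ open Q, Q y0 & finite_set (cls @` Q)].
Proof.
have local i : exists Q : set Mt, [/\ open Q, Q y0 & forall y y', Q y -> Q y' ->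
    piece i (p y) -> piece i (p y') -> cls y = cls y'].
  have [Wi|nWi] := pselect (W i (p y0)).
    have [S hS Sy0] := evW Wi; exists S; split=> //; first exact: sheet_open hS.
    by move=> y y' Sy Sy'; exact: class_sheet hS Sy Sy'.
  exists (p @^-1` ~` closure (U i)); split.
  - apply: preimage_open => //; exact/closed_openC/closed_closure.
  - by move=> /UW.
  - by move=> y y' ny _ [Uy _]; case: ny; exact: subset_closure.
have [Q [oQ Qy0 Qc]] : exists Q : set Mt, [/\ open Q, Q y0 &
    forall i, (i < k)%N -> forall y y', Q y -> Q y' ->
    piece i (p y) -> piece i (p y') -> cls y = cls y'].
  elim: k => [|n [Q [oQ Qy0 Qc]]].
    by exists [set: Mt]; split=> //; exact: openT.
  have [Q' [oQ' Q'y0 Q'c]] := local n; exists (Q `&` Q'); split=> //.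
    exact: openI.
  move=> i; rewrite ltnS leq_eqVlt => /predU1P[->|ltin] y y' [? ?] [? ?].
    exact: Q'c.
  exact: (Qc i).
exists Q; split=> //.
have /choice[v vP] : forall i, exists h, (i < k)%N -> forall y, Q y -> piece i (p y) -> cls y = h.
  move=> i; have [[y [Qy py]]|ny] := pselect (exists y, Q y /\ piece i (p y)).
    by exists (cls y) => ik y' Qy' py'; exact: (Qc i).
  by exists 1%g => ik y Qy py; case: ny; exists y.
apply: sub_finite_set (finite_image v (finite_II k)) => _ [y Qy <-].
by have [ik pk] := pindexP (p y); exists (pindex (p y)) => //; rewrite (vP _ ik y).
Qed.

Lemma class_compact_finite (C : set Mt) : compact C -> finite_set (cls @` C).
Proof.
have /choice[Q QP] := class_locally_finite.
rewrite compact_cover => /(_ Mt setT Q) cC.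
have [||D _ CD] := cC; first by move=> y _; have [] := QP y.
  by move=> y _; exists y => //; have [] := QP y.
apply: (@sub_finite_set _ _ (\bigcup_(y in [set` D]) (cls @` Q y))).
  by move=> _ [y /CD[z Dz Qy] <-]; exists z => //; exists y.
by apply: bigcup_finite => [|y _]; [exact: finite_fset|have [] := QP y].
Qed.

(** The range of the Borel section [sigma] need not be compact; closures of the pieces provide a
    compact set that contains it. *)
Definition domain : set Mt := \bigcup_(i in `I_k) (s i @` closure (U i)).

Lemma sigma_domain m : domain (sigma m).
Proof.
have [ik [Um _]] := pindexP m.
by exists (pindex m) => //; exists m => //; exact: subset_closure.
Qed.

Lemma domain_compact : compact [set: M] -> compact domain.
Proof.
move=> cM; rewrite /domain.
elim: k => [|n IH]; first by rewrite II0 bigcup_set0; exact: compact0.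
rewrite IIS bigcup_setU bigcup_set1; apply: compactU => //.
apply: continuous_compact.
  by apply: continuous_subspaceW (@section_continuous n); exact: UW.
by apply: (subclosed_compact _ cM) => //; exact: closed_closure.
Qed.

Lemma measurable_piece i : measurable (piece i : set (borel M)).
Proof.
have mU j : measurable (U j : set (borel M)) by apply: open_borel; exact: oU.
apply: measurableI; first exact: mU.
by apply: bigcap_measurableType => j _; apply: measurableC; exact: mU.
Qed.

(** Take the union of the sheets over [W i] on which the value [l] occurs above the piece;
    [class_sheet] makes the class constant there. This is the source of measurability of the
    cocycle. *)
Lemma class_level i l : exists2 Q : set Mt, open Q &
  forall y, piece i (p y) -> cls y = l <-> Q y.
Proof.
exists (\bigcup_(S in [set S | homeo_on p S (W i) /\ exists y, [/\ S y, piece i (p y) & cls y = l]]) S).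
  by apply: bigcup_open => S [hS _]; exact: sheet_open hS.
move=> y py; split=> [cy|[S [hS [y' [Sy' py' <-]]] Sy]]; last exact: class_sheet hS Sy Sy' py py'.
have [S hS Sy] := evW (pieceW py).
by exists S => //; split=> //; exists y.
Qed.

Context (G : topGroupType) (Gt : topGroupType) (q : Gt -> G).
Variables (a : contAction G M) (b : contAction Gt Mt).
Hypothesis b_lift : lifted_action q p a b.
Hypothesis qM : {morph q : g h / (g * h)%g}.
Hypothesis Gt_path : forall g, exists f : R -> Gt, is_path 1%g g f.

Definition deck_cocycle (g : Gt) (x : M) : H := cls (b g (sigma x)).
Local Notation c := deck_cocycle.

Lemma act_continuousr g : continuous (b g).
Proof.
move=> y; apply: (continuous_comp (f := fun y => (g, y)) (g := fun gx => b gx.1 gx.2)).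
  exact: (cvg_pair (cvg_cst g) cvg_id).
exact: act_continuous.
Qed.

Lemma act_continuousl y : continuous (fun g => b g y).
Proof.
move=> g; apply: (continuous_comp (f := fun g => (g, y)) (g := fun gx => b gx.1 gx.2)).
  exact: (cvg_pair cvg_id (cvg_cst y)).
exact: act_continuous.
Qed.

(** Move along a path from 1 to [g] in [Gt]. The orbits of [b h (sigma x)] and of
    [sigma (a (q h) x)] along it have the same projection, so [class_relative] applies. *)
Lemma deck_cocycleM g h x : c (g * h)%g x = (c h x * c g (a (q h) x))%g.
Proof.
have [f pf] := Gt_path g; rewrite /deck_cocycle actM.
have path y : is_path y (b g y) (fun t => b (f t) y).
  have := is_path_image (h := fun g => b g y) (act_continuousl (y := y)) pf.
  by rewrite act1.
have e : p \o (fun t => b (f t) (b h (sigma x))) =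
    p \o (fun t => b (f t) (sigma (a (q h) x))).
  by apply/funext => t; rewrite /= !b_lift !p_sigma.
have := class_relative p_univ phi_eq phiM p_xt0 p_sigma (path _) (path _) e.
rewrite (class_sigma p_univ phi_eq phiM p_xt0) invg1 mul1g => <-.
by rewrite mulgA mulgV mul1g.
Qed.

Lemma deck_cocycle_in g x : L (c g x).
Proof. exact: (class_in p_univ phi_in p_xt0). Qed.

Lemma deck_cocycle_compact (K : set Gt) : compact [set: M] -> compact K ->
  finite_set [set c g x | g in K & x in [set: M]].
Proof.
move=> cM cK.
have cKD : compact ((fun gx => b gx.1 gx.2) @` (K `*` domain)).
  apply: continuous_compact; last exact: compact_setX (domain_compact cM).
  by apply: continuous_subspaceT; exact: act_continuous.
apply: sub_finite_set (class_compact_finite cKD).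
move=> _ [g Kg [x _ <-]]; exists (b g (sigma x)) => //.
by exists (g, sigma x) => //; split=> //; exact: sigma_domain.
Qed.

Lemma deck_cocycle_simple g : compact [set: M] ->
  @simple_map _ (borel M) H (c g).
Proof.
move=> cM; split=> [|l].
  apply: (@sub_finite_set _ _ [set c g' x | g' in [set g] & x in [set: M]]); last first.
    by apply: deck_cocycle_compact => //; exact: compact_set1.
  by move=> _ [x _ <-]; exists g => //; exists x.
have /choice[Q QP] : forall j, exists Q : set Mt, open Q /\
    forall y, piece j (p y) -> cls y = l <-> Q y.
  by move=> j; have [Q oQ Qy] := class_level j l; exists Q.
(* On the part where [x] lies in [piece i] and its image in [piece j], [sigma] is the continuous
   section [s i] and the level set is the trace of an open set. *)
rewrite (_ : c g @^-1` [set l] = \bigcup_i \bigcup_j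
  (piece i `&` (a (q g) @^-1` piece j `&` (W i `&` (fun x => b g (s i x)) @^-1` Q j)))).
  apply: bigcupT_measurable => i; apply: bigcupT_measurable => j.
  apply: measurableI; first exact: measurable_piece.
  have ca : continuous (a (q g)).
    move=> y; apply: (continuous_comp (f := fun y => (q g, y)) (g := fun gx => a gx.1 gx.2)).
      exact: (cvg_pair (cvg_cst (q g)) cvg_id).
    exact: act_continuous.
  apply: measurableI; last first.
    apply: open_borel; rewrite /= openE => x [Wx Qx].
    have cs := @section_continuous i.
    have cb : {within W i, continuous (fun x => b g (s i x))}.
      apply: (within_continuous_comp cs (B := [set: Mt]) (f := b g)) => //.
      exact/continuous_subspaceT/act_continuousr.
    have [N [oN Nx NQ]] := (within_continuousP _ _).1 cb x Wx (Q j) (QP j).1 Qx.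
    rewrite /interior nbhsE; exists (W i `&` N); first by split; [apply: openI => //; have [] := hV i|].
    by move=> z [Wz Nz]; split=> //; exact: NQ.
  rewrite /piece preimage_setI preimage_bigcap.
  have oaU n : open (a (q g) @^-1` U n) by exact: preimage_open.
  apply: measurableI; first by apply: open_borel; exact: oaU.
  apply: bigcap_measurableType => n _; rewrite preimage_setC; apply: measurableC.
  by apply: open_borel; exact: oaU.
apply/seteqP; split=> [x /= cgx|x [i _ [j _ [pi [pj [_ Qx]]]]]].
  have [_ pi] := pindexP x; have [_ pj] := pindexP (a (q g) x).
  exists (pindex x) => //; exists (pindex (a (q g) x)) => //.
  split=> //; split=> //; split; first exact: pieceW.
  have [_ Qj] := QP (pindex (a (q g) x)).
  have [|Q1 _] := Qj (b g (sigma x)); first by rewrite b_lift p_sigma.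
  exact: Q1.
have [_ Qj] := QP j; rewrite /= /deck_cocycle.
have [|_ Q2] := Qj (b g (sigma x)); first by rewrite b_lift p_sigma.
by apply: Q2; rewrite /sigma (pindexE pi).
Qed.

(** Class 1 characterizes the preferred lift in each fibre, so [b g (sigma x)] is again a value of
    [sigma]. Through properness of the orbit map this bounds [g]. *)
Lemma deck_cocycle1 g x : c g x = 1%g -> domain (b g (sigma x)).
Proof.
move=> c1; rewrite (_ : b g (sigma x) = sigma (p (b g (sigma x)))).
  exact: sigma_domain.
apply: (class_injective phi_eq p_xt0 (p_sigma := p_sigma)); first by rewrite p_sigma.
by rewrite (class_sigma p_univ phi_eq phiM p_xt0).
Qed.

Lemma measurable_section i (A : set (borel Mt)) : measurable A ->
  measurable (W i `&` s i @^-1` A : set (borel M)).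
Proof.
move=> mA.
have ms : @measurable_fun _ _ (borel M) (borel Mt) (W i) (s i).
  apply: (@measurability _ _ (borel M) (borel Mt) (W i) (s i) (@open Mt)) => // _ [Q oQ <-].
  apply: open_borel; rewrite /= openE => x [Wx Qx].
  have [N [oN Nx NQ]] := (within_continuousP _ _).1 (@section_continuous i) x Wx _ oQ Qx.
  rewrite /interior nbhsE; exists (W i `&` N); first by split; [apply: openI => //; have [] := hV i|].
  by move=> z [Wz Nz]; split=> //; exact: NQ.
apply: ms => //; apply: open_borel; by have [] := hV i.
Qed.

(** Above [piece i] the section inverts [p] on the sheet [V i], where the lifted measure agrees with
    [mu]; the exceptional set is a countable union over the pieces. *)
Lemma natural_lift_ae (mu : {measure set (borel M) -> \bar R})
    (mut : {measure set (borel Mt) -> \bar R}) (P : Mt -> Prop) :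
  natural_lift p mu mut -> {ae mut, forall y, P y} ->
  {ae mu, forall x, P (sigma x)}.
Proof.
move=> [_ lift] [A [mA A0 PA]].
pose B i := piece i `&` (W i `&` s i @^-1` A) : set (borel M).
have mB i : measurable (B i).
  by apply: measurableI; [exact: measurable_piece|exact: measurable_section].
have B0 i : mu (B i) = 0%E.
  have pV : p @` V i = W i.
    apply/seteqP; split=> [_ [y Vy <-]|m Wm]; first exact: (sheet_in (hV i)).
    by have [e Ve pe] := sheet_surj (hV i) Wm; exists e.
  pose A' := A `&` (V i `&` p @^-1` piece i) : set (borel Mt).
  have mp : @measurable_fun _ _ (borel Mt) (borel M) [set: Mt] p.
    apply: (@measurability _ _ (borel Mt) (borel M) setT p (@open M)) => // _ [Q oQ <-].
    rewrite setTI; apply: open_borel; exact: preimage_open.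
  have mA' : measurable A'.
    apply: measurableI => //; apply: measurableI.
      by apply: open_borel; exact: sheet_open (hV i).
    by rewrite -[X in measurable X]setTI; apply: mp => //; exact: measurable_piece.
  have BA : B i = p @` A'.
    apply/seteqP; split=> [m [pi [Wm Am]]|_ [y [Ay [Vy py]] <-]].
      have [Vs ps] := sP Wm.
      by exists (s i m) => //; split=> //; split=> //; rewrite /= ps.
    have [Vs ps] := sP (pieceW py); split=> //; split; first exact: pieceW.
    by rewrite /= (sheet_inj (hV i) Vs Vy ps).
  rewrite BA -(lift (V i)) ?pV//; last by move=> y [_ []].
  apply: (subset_measure0 _ mA _ A0) => //; exact: subIsetl.
apply: (negligibleS (A := \bigcup_i B i)); last first.
  by apply: negligible_bigcup => i; apply/negligibleP; [exact: mB|exact: B0].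
move=> x; have [_ pi] := pindexP x => nP.
exists (pindex x) => //; split=> //; split; first exact: pieceW.
exact: PA.
Qed.

End Cover.

(** * Unipotent elements of SO(n,1) *)

Section LorentzMatrices.
Context (R : realType) (N : nat).
Implicit Types (v w : 'cV[R]_N) (t : R).

Definition emb : 'M[R]_(N.+2, N) := \matrix_(i, j) (i == j :> nat)%:R.
Definition null1 : 'cV[R]_N.+2 := \col_i (if (i < N)%N then 0 else 1).
Definition null2 : 'cV[R]_N.+2 :=
  \col_i (if (i < N)%N then 0 else if i == N :> nat then -1 else 1).
Definition lorentz : 'M[R]_N.+2 := diag_mx (\row_i (if i == ord_max then -1 else 1)).

Local Notation P := emb.
Local Notation z := null1.
Local Notation y := null2.
Local Notation J := lorentz.

(* In the coordinates dual to the null vectors [z] and [y] and to the columns of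
   [P], [unip v] fixes [z] and translates the horosphere centred there. *)
Definition unip v : 'M[R]_N.+2 :=
  1%:M + P *m v *m y^T + z *m v^T *m P^T + 2^-1 *: (z *m v^T *m v *m y^T).

(** It multiplies [z] by [expR t] and [y] by [expR (- t)] and fixes the columns of [P]; the division
    by 2 compensates for the squared length of [z] and [y]. *)
Definition boost t : 'M[R]_N.+2 :=
  1%:M + ((expR t - 1) / 2) *: (z *m z^T) + ((expR (- t) - 1) / 2) *: (y *m y^T).

Let split_sum (f : 'I_N.+2 -> R) : \sum_i f i =
  \sum_(j < N) f (widen_ord (leqnSn N.+1) (widen_ord (leqnSn N) j)) +
  f (widen_ord (leqnSn N.+1) ord_max) + f ord_max.
Proof. by rewrite big_ord_recr big_ord_recr. Qed.

Let sum0 (f : 'I_N -> R) : (forall j, f j = 0) -> \sum_j f j = 0.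
Proof. by move=> f0; apply: big1. Qed.

Lemma null1_null1 : z^T *m z = 2%:M.
Proof.
apply/matrixP => i j; rewrite !ord1 mxE split_sum !mxE/= ltnn ltnNge leqnSn/=.
by rewrite sum0 => [|k]; rewrite ?mxE/= ?ltn_ord ?mul0r//; ring.
Qed.

Lemma null2_null2 : y^T *m y = 2%:M.
Proof.
apply/matrixP => i j; rewrite !ord1 mxE split_sum !mxE/= ltnn ltnNge leqnSn/= eqxx.
rewrite (gtn_eqF (ltnSn N)).
by rewrite sum0 => [|k]; rewrite ?mxE/= ?ltn_ord ?mul0r//; ring.
Qed.

Lemma null2_null1 : y^T *m z = 0.
Proof.
apply/matrixP => i j; rewrite !ord1 mxE split_sum !mxE/= ltnn ltnNge leqnSn/= eqxx.
rewrite (gtn_eqF (ltnSn N)).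
by rewrite sum0 => [|k]; rewrite ?mxE/= ?ltn_ord ?mul0r//; ring.
Qed.

Lemma null1_null2 : z^T *m y = 0.
Proof. by rewrite -[RHS]trmx0 -null2_null1 trmx_mul trmxK. Qed.

Lemma emb_emb : P^T *m P = 1%:M.
Proof.
apply/matrixP => i j; rewrite mxE split_sum !mxE/=.
rewrite (gtn_eqF (ltn_ord i)) (gtn_eqF (leqW (ltn_ord i))) !mul0r !addr0.
rewrite (bigD1 i)//= !mxE/= eqxx mul1r big1 ?addr0// => k ki.
by rewrite !mxE/= (negbTE ki : (k == i :> nat) = false) mul0r.
Qed.

Lemma emb_null1 : P^T *m z = 0.
Proof.
apply/matrixP => i j; rewrite !ord1 mxE split_sum !mxE/=.
rewrite (gtn_eqF (ltn_ord i)) (gtn_eqF (leqW (ltn_ord i))) !mul0r !addr0.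
by rewrite sum0 // => k; rewrite !mxE/= ltn_ord mulr0.
Qed.

Lemma emb_null2 : P^T *m y = 0.
Proof.
apply/matrixP => i j; rewrite !ord1 mxE split_sum !mxE/=.
rewrite (gtn_eqF (ltn_ord i)) (gtn_eqF (leqW (ltn_ord i))) !mul0r !addr0.
by rewrite sum0 // => k; rewrite !mxE/= ltn_ord mulr0.
Qed.

Lemma null1_emb : z^T *m P = 0.
Proof. by rewrite -[RHS]trmx0 -emb_null1 trmx_mul trmxK. Qed.

Lemma null2_emb : y^T *m P = 0.
Proof. by rewrite -[RHS]trmx0 -emb_null2 trmx_mul trmxK. Qed.

Lemma lorentz_null1 : J *m z = - y.
Proof.
apply/matrixP => i j; rewrite /lorentz mul_diag_mx !mxE.
have [/eqP iN|iN] := boolP (i == ord_max).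
  by rewrite iN/= ltnNge leqnSn/= (gtn_eqF (ltnSn N)) mulr1.
rewrite mul1r; case: ltnP => [|Ni]; first by rewrite oppr0.
have -> : i == N :> nat by rewrite eqn_leq Ni andbT -ltnS ltn_neqAle iN -ltnS ltn_ord.
by rewrite opprK.
Qed.

Lemma lorentz_tr : J^T = J. Proof. exact: tr_diag_mx. Qed.

Lemma lorentz_sqr : J *m J = 1%:M.
Proof.
rewrite /lorentz mulmx_diag -diag_const_mx; congr diag_mx.
by apply/rowP => i; rewrite !mxE; case: ifP => _; rewrite ?mulrNN mulr1.
Qed.

Lemma lorentz_null2 : J *m y = - z.
Proof.
have := congr1 (mulmx J) lorentz_null1; rewrite mulmxA lorentz_sqr mul1mx mulmxN.
by move=> ->; rewrite opprK.
Qed.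

Lemma lorentz_emb : J *m P = P.
Proof.
apply/matrixP => i j; rewrite /lorentz mul_diag_mx !mxE.
case: eqP => [->|_]; last by rewrite mul1r.
by rewrite /= (gtn_eqF (leqW (ltn_ord j))) mulr0.
Qed.

Let kill := (null1_null2, null2_null1, emb_null1, emb_null2, null1_emb, null2_emb,
  mulmx0, mul0mx, scaler0, addr0, add0r).

Let unip_null1 v : unip v *m z = z.
Proof.
by rewrite /unip !mulmxDl mul1mx -scalemxAl -!mulmxA !kill.
Qed.

Let unip_emb v : unip v *m P = P + z *m v^T.
Proof.
by rewrite /unip !mulmxDl mul1mx -scalemxAl -!mulmxA !kill emb_emb mulmx1.
Qed.

Lemma unipD v w : unip (v + w) = unip v *m unip w.
Proof.
have vw : w^T *m v = v^T *m w.
  by rewrite [LHS]mx11_scalar -[LHS]tr_scalar_mx -mx11_scalar trmx_mul trmxK.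
rewrite [unip w in RHS]/unip !mulmxDr mulmx1 -scalemxAr !mulmxA unip_null1 unip_emb.
have tD : (v + w)^T = v^T + w^T by rewrite linearD.
rewrite /unip tD !(mulmxDl, mulmxDr)/= -[z *m w^T *m v]mulmxA vw [z *m (v^T *m w)]mulmxA.
move: (P *m v *m y^T) (P *m w *m y^T) (z *m v^T *m P^T) (z *m w^T *m P^T)
  (z *m v^T *m v *m y^T) (z *m v^T *m w *m y^T) (z *m w^T *m w *m y^T).
by move=> a b c d e f g; apply/matrixP => i j; rewrite !mxE; field.
Qed.

Lemma unip0 : unip 0 = 1%:M.
Proof. by rewrite /unip trmx0 !(mulmx0, mul0mx) scaler0 !addr0. Qed.

Let boost_null1 t : boost t *m z = expR t *: z.
Proof.
rewrite /boost !mulmxDl mul1mx -!scalemxAl -!mulmxA null1_null1 null2_null1 mulmx0 scaler0 addr0.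
rewrite mul_mx_scalar scalerA -[X in X + _]scale1r -scalerDl; congr (_ *: _).
by rewrite divfK// addrC subrK.
Qed.

Let boost_null2 t : boost t *m y = expR (- t) *: y.
Proof.
rewrite /boost !mulmxDl mul1mx -!scalemxAl -!mulmxA null1_null2 null2_null2 mulmx0 scaler0 addr0.
rewrite mul_mx_scalar scalerA -[X in X + _]scale1r -scalerDl; congr (_ *: _).
by rewrite divfK// addrC subrK.
Qed.

Let boost_emb t : boost t *m P = P.
Proof.
by rewrite /boost !mulmxDl mul1mx -!scalemxAl -!mulmxA null1_emb null2_emb !mulmx0 !scaler0 !addr0.
Qed.

Lemma boost_tr t : (boost t)^T = boost t.
Proof. by rewrite /boost !linearD/= !linearZ/= !trmx_mul !trmxK tr_scalar_mx. Qed.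

Lemma boostD s t : boost (s + t) = boost s *m boost t.
Proof.
rewrite [boost t in RHS]/boost !mulmxDr mulmx1 -!scalemxAr !mulmxA boost_null1 boost_null2.
rewrite /boost -!scalemxAl opprD !expRD.
move: (z *m z^T) (y *m y^T) => a b; apply/matrixP => i j; rewrite !mxE.
by field.
Qed.

Lemma boost0 : boost 0 = 1%:M.
Proof. by rewrite /boost oppr0 expR0 subrr mul0r !scale0r !addr0. Qed.

Lemma boost_unip t v : boost t *m unip v = unip (expR t *: v) *m boost t.
Proof.
have zb : z^T *m boost t = expR t *: z^T.
  by rewrite -[boost t]boost_tr -trmx_mul boost_null1 linearZ.
have yb : y^T *m boost t = expR (- t) *: y^T.
  by rewrite -[boost t]boost_tr -trmx_mul boost_null2 linearZ.
have Pb : P^T *m boost t = P^T.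
  by rewrite -[boost t]boost_tr -trmx_mul boost_emb.
have L : boost t *m unip v = boost t + P *m v *m y^T + expR t *: (z *m v^T *m P^T) +
    (2^-1 * expR t) *: (z *m v^T *m v *m y^T).
  rewrite /unip !mulmxDr mulmx1 -scalemxAr !mulmxA boost_emb boost_null1.
  by rewrite -!scalemxAl scalerA.
have M w : unip w *m boost t = boost t + expR (- t) *: (P *m w *m y^T) +
    z *m w^T *m P^T + (2^-1 * expR (- t)) *: (z *m w^T *m w *m y^T).
  rewrite /unip !mulmxDl mul1mx -scalemxAl -[P *m w *m y^T *m _]mulmxA yb.
  rewrite -[z *m w^T *m P^T *m _]mulmxA Pb -[z *m w^T *m w *m y^T *m _]mulmxA yb.
  by rewrite -!scalemxAr scalerA.
have e1 : expR (- t) * expR t = 1 by rewrite -expRD addNr expR0.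
have tZ : (expR t *: v)^T = expR t *: v^T by rewrite linearZ.
rewrite L M tZ -!(scalemxAr, scalemxAl) !scalerA e1 scale1r.
by congr (_ + _ *: _); rewrite -!mulrA; congr (_ * _); rewrite mulrA e1 mul1r.
Qed.

Definition lorentzian (g : 'M[R]_N.+2) : Prop := g^T *m J *m g = J.

Lemma lorentzian_unip v : lorentzian (unip v).
Proof.
have zJ : z^T *m J = - y^T by rewrite -lorentz_tr -trmx_mul lorentz_null1 linearN.
have yJ : y^T *m J = - z^T by rewrite -lorentz_tr -trmx_mul lorentz_null2 linearN.
have PJ : P^T *m J = P^T by rewrite -lorentz_tr -trmx_mul lorentz_emb.
have uN : unip (- v) = 1%:M - P *m v *m y^T - z *m v^T *m P^T +
    2^-1 *: (z *m v^T *m v *m y^T).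
  have tN : (- v)^T = - v^T by rewrite linearN.
  by rewrite /unip tN !(mulmxN, mulNmx) opprK.
have uT : (unip v)^T = 1%:M + y *m v^T *m P^T + P *m v *m z^T +
    2^-1 *: (y *m v^T *m v *m z^T).
  rewrite /unip [LHS]linearD/= [(_ + _)^T]linearD/= [(_ + _)^T]linearD/= trmx1.
  by rewrite [(_ *: _)^T]linearZ/= !trmx_mul !trmxK !mulmxA.
have Jt : (unip v)^T *m J = J *m unip (- v).
  rewrite uT uN !mulmxDl !mulmxDr !mulmxN mul1mx mulmx1 -scalemxAl -scalemxAr.
  rewrite !mulmxA lorentz_emb lorentz_null1 -[_ *m P^T *m J]mulmxA PJ.
  rewrite -![_ *m z^T *m J]mulmxA zJ !(mulmxN, mulNmx).
  move: (y *m v^T *m P^T) (P *m v *m y^T) (y *m v^T *m v *m y^T) => a b c.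
  by apply/matrixP => i j; rewrite !mxE; ring.
rewrite /lorentzian Jt -mulmxA -unipD addNr.
by rewrite unip0 mulmx1.
Qed.

Lemma lorentzian_boost t : lorentzian (boost t).
Proof.
have Jt : (boost t)^T *m J = J *m boost (- t).
  have zJ : z^T *m J = - y^T by rewrite -lorentz_tr -trmx_mul lorentz_null1 linearN.
  have yJ : y^T *m J = - z^T by rewrite -lorentz_tr -trmx_mul lorentz_null2 linearN.
  rewrite boost_tr /boost opprK !mulmxDl !mulmxDr mul1mx mulmx1.
  rewrite -!scalemxAl -!scalemxAr -!mulmxA zJ yJ !mulmxA lorentz_null1 lorentz_null2.
  rewrite !(mulmxN, mulNmx).
  move: (y *m z^T) (z *m y^T) => a b.
  by apply/matrixP => i j; rewrite !mxE; ring.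
by rewrite /lorentzian Jt -mulmxA -boostD addNr boost0 mulmx1.
Qed.

Lemma lorentzianT g : lorentzian g -> lorentzian g^T.
Proof.
rewrite /lorentzian trmxK => gJ.
have h : (J *m g^T *m J) *m g = 1%:M by rewrite -!mulmxA (mulmxA g^T) gJ lorentz_sqr.
have := mulmx1C h; rewrite !mulmxA => h'.
by move/(congr1 (mulmx^~ J)): h' => /=; rewrite -(mulmxA _ J J) lorentz_sqr mulmx1 mul1mx.
Qed.

Lemma hformE (x : 'cV[R]_N.+2) : (hform x)%:M = x^T *m J *m x.
Proof.
rewrite [RHS]mx11_scalar; congr (_%:M); rewrite !mxE big_ord_recr/= /hform.
congr (_ + _).
  apply: eq_bigr => i _; rewrite mxE (bigD1 (widen_ord (leqnSn N.+1) i))//= big1 ?addr0.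
    rewrite !mxE eqxx mulr1n; case: eqP => [/(congr1 val)/= e|_].
      by have := ltn_ord i; rewrite e ltnn.
    by rewrite mulr1 real_normK ?num_real// expr2.
  by move=> j /negbTE ji; rewrite !mxE ji mulr0n mulr0.
rewrite mxE (bigD1 ord_max)//= big1 ?addr0.
  by rewrite !mxE eqxx mulr1n mulrN1 mulNr real_normK ?num_real// expr2.
by move=> j /negbTE ji; rewrite !mxE ji mulr0n mulr0.
Qed.

Lemma lorentzian_pseudo_unitary g : \det g = 1 -> lorentzian g ->
  pseudo_unitary g.
Proof.
move=> dg gJ; split=> // x.
have : (hform (g *m x))%:M = (hform x)%:M :> 'M[R]_1.
  by rewrite !hformE -[in RHS]gJ trmx_mul !mulmxA.
by move/matrixP/(_ 0 0); rewrite !mxE eqxx !mulr1n.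
Qed.

(** The form only gives determinant 1 up to sign. A square root settles the sign, and one-parameter
    families provide one at half the parameter. *)
Lemma lorentzian_det (g h : 'M[R]_N.+2) : lorentzian h -> g = h *m h -> \det g = 1.
Proof.
move=> hJ ->; rewrite det_mulmx.
have J0 : \det J != 0.
  have := congr1 determinant lorentz_sqr; rewrite det_mulmx det1 => e.
  by apply/eqP => J0; move: e; rewrite J0 mul0r => /eqP; rewrite eq_sym oner_eq0.
have := congr1 determinant hJ; rewrite !det_mulmx det_tr mulrAC => e.
by apply: (mulIf J0); rewrite mul1r.
Qed.

End LorentzMatrices.

Lemma path_identity_component (R : realType) m (c : R -> 'M[R]_m.+1) : continuous c ->
  c 0 = 1%:M -> (forall t, pseudo_unitary (c t)) -> forall t, identity_component (c t).
Proof.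
move=> cc c0 pc t; exists (range c); last by exists t.
split; first by exists 0.
  by move=> _ [s _ <-]; exact: pc.
apply: connected_continuous_connected; last exact: continuous_subspaceT.
by apply/connected_intervalP => a b _ _ x _.
Qed.

(** * Matrix sizes and the unipotent elements *)

Section MatrixSize.
Context (R : realType).

Definition mxsize m n (A : 'M[R]_(m, n)) : R := \sum_i \sum_j `|A i j|.

Lemma mxsize_ge0 m n (A : 'M[R]_(m, n)) : 0 <= mxsize A.
Proof. by apply: sumr_ge0 => i _; apply: sumr_ge0. Qed.

Lemma le_entry_mxsize m n (A : 'M[R]_(m, n)) i j : `|A i j| <= mxsize A.
Proof.
rewrite /mxsize (bigD1 i)//= (bigD1 j)//= -addrA lerDl addr_ge0 ?sumr_ge0// => k _.
exact: sumr_ge0.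
Qed.

Lemma mxsizeM m n l (A : 'M[R]_(m, n)) (B : 'M[R]_(n, l)) :
  mxsize (A *m B) <= mxsize A * mxsize B.
Proof.
rewrite /mxsize mulr_suml; apply: ler_sum => i _.
apply: (@le_trans _ _ (\sum_j \sum_k `|A i k| * `|B k j|)).
  apply: ler_sum => j _; rewrite mxE; apply: le_trans (ler_norm_sum _ _ _) _.
  by apply: ler_sum => k _; rewrite normrM.
rewrite exchange_big/= mulr_suml; apply: ler_sum => k _.
rewrite -mulr_sumr ler_wpM2l// (bigD1 k)//= lerDl; apply: sumr_ge0 => ? _; exact: sumr_ge0.
Qed.

Lemma bilinear_le_mxsize m n (A : 'M[R]_(m, n)) (x : 'cV[R]_m) (y : 'cV[R]_n) :
  (forall i, `|x i 0| <= 1) -> (forall j, `|y j 0| <= 1) ->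
  `|(x^T *m A *m y) 0 0| <= mxsize A.
Proof.
move=> x1 y1; rewrite mxE; apply: le_trans (ler_norm_sum _ _ _) _.
rewrite /mxsize exchange_big/=; apply: ler_sum => j _.
rewrite normrM mxE; apply: (@le_trans _ _ (`|\sum_k x^T 0 k * A k j| * 1)).
  by rewrite ler_wpM2l.
rewrite mulr1; apply: le_trans (ler_norm_sum _ _ _) _; apply: ler_sum => i _.
by rewrite normrM mxE ler_piMl.
Qed.

End MatrixSize.

Section LorentzGroup.
Context (R : realType) (N : nat).
Local Notation J := (lorentz R N).
Local Notation G := (mxgroup_type (SO R N.+1)).
Implicit Types (v w s : 'cV[R]_N) (t : R).

Lemma null_entries (i : 'I_N.+2) : `|null1 R N i 0| <= 1 /\ `|null2 R N i 0| <= 1.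
Proof. by rewrite !mxE; do 2?case: ifP => _; rewrite ?normr0 ?normrN ?normr1. Qed.

(** Pair the product with [y^T] on the left and [z] on the right: [unip v] fixes [y^T] and [unip w]
    fixes [z], so the outer factors disappear and [2 s^T s] is left. Both null vectors have entries
    of absolute value at most 1. *)
Lemma unip_opposite_size v s w j :
  2 * s j 0 ^+ 2 <= mxsize (unip v *m (unip s)^T *m unip w).
Proof.
apply: (@le_trans _ _ (`|((null2 R N)^T *m (unip v *m (unip s)^T *m unip w) *m null1 R N) 0 0|)); last first.
  by apply: bilinear_le_mxsize => i; have [] := null_entries i.
have fixz x : unip x *m null1 R N = null1 R N.
  rewrite /unip !mulmxDl mul1mx -scalemxAl -!mulmxA null2_null1 emb_null1.
  by rewrite !mulmx0 scaler0 !addr0.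
have fixy x : (null2 R N)^T *m unip x = (null2 R N)^T.
  rewrite /unip !mulmxDr mulmx1 -scalemxAr !mulmxA null2_emb null2_null1.
  by rewrite !mul0mx scaler0 !addr0.
have -> : (null2 R N)^T *m (unip v *m (unip s)^T *m unip w) *m null1 R N =
    2 *: (s^T *m s).
  rewrite !mulmxA fixy -!mulmxA fixz mulmxA.
  apply: (@trmx_inj _ _ _); rewrite !trmx_mul !trmxK mulmxA.
  rewrite /unip !mulmxDr !mulmxDl mulmx1 null1_null2 add0r.
  rewrite -!scalemxAr -!scalemxAl !mulmxA null1_emb !mul0mx add0r.
  rewrite -[_ *m (emb R N)^T *m _]mulmxA emb_null2 mulmx0 add0r.
  rewrite null1_null1 -!mulmxA null2_null2 mul_scalar_mx mul_mx_scalar.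
  by rewrite !scalerA linearZ/= mulVf ?scale1r// [RHS]linearZ/= trmx_mul trmxK.
have -> : (2 *: (s^T *m s)) 0 0 = 2 * \sum_k s k 0 ^+ 2.
  by rewrite !mxE; congr (_ * _); apply: eq_bigr => k _; rewrite mxE expr2.
have s0 : 0 <= \sum_k s k 0 ^+ 2 by apply: sumr_ge0 => k _; exact: sqr_ge0.
rewrite ger0_norm ?mulr_ge0// ler_wpM2l// (bigD1 j)//= lerDl sumr_ge0// => k _.
exact: sqr_ge0.
Qed.

Lemma unip_size v j : `|v j 0| <= mxsize (unip v).
Proof.
pose i : 'I_N.+2 := widen_ord (leqnSn N.+1) (widen_ord (leqnSn N) j).
suff -> : v j 0 = unip v i ord_max by exact: le_entry_mxsize.
have zi (A : 'M[R]_(1, N.+2)) k : (null1 R N *m A) i k = 0.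
  by rewrite mxE big1// => l _; rewrite mxE/= ltn_ord mul0r.
have E (a b c d : 'M[R]_N.+2) : (a + b + c + 2^-1 *: d) i ord_max =
    a i ord_max + b i ord_max + c i ord_max + 2^-1 * d i ord_max by rewrite !mxE.
rewrite /unip E -(mulmxA (null1 R N)) zi -!(mulmxA (null1 R N)) zi.
rewrite [X in _ = X + _ + _ + _](_ : _ = 0); last first.
  rewrite mxE; case: eqP => // /(congr1 val)/= e.
  by have := ltn_ord j; rewrite e ltnNge leqW.
rewrite mulr0 !addr0 add0r mxE big_ord1 mxE (bigD1 j)//= !mxE/= eqxx mul1r.
rewrite ltnNge leqnSn/= (gtn_eqF (ltnSn N)) mulr1 big1 ?addr0// => k kj.
by rewrite mxE/= eq_sym (negbTE kj : (k == j :> nat) = false) mul0r.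
Qed.

Lemma unip_continuous v : continuous (fun t : R => unip (t *: v)).
Proof.
have E t : unip (t *: v) = 1%:M + t *: (emb R N *m v *m (null2 R N)^T +
    null1 R N *m v^T *m (emb R N)^T) + (t * t) *: (2^-1 *: (null1 R N *m v^T *m v *m (null2 R N)^T)).
  have tZ : (t *: v)^T = t *: v^T by rewrite linearZ.
  rewrite /unip tZ -!(scalemxAr, scalemxAl) !scalerA scalerDr !addrA.
  by congr (_ + _ *: _); ring.
move: (emb R N *m v *m (null2 R N)^T + _) (2^-1 *: _) E => A B E.
apply: mx_continuous => i j; under eq_fun do rewrite E !mxE.
move=> t; apply: cvgD; [apply: cvgD; [exact: cvg_cst|]|].
  by apply: cvgM; [exact: cvg_id|exact: cvg_cst].
by apply: cvgM; [apply: cvgM; exact: cvg_id|exact: cvg_cst].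
Qed.

Lemma boost_continuous : continuous (@boost R N).
Proof.
rewrite /boost; move: (null1 R N *m _) (null2 R N *m _) => A B.
apply: mx_continuous => i j; under eq_fun do rewrite !mxE.
move=> t; apply: cvgD; [apply: cvgD; [exact: cvg_cst|]|].
  apply: cvgM; last exact: cvg_cst.
  apply: cvgM; last exact: cvg_cst.
  by apply: cvgB; [exact: continuous_expR|exact: cvg_cst].
apply: cvgM; last exact: cvg_cst.
apply: cvgM; last exact: cvg_cst.
apply: cvgB; last exact: cvg_cst.
by apply: continuous_comp; [exact: cvgN|exact: continuous_expR].
Qed.

Let det_unip v : \det (unip v) = 1.
Proof.
apply: (@lorentzian_det R N _ (unip (2^-1 *: v))); first exact: lorentzian_unip.
rewrite -unipD -scalerDl (_ : 2^-1 + 2^-1 = 1) ?scale1r//; lra.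
Qed.

Let det_boost t : \det (@boost R N t) = 1.
Proof.
apply: (@lorentzian_det R N _ (boost N (t / 2))); first exact: lorentzian_boost.
by rewrite -boostD -splitr.
Qed.

Lemma identity_component_unip v : identity_component (unip v).
Proof.
have := @path_identity_component R N.+1 (fun t => unip (t *: v)) (@unip_continuous v) _ _ 1.
rewrite scale1r scale0r; apply; first exact: unip0.
by move=> t; apply: lorentzian_pseudo_unitary; [exact: det_unip|exact: lorentzian_unip].
Qed.

Lemma identity_component_unipT v : identity_component (unip v)^T.
Proof.
have := @path_identity_component R N.+1 (fun t => (unip (t *: v))^T) _ _ _ 1.
rewrite scale1r scale0r; apply.
- apply: mx_continuous => i j; under eq_fun do rewrite mxE.
  by apply: entry_continuous; exact: unip_continuous.
- by rewrite unip0 trmx1.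
- move=> t; apply: lorentzian_pseudo_unitary; first by rewrite det_tr det_unip.
  exact/lorentzianT/lorentzian_unip.
Qed.

Lemma identity_component_boost t : identity_component (boost N t).
Proof.
apply: (@path_identity_component R N.+1 (boost N)); first exact: boost_continuous.
  exact: boost0.
by move=> s; apply: lorentzian_pseudo_unitary; [exact: det_boost|exact: lorentzian_boost].
Qed.

Definition gunip v : G := mxgroup_mk (A := SO R N.+1) (identity_component_unip v).
Definition gunipT v : G := mxgroup_mk (A := SO R N.+1) (identity_component_unipT v).
Definition gboost t : G := mxgroup_mk (A := SO R N.+1) (identity_component_boost t).

Lemma gunipD v w : gunip (v + w) = (gunip v * gunip w)%g.
Proof. by apply: val_inj; rewrite /= unipD. Qed.

Lemma gunipTD v w : gunipT (v + w) = (gunipT v * gunipT w)%g.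
Proof. by apply: val_inj; rewrite /= addrC unipD trmx_mul. Qed.

Lemma gboost_unip v :
  (gboost (ln 2) * gunip v)%g = (gunip (2 *: v) * gboost (ln 2))%g.
Proof. by apply: val_inj; rewrite /= boost_unip lnK// posrE. Qed.

Lemma gboost_unipT v :
  (gunipT v * gboost (ln 2))%g = (gboost (ln 2) * gunipT (2 *: v))%g.
Proof.
apply: val_inj; rewrite /=.
have := congr1 trmx (boost_unip (ln 2) v); rewrite !trmx_mul !boost_tr lnK// posrE//.
Qed.

Lemma mxgroup_continuous (T : topologicalType) (f : T -> G) :
  continuous (fun x => val (f x)) -> continuous f.
Proof.
move=> cf.
exact: (@continuous_comp_initial _ _ _ (set_val : set_type (mxgroup_set (SO R N.+1)) -> _)).
Qed.

Lemma gunip_continuous v : continuous (fun t : R => gunip (t *: v)).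
Proof. by apply: mxgroup_continuous; exact: unip_continuous. Qed.

Lemma gunipT_continuous v : continuous (fun t : R => gunipT (t *: v)).
Proof.
apply: mxgroup_continuous; apply: mx_continuous => i j; under eq_fun do rewrite mxE.
by apply: entry_continuous; exact: unip_continuous.
Qed.

End LorentzGroup.

(** * Lifts to the covering group *)

Section OneParameterLifts.
Context (R : realType) (N : nat) (G Gt : topGroupType) (q : Gt -> G).
Hypothesis qM : {morph q : g h / (g * h)%g}.
Hypothesis q_cov : covering q.

Lemma morph_one : q 1%g = 1%g.
Proof. by apply: (mulgI (q 1%g)); rewrite -qM !mulg1. Qed.

Lemma morph_inv g : q g^-1%g = (q g)^-1%g.
Proof. by apply: (mulgI (q g)); rewrite -qM !mulgV morph_one. Qed.

Lemma within_continuous_mulg (A : set R) (f g : R -> Gt) :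
  {within A, continuous f} -> {within A, continuous g} ->
  {within A, continuous (fun t => (f t * g t)%g)}.
Proof.
move=> cf cg.
have cfg : {within A, continuous (fun t => (f t, g t))}.
  by move=> t; exact: (cvg_pair (cf t) (cg t)).
have := within_continuous_comp cfg (B := [set: Gt * Gt]) (f := fun x => (x.1 * x.2)%g).
apply=> //; apply: continuous_subspaceT; exact: mulg_continuous.
Qed.

Variable u : 'cV[R]_N -> G.
Hypothesis uD : forall v w, u (v + w) = (u v * u w)%g.
Hypothesis u_continuous : forall v, continuous (fun t : R => u (t *: v)).
Implicit Types v w : 'cV[R]_N.

Lemma family_zero : u 0 = 1%g.
Proof. by apply: (mulgI (u 0)); rewrite -uD addr0 mulg1. Qed.

Lemma family_lift_exists v : exists f : R -> Gt, [/\ {within `[0, 1], continuous f},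
  f 0 = 1%g & forall t, t \in `[0, 1] -> q (f t) = u (t *: v)].
Proof.
apply: (lift_exists q_cov (al := fun t => u (t *: v))).
  exact: continuous_subspaceT.
by rewrite scale0r family_zero morph_one.
Qed.

Definition family_path v : R -> Gt := sval (cid (family_lift_exists v)).

(** The path [t *: v] singles out one preimage of [u v]; additivity and conjugation rules then
    follow from uniqueness of lifts. *)
Definition family_lift v : Gt := family_path v 1.

Lemma family_pathP v : [/\ {within `[0, 1], continuous (family_path v)},
  family_path v 0 = 1%g & forall t, t \in `[0, 1] -> q (family_path v t) = u (t *: v)].
Proof. by rewrite /family_path; case: cid. Qed.

Let I0 : (0 : R) \in `[0, 1]. Proof. by rewrite in_itv/= lexx ler01. Qed.
Let I1 : (1 : R) \in `[0, 1]. Proof. by rewrite in_itv/= lexx ler01. Qed.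

Lemma q_family_lift v : q (family_lift v) = u v.
Proof. by have [_ _ /(_ 1 I1)] := family_pathP v; rewrite scale1r. Qed.

Lemma family_lift_unique v (f : R -> Gt) : {within `[0, 1], continuous f} ->
  f 0 = 1%g -> (forall t, t \in `[0, 1] -> q (f t) = u (t *: v)) ->
  f 1 = family_lift v.
Proof.
move=> cf f0 qf; have [c0 p0 qp] := family_pathP v.
apply: (lift_unique q_cov (@segment_connected R 0 1) cf c0 _ I0 I1).
  by move=> s sI; rewrite qf// qp.
by rewrite f0 p0.
Qed.

Lemma family_liftD v w : family_lift (v + w) = (family_lift v * family_lift w)%g.
Proof.
have [cv v0 qv] := family_pathP v; have [cw w0 qw] := family_pathP w.
symmetry; apply: (family_lift_unique (f := fun t => (family_path v t * family_path w t)%g)).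
- exact: within_continuous_mulg.
- by rewrite v0 w0 mulg1.
- by move=> t tI; rewrite qM qv// qw// scalerDr uD.
Qed.

Lemma family_lift0 : family_lift 0 = 1%g.
Proof. by apply: (mulgI (family_lift 0)); rewrite -family_liftD addr0 mulg1. Qed.

Lemma family_liftN v : family_lift (- v) = (family_lift v)^-1%g.
Proof. by apply: (mulgI (family_lift v)); rewrite -family_liftD subrr family_lift0 mulgV. Qed.

Lemma family_lift_conj (h : Gt) (a : R) :
  (forall v, (q h * u v)%g = (u (a *: v) * q h)%g) ->
  forall v, (h * family_lift v)%g = (family_lift (a *: v) * h)%g.
Proof.
move=> hu v; have [cv v0 qv] := family_pathP v.
have cc (g : Gt) : {within `[0, 1], continuous (fun _ : R => g)} by exact: cst_continuous.
have <- : (h * family_lift v * h^-1)%g = family_lift (a *: v).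
  apply: (family_lift_unique (f := fun t => (h * family_path v t * h^-1)%g)).
  - by do 2?apply: within_continuous_mulg.
  - by rewrite v0 mulg1 mulgV.
  - move=> t tI; rewrite !qM qv// hu -mulgA -qM mulgV morph_one mulg1.
    by rewrite !scalerA mulrC.
by rewrite mulgVK.
Qed.

Lemma family_lift_segment v : exists2 K : set Gt, compact K &
  forall t, t \in `[0, 1] -> K (family_lift (t *: v)).
Proof.
have [cv v0 qv] := family_pathP v.
exists (family_path v @` [set` `[0, 1]]).
  apply: continuous_compact => //; exact: segment_compact.
move=> t tI; exists t => //.
have ct : {within `[0, 1], continuous (fun s : R => s * t)}.
  by apply: continuous_subspaceT => s; apply: cvgM; [exact: cvg_id|exact: cvg_cst].
have tI' s : s \in `[0, 1] -> s * t \in `[0, 1].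
  move: tI; rewrite !in_itv/= => /andP[t0 t1] /andP[s0 s1].
  by rewrite mulr_ge0//= mulr_ile1.
have := @family_lift_unique (t *: v) (fun s => family_path v (s * t)).
rewrite mul1r mul0r; apply => //.
  exact: (within_continuous_comp ct _ cv).
by move=> s sI; rewrite qv ?tI'// scalerA.
Qed.

(** Continuity is known along lines only, so the cube is covered by a product of coordinate
    segments. *)
Lemma family_lift_cube : exists2 K : set Gt, compact K &
  forall v, (forall j, 0 <= v j 0 <= 1) -> K (family_lift v).
Proof.
have [K cK vK] : exists2 K : set Gt, compact K & forall v, (forall j, 0 <= v j 0 <= 1) ->
    K (family_lift (\sum_(j <- index_enum 'I_N) v j 0 *: delta_mx j 0)).
  elim: (index_enum 'I_N) => [|j r [K cK vK]].
    exists [set 1%g]; first exact: compact_set1.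
    by move=> v _; rewrite big_nil family_lift0.
  have [K' cK' vK'] := family_lift_segment (delta_mx j 0).
  exists ((fun x => (x.1 * x.2)%g) @` (K' `*` K)).
    apply: continuous_compact; last exact: compact_setX.
    by apply: continuous_subspaceT; exact: mulg_continuous.
  move=> v v01; rewrite big_cons family_liftD.
  exists (family_lift (v j 0 *: delta_mx j 0), family_lift (\sum_(i <- r) v i 0 *: delta_mx i 0)) => //.
  by split; [apply: vK'; rewrite in_itv/=; exact: v01|exact: vK].
exists K => // v v01.
rewrite [v](_ : _ = \sum_(j <- index_enum 'I_N) v j 0 *: delta_mx j 0); first exact: vK.
rewrite {1}[v]matrix_sum_delta; apply: eq_bigr => j _.
by rewrite big_ord1.
Qed.

End OneParameterLifts.

Lemma card_close_ffun (N K D : nat) (S : pred {ffun 'I_N -> 'I_K}) :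
  (forall w w', S w -> S w' -> forall j, (w j <= w' j + D)%N) ->
  (#|S| <= (2 * D).+1 ^ N)%N.
Proof.
move=> close; have [[w0 Sw0]|nS] := pselect (exists w, S w); last first.
  by rewrite eq_card0// => w; apply/negP => Sw; apply: nS; exists w.
(* Differences to [w0] lie in [[-D, D]]; adding [D] first avoids truncated subtraction. *)
pose h (w : {ffun 'I_N -> 'I_K}) : {ffun 'I_N -> 'I_(2 * D).+1} :=
  [ffun j => inord (w j + D - w0 j)].
have hinj : {in S &, injective h}.
  move=> w w' Sw Sw' hww'; apply/ffunP => j; apply: val_inj.
  have bound v : S v -> (w0 j <= v j + D)%N /\ (v j + D - w0 j < (2 * D).+1)%N.
    move=> Sv; split; first exact: close.
    by rewrite ltnS leq_subLR mul2n -addnn addnA leq_add2r; exact: close.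
  have [a1 b1] := bound w Sw; have [a2 b2] := bound w' Sw'.
  move/ffunP/(_ j): hww'; rewrite !ffunE => /(congr1 val); rewrite /= !inordK//.
  move=> e; apply/eqP; rewrite -(eqn_add2r D) -(subnK a1) -(subnK a2).
  by rewrite eqn_add2r; apply/eqP.
rewrite -(card_in_image hinj); apply: leq_trans (max_card _) _.
by rewrite card_ffun !card_ord.
Qed.

Lemma card_fiber_bound (W V : finType) (S : pred (W * V)) (A B : nat) :
  (forall v, (#|[pred w | S (w, v)]| <= A)%N) ->
  (#|[pred v | [exists w, S (w, v)]]| <= B)%N -> (#|S| <= A * B)%N.
Proof.
move=> SA SB; rewrite -sum1_card big_mkcond/=.
rewrite (eq_bigr (fun wv => if S (wv.1, wv.2) then 1 else 0)%N); last by case.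
rewrite -(pair_bigA _ (fun w v => if S (w, v) then 1 else 0)%N) exchange_big/=.
apply: (@leq_trans (\sum_v (if [exists w, S (w, v)] then A else 0))).
  apply: leq_sum => v _; case: ifPn => [_|/existsPn nS].
    by rewrite -big_mkcond sum1_card; exact: SA.
  by rewrite big1// => w _; rewrite (negbTE (nS w)).
by rewrite -big_mkcond sum_nat_const mulnC leq_mul2l SB orbT.
Qed.

Definition natv (K : pzRingType) (N : nat) (w : 'I_N -> nat) : 'cV[K]_N :=
  \col_j (w j)%:R.

(** The affine contraction that [A^-1 n_e], the inverse of a twisted boost, induces on horospherical
    coordinates. *)
Definition halving (K : unitRingType) (N : nat) (e y : 'cV[K]_N) := 2^-1 *: (e + y).

Lemma map_iter_halving (K K' : fieldType) (f : {rmorphism K -> K'}) N i (e y : 'cV[K]_N) :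
  map_mx f (iter i (halving e) y) = iter i (halving (map_mx f e)) (map_mx f y).
Proof.
elim: i => //= i IH; rewrite -IH.
by apply/matrixP => j l; rewrite !mxE rmorphM fmorphV rmorph_nat rmorphD.
Qed.

Lemma map_natv (K K' : pzRingType) (f : {rmorphism K -> K'}) N (w : 'I_N -> nat) :
  map_mx f (natv K w) = natv K' w.
Proof. by apply/matrixP => j l; rewrite !mxE rmorph_nat. Qed.

Lemma iter_halving_dist (R : realType) N i (e y y' : 'cV[R]_N) j :
  `|iter i (halving e) y j 0 - iter i (halving e) y' j 0| = 2^-1 ^+ i * `|y j 0 - y' j 0|.
Proof.
elim: i => [|i IH]; first by rewrite mul1r.
rewrite exprS -mulrA -IH !iterS; move: (iter i _ y) (iter i _ y') => z z'.
rewrite !mxE -mulrBr normrM; rewrite ger0_norm//.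
by rewrite opprD addrACA subrr add0r.
Qed.

(** * Counting elements of bounded size *)

Section HorosphereCount.
Context (R : realType) (N : nat) (Gt : topGroupType).
Local Notation G := (mxgroup_type (SO R N.+1)).
Variable q : Gt -> G.
Hypothesis qM : {morph q : g h / (g * h)%g}.
Hypothesis q_cov : covering q.
Variable At : Gt.
Hypothesis qAt : q At = gboost N (ln 2).

Local Notation nt := (family_lift qM q_cov (@gunipD R N) (@gunip_continuous R N)).
Local Notation mt := (family_lift qM q_cov (@gunipTD R N) (@gunipT_continuous R N)).
Local Notation pw A i := (A^-1 ^+ i)%g.
Implicit Types (v w x y : 'cV[R]_N).

(** Adding the size of the inverse gives invariance under inversion and keeps submultiplicativity,
    so quotients of elements of bounded size are bounded. *)
Definition gsize (g : Gt) : R := mxsize (val (q g)) + mxsize (val (q g^-1%g)).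

Lemma lift_boost_unip v : (At * nt v)%g = (nt (2 *: v) * At)%g.
Proof. by apply: family_lift_conj => w; rewrite qAt gboost_unip. Qed.

Lemma lift_boost_unipT v : (mt v * At)%g = (At * mt (2 *: v))%g.
Proof.
have := @family_lift_conj _ _ _ _ _ qM q_cov _ (@gunipTD R N) (@gunipT_continuous R N)
  At^-1%g 2.
rewrite (morph_inv qM) qAt => /(_ _ v) e.
apply: (mulgI At^-1%g); rewrite mulgA e ?mulgVK ?mulgA ?mulVg ?mul1g// => w.
apply: (mulgI (gboost N (ln 2))); rewrite !mulgA mulgV mul1g.
by rewrite -gboost_unipT -mulgA mulgV mulg1.
Qed.

Lemma lift_pow_unip i v : (pw At i * nt v)%g = (nt ((2^-1) ^+ i *: v) * pw At i)%g.
Proof.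
elim: i => [|i IH]; first by rewrite expg0 expr0 scale1r mul1g mulg1.
rewrite !expgS -mulgA IH !mulgA; congr (_ * _)%g.
apply: (mulgI At); rewrite !mulgA mulgV mul1g lift_boost_unip.
by rewrite -mulgA mulgV mulg1 scalerA exprS mulrA mulfV// mul1r.
Qed.

Lemma lift_pow_unipT i v : (At ^+ i * mt v * pw At i)%g = mt ((2^-1) ^+ i *: v).
Proof.
elim: i v => [|i IH] v; first by rewrite expg0 expr0 scale1r !mulg1 mul1g.
have -> : (At ^+ i.+1 * mt v * pw At i.+1 = At ^+ i * (At * mt v * At^-1) * pw At i)%g.
  by rewrite expgSr expgS !mulgA.
have -> : (At * mt v * At^-1)%g = mt (2^-1 *: v).
  have := lift_boost_unipT (2^-1 *: v); rewrite scalerA mulfV// scale1r => <-.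
  by rewrite -mulgA mulgV mulg1.
by rewrite IH scalerA exprSr.
Qed.

(** Since [A^-1 n_e n_z = n_((e + z) / 2) A^-1], each twisted step applies [halving e] and leaves
    one untwisted [A^-1] on the right. *)
Lemma lift_pow_twist i e y :
  (pw ((nt e)^-1 * At) i * nt y)%g = (nt (iter i (halving e) y) * pw At i)%g.
Proof.
elim: i => [|i IH]; first by rewrite !expg0 mul1g mulg1.
rewrite expgS -mulgA IH invgM invgK iterS /halving.
move: (iter i _ y) => z; rewrite !mulgA -[(At^-1 * _ * _)%g]mulgA -family_liftD.
have := lift_pow_unip 1 (e + z); rewrite !expg1 expr1 => ->.
by rewrite expgS !mulgA.
Qed.

Lemma gsize_ge0 g : 0 <= gsize g.
Proof. by rewrite addr_ge0 ?mxsize_ge0. Qed.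

Lemma gsizeM g h : gsize (g * h)%g <= gsize g * gsize h.
Proof.
have m0 (B : 'M[R]_N.+2) := mxsize_ge0 B.
rewrite /gsize invgM !qM/= mulrDl !mulrDr -!addrA.
apply: lerD; first exact: mxsizeM.
rewrite addrA ler_wpDl ?addr_ge0 ?mulr_ge0// mulrC; exact: mxsizeM.
Qed.

Lemma gsizeV g : gsize g^-1%g = gsize g.
Proof. by rewrite /gsize invgK addrC. Qed.

Lemma le_gsize g : mxsize (val (q g)) <= gsize g.
Proof. by rewrite /gsize lerDl mxsize_ge0. Qed.

Lemma gsize_unip_bound x x' (h : Gt) j T :
  gsize (nt x * h)%g <= T -> gsize (nt x' * h)%g <= T ->
  `|x j 0 - x' j 0| <= T * T.
Proof.
move=> gx gx'.
have e : (nt (x - x') = (nt x * h) * (nt x' * h)^-1)%g.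
  by rewrite invgM !mulgA mulgK family_liftD family_liftN.
apply: (@le_trans _ _ (mxsize (unip (x - x')))).
  by have := unip_size (x - x') j; rewrite !mxE.
have -> : unip (x - x') = val (q (nt (x - x'))) by rewrite q_family_lift.
apply: le_trans (le_gsize _) _; rewrite e; apply: le_trans (gsizeM _ _) _.
by rewrite gsizeV ler_pM ?gsize_ge0.
Qed.

Lemma gsize_opposite_bound x v x' j T :
  gsize (nt x * mt v * nt x')%g <= T -> `|v j 0| <= 1 + T.
Proof.
move=> gT; have := le_trans (le_gsize _) gT; rewrite !qM !q_family_lift/=.
move=> /(le_trans (unip_opposite_size _ _ _ j)) h.
have T0 : 0 <= T by apply: le_trans h; rewrite mulr_ge0// sqr_ge0.
rewrite -[leLHS]ger0_norm// -[leRHS]ger0_norm ?addr_ge0// -ler_sqr ?nnegrE//.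
rewrite !real_normK ?num_real//; nra.
Qed.

(** The opposite coordinate confines [v] to boundedly many values. For each of them the coordinates
    [w], spaced by [2^-i], have at most a constant times [2^(i N)] values, a constant times the
    number of all [v]. *)
Lemma card_horosphere_box (T : R) : exists K : nat, forall (i r : nat)
  (x : {ffun 'I_N -> 'I_(2 ^ r)} -> 'cV[R]_N) y0 x0,
  (forall (w w' : {ffun 'I_N -> 'I_(2 ^ r)}) j, `|x w j 0 - x w' j 0| = 2^-1 ^+ i * `|(w j)%:R - (w' j)%:R|) ->
  (#|[pred wv : {ffun 'I_N -> 'I_(2 ^ r)} * {ffun 'I_N -> 'I_(2 ^ i)} |
     (gsize (nt (x wv.1) * mt (natv R (fun j => wv.2 j) - y0) * nt x0)%g <= T)%R]| <=
   K * #|{: {ffun 'I_N -> 'I_(2 ^ i)}}|)%N.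
Proof.
pose D := (Num.truncn ((1 + T) *+ 2)).+1; pose E := (Num.truncn (T * T)).+1.
exists ((2 * E).+1 ^ N * (2 * D).+1 ^ N)%N => i r x y0 x0 xd.
have expX c e n : (c <= e)%N -> (c ^ n <= e ^ n)%N.
  by case: n => // n; rewrite leq_exp2r.
apply: (@leq_trans ((2 * (2 ^ i * E)).+1 ^ N * (2 * D).+1 ^ N)); last first.
  rewrite card_ffun !card_ord mulnAC leq_mul2r -expnMn expX ?orbT//.
  have -> : (2 * (2 ^ i * E) = 2 * E * 2 ^ i)%N by rewrite mulnCA mulnC.
  by rewrite mulSn -add1n leq_add2r expn_gt0.
apply: card_fiber_bound => [v|].
  apply: card_close_ffun => w w' /= gw gw' j.
  have := @gsize_unip_bound (x w) (x w')
    (mt (natv R (fun j => v j) - y0) * nt x0)%g j T.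
  rewrite !mulgA => /(_ gw gw'); rewrite xd exprVn mulrC ler_pdivrMr ?exprn_gt0// => le.
  have : (w j)%:R <= (w' j + 2 ^ i * E)%:R :> R.
    have TE : T * T * 2 ^+ i <= E%:R * 2 ^+ i.
      by rewrite ler_wpM2r ?exprn_ge0// ltW// truncnS_gt.
    have := le_trans (ler_norm _) (le_trans le TE).
    by rewrite natrD natrM natrX mulrC lerBlDl.
  by rewrite ler_nat.
apply: card_close_ffun => v v' /= /existsP[w gw] /existsP[w' gw'] j.
have := gsize_opposite_bound j gw; have := gsize_opposite_bound j gw'.
rewrite !mxE => /= b1 b2; have TD := truncnS_gt ((1 + T) *+ 2).
suff : (v j)%:R <= (v' j + D)%:R :> R by rewrite ler_nat.
move: b1 b2; rewrite !ler_norml natrD => /andP[b1 _] /andP[_ b2].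
move: TD; rewrite -/D mulr2n; lra.
Qed.

(** Rational coordinates suffice for all the quotients to be counted and keep the set [Z] of the
    tame sets countable. *)
Definition opposite_product (t : 'cV[rat]_N * 'cV[rat]_N * 'cV[rat]_N) : Gt :=
  (nt (map_mx ratr t.1.1) * mt (map_mx ratr t.1.2) * nt (map_mx ratr t.2))%g.

Lemma countable_opposite_products : countable (range opposite_product).
Proof. exact: (card_le_trans (card_image_le _ _) (countableP _)). Qed.

Lemma horosphere_count_family d (X : measurableType d) (H : groupType) (F : H -> R) (c : Gt -> X -> H)
    (sg : bool) (e : 'I_N -> nat) :
  (forall K : set Gt, compact K -> exists C : R, forall g (z : X), K g -> F (c g z) <= C) ->
  horosphere_count F c (range opposite_product) gsize ((nt (natv R e))^-1 * At)%g
    (fun u : 'I_N -> nat => nt ((-1) ^+ sg *: natv R u)).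
Proof.
move=> cF; have [K cK nK] := family_lift_cube qM q_cov (@gunipTD R N) (@gunipT_continuous R N).
have [C0 KC0] := cF K cK; exists C0 => T.
have [K0 card] := card_horosphere_box T; exists K0 => i.
(* The conjugation uses the untwisted [At], because [lift_pow_twist] leaves [pw At i] on the right
   to be cancelled. The conjugate is [mt] at a point of the unit cube. *)
exists {ffun 'I_N -> 'I_(2 ^ i)},
  (fun u : {ffun 'I_N -> 'I_(2 ^ i)} => At ^+ i * mt (natv R (fun j => u j)) * pw At i)%g; split.
- by rewrite card_ffun !card_ord !expn_gt0.
- move=> v x; apply: KC0; rewrite lift_pow_unipT; apply: nK => j; rewrite !mxE.
  rewrite exprVn mulrC divr_ge0 ?ler0n ?exprn_ge0//= ler_pdivrMr ?exprn_gt0// mul1r.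
  by rewrite -natrX ler_nat ltnW.
move=> r s g.
(* The formula is kept over any field: the instance over [rat] exhibits the quotients as
   [opposite_product]s. *)
pose xx (K : numFieldType) (w : {ffun 'I_N -> 'I_(2 ^ r)}) := iter i (halving (natv K e)) ((-1) ^+ sg *: natv K (vadd (fun j : 'I_N => w j) s)).
have gE (wv : {ffun 'I_N -> 'I_(2 ^ r)} * {ffun 'I_N -> 'I_(2 ^ i)}) :
    g wv = (nt (xx R wv.1) * mt (natv R (fun j => wv.2 j)) * pw At i)%g.
  rewrite /g lift_pow_twist -!mulgA; congr (_ * _)%g; rewrite !mulgA.
  have -> : (pw At i * At ^+ i = 1)%g by rewrite expVgn mulVg.
  by rewrite mul1g.
move=> wv0.
have E wv : (g wv * (g wv0)^-1 = nt (xx R wv.1) * mt (natv R (fun j => wv.2 j) -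
    natv R (fun j => wv0.2 j)) * nt (- xx R wv0.1))%g.
  rewrite !gE !invgM !family_liftD !family_liftN !mulgA; congr (_ * _ * _)%g.
  by rewrite mulgK.
have xxE (w : {ffun 'I_N -> 'I_(2 ^ r)}) : map_mx ratr (xx rat w) = xx R w.
  rewrite /xx map_iter_halving map_mxZ !map_natv; congr (iter i _ (_ *: _)).
  by rewrite rmorph_sign.
split=> [wv|].
  exists (xx rat wv.1, natv rat (fun j => wv.2 j) - natv rat (fun j => wv0.2 j), - xx rat wv0.1) => //.
  by rewrite E /opposite_product /= map_mxB map_mxN !map_natv !xxE.
apply: leq_trans (card i r (xx R) (natv R (fun j => wv0.2 j)) (- xx R wv0.1) _).
  by apply: subset_leq_card; apply/fintype.subsetP => wv; rewrite !unfold_in /= E.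
move=> w w' j; rewrite iter_halving_dist; congr (_ * _).
have h (u : 'I_N -> nat) : ((-1) ^+ sg *: natv R (vadd u s)) j 0 =
    (-1) ^+ sg * ((u j)%:R + (s j)%:R).
  by rewrite !mxE natrD.
rewrite !h -mulrBr normrM normr_sign mul1r.
by rewrite opprD addrACA subrr addr0.
Qed.

End HorosphereCount.

(** * Geometry of the hyperbolic spaces *)

Lemma cauchy_schwarz_le (R : realType) (m : nat) (f g : 'I_m -> R) (A B : R) :
  0 < A -> 0 < B -> \sum_i f i ^+ 2 <= A ^+ 2 -> \sum_i g i ^+ 2 <= B ^+ 2 ->
  \sum_i f i * g i <= A * B.
Proof.
move=> A0 B0 fA gB.
have le i : f i * g i <= 2^-1 * (B / A * f i ^+ 2 + A / B * g i ^+ 2).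
  have : 0 <= (B * f i - A * g i) ^+ 2 / (A * B) by rewrite divr_ge0 ?sqr_ge0 ?mulr_ge0// ltW.
  rewrite (_ : _ / _ = B / A * f i ^+ 2 + A / B * g i ^+ 2 - 2 * (f i * g i)).
    by move: (B / A * _ + _) (f i * g i) => x y; lra.
  by field; rewrite !gt_eqF.
apply: le_trans (ler_sum _ (fun i _ => le i)) _.
rewrite -mulr_sumr big_split/= -!mulr_sumr.
have h1 : B / A * \sum_i f i ^+ 2 <= B / A * A ^+ 2 by rewrite ler_wpM2l ?divr_ge0// ltW.
have h2 : A / B * \sum_i g i ^+ 2 <= A / B * B ^+ 2 by rewrite ler_wpM2l ?divr_ge0// ltW.
have e1 : B / A * A ^+ 2 = A * B by field; rewrite gt_eqF.
have e2 : A / B * B ^+ 2 = A * B by field; rewrite gt_eqF.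
lra.
Qed.

Section ConjugateTranspose.
Context (C : numClosedFieldType).

Definition ctr n p (A : 'M[C]_(n, p)) : 'M[C]_(p, n) := map_mx Num.conj A^T.

Lemma ctrM n p q (A : 'M[C]_(n, p)) (B : 'M[C]_(p, q)) : ctr (A *m B) = ctr B *m ctr A.
Proof. by rewrite /ctr trmx_mul map_mxM. Qed.

Lemma ctrK n p (A : 'M[C]_(n, p)) : ctr (ctr A) = A.
Proof. by apply/matrixP => i j; rewrite !mxE conjCK. Qed.

(** Polarization: the values at [x + y] and at [x + 'i y] kill the sum and the difference of [B x y]
    and [B y x]. *)
Lemma sesquilinear_eq0 n (M : 'M[C]_n) :
  (forall x : 'cV[C]_n, (ctr x *m M *m x) 0 0 = 0) -> M = 0.
Proof.
pose B (x y : 'cV[C]_n) := (ctr x *m M *m y) 0 0 => B0.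
have E x y c : B (x + c *: y) (x + c *: y) =
    B x x + c * B x y + c^* * B y x + c^* * c * B y y.
  have -> : B (x + c *: y) (x + c *: y) =
      (ctr x *m M *m x + c *: (ctr x *m M *m y) + c^* *: (ctr y *m M *m x) +
      (c^* * c) *: (ctr y *m M *m y)) 0 0.
    rewrite /B; congr fun_of_matrix.
    have -> : ctr (x + c *: y) = ctr x + c^* *: ctr y.
      by apply/matrixP => i j; rewrite !mxE rmorphD rmorphM.
    by rewrite !mulmxDl !mulmxDr -!(scalemxAl, scalemxAr) scalerA !addrA mulrC.
  have S (a b d e : 'M[C]_1) : (a + b + d + e) 0 0 = a 0 0 + b 0 0 + d 0 0 + e 0 0.
    by rewrite !mxE.
  have Z (a : C) (b : 'M[C]_1) : (a *: b) 0 0 = a * b 0 0 by rewrite mxE.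
  by rewrite S !Z.
have b0 x y : B x y = 0.
  have := E x y 1; have := E x y 'i; have i0 : 'i != 0 :> C by rewrite neq0Ci.
  move: (B0 x) (B0 y) (B0 (x + 1 *: y)) (B0 (x + 'i *: y)); rewrite -/(B _ _).
  rewrite -/(B y y) -!/(B (_ + _) _) => -> -> -> ->.
  rewrite conjCi conjC1 !mulr0 !addr0 !add0r !mul1r.
  move: (B x y) (B y x) => u v /esym/eqP + /esym/eqP.
  rewrite mulNr -mulrBr mulf_eq0 (negbTE i0)/= subr_eq0 => /eqP uv.
  by rewrite -uv -mulr2n mulrn_eq0 => /eqP.
apply/matrixP => i j; rewrite [RHS]mxE -(b0 (delta_mx i 0) (delta_mx j 0)) /B.
have -> : ctr (delta_mx i 0) = delta_mx 0 i :> 'rV[C]_n.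
  by apply/matrixP => a b; rewrite !mxE andbC; case: andP; rewrite ?rmorph1 ?rmorph0.
by rewrite -rowE -colE !mxE.
Qed.

End ConjugateTranspose.

Section PseudoUnitaryMatrices.
Context (R : realType) (m : nat).
Local Notation C := R[i].
Implicit Types (g l : 'M[C]_m.+1) (z : C).
Local Notation wd := (widen_ord (leqnSn m)).

Definition cabs z : R := complex.Re `|z|.

Lemma cabsE z : (cabs z)%:C%C = `|z|.
Proof. by rewrite /cabs RRe_real// normr_real. Qed.

Lemma cabs_ge0 z : 0 <= cabs z.
Proof. by rewrite -lecR cabsE normr_ge0. Qed.

Lemma cabsM z z' : cabs (z * z') = cabs z * cabs z'.
Proof. by apply: complexI; rewrite rmorphM/= !cabsE normrM. Qed.

Lemma cabs_conj z : cabs z^* = cabs z.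
Proof. by apply: complexI; rewrite !cabsE norm_conjC. Qed.

Lemma cabs_eq0 z : (cabs z == 0) = (z == 0).
Proof. by rewrite -(inj_eq (@complexI R)) cabsE normr_eq0. Qed.

Lemma cabsD z z' : cabs (z + z') <= cabs z + cabs z'.
Proof. by rewrite -lecR rmorphD/= !cabsE ler_normD. Qed.

Lemma cabs_sum (I : Type) (r : seq I) (P : pred I) (f : I -> C) :
  cabs (\sum_(i <- r | P i) f i) <= \sum_(i <- r | P i) cabs (f i).
Proof.
elim/big_rec2 : _ => [|i x z _ le]; first by rewrite /cabs normr0.
by apply: le_trans (cabsD _ _) _; rewrite lerD2l.
Qed.

Definition hform_mx : 'M[C]_m.+1 := diag_mx (\row_i (if i == ord_max then -1 else 1)).
Local Notation J := hform_mx.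

Lemma hform_mx_sqr : J *m J = 1%:M.
Proof.
rewrite /hform_mx mulmx_diag -diag_const_mx; congr diag_mx.
by apply/rowP => i; rewrite !mxE; case: ifP => _; rewrite ?mulrNN mulr1.
Qed.

Lemma wd_max i : (wd i == ord_max) = false.
Proof. by apply/eqP => /(congr1 val)/= e; have := ltn_ord i; rewrite e ltnn. Qed.

Lemma sesquilinear_sum n p (x : 'M[C]_(n, m.+1)) (y : 'M[C]_(m.+1, p)) i j :
  (x *m J *m y) i j = \sum_(k < m) x i (wd k) * y (wd k) j - x i ord_max * y ord_max j.
Proof.
rewrite mxE big_ord_recr/=; congr (_ + _).
  by apply: eq_bigr => k _; rewrite /hform_mx mul_mx_diag !mxE wd_max mulr1.
by rewrite /hform_mx mul_mx_diag !mxE eqxx mulrN1 mulNr.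
Qed.

Lemma hform_ctr (x : 'cV[C]_m.+1) : hform x = (ctr x *m J *m x) 0 0.
Proof.
rewrite sesquilinear_sum !mxE; congr (_ - _); last by rewrite normCKC.
by apply: eq_bigr => k _; rewrite !mxE normCKC.
Qed.

Lemma pseudo_unitaryE g : pseudo_unitary g -> ctr g *m J *m g = J.
Proof.
move=> [_ gh]; apply/eqP; rewrite -subr_eq0; apply/eqP; apply: sesquilinear_eq0 => x.
have := gh x; rewrite !hform_ctr ctrM => /eqP; rewrite -subr_eq0 => /eqP <-.
have S (a b : 'M[C]_1) : (a - b) 0 0 = a 0 0 - b 0 0 by rewrite !mxE.
by rewrite -S mulmxBr mulmxBl !mulmxA.
Qed.

Lemma pseudo_unitary_intro g : \det g = 1 -> ctr g *m J *m g = J -> pseudo_unitary g.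
Proof.
move=> dg gJ; split=> // x.
by rewrite !hform_ctr ctrM -[in RHS]gJ !mulmxA.
Qed.

Lemma pseudo_unitaryVE g : pseudo_unitary g -> invmx g = J *m ctr g *m J.
Proof.
move=> gP; have ug : g \in unitmx by rewrite unitmxE gP.1 unitr1.
have e : (J *m ctr g *m J) *m g = 1%:M.
  by rewrite -!mulmxA (mulmxA (ctr g)) pseudo_unitaryE// hform_mx_sqr.
by rewrite -[RHS]mulmx1 -(mulmxV ug) mulmxA e mul1mx.
Qed.

Lemma pseudo_unitary_ctr g : pseudo_unitary g -> g *m J *m ctr g = J.
Proof.
move=> gP; have ug : g \in unitmx by rewrite unitmxE gP.1 unitr1.
have := mulmxV ug; rewrite pseudo_unitaryVE// => e.
by rewrite -[RHS]mul1mx -e -!mulmxA hform_mx_sqr mulmx1.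
Qed.

Definition corner g := g ord_max ord_max.

Lemma row_norm g : pseudo_unitary g ->
  \sum_(i < m) cabs (g ord_max (wd i)) ^+ 2 = cabs (corner g) ^+ 2 - 1.
Proof.
move=> gP; apply: complexI; rewrite rmorphB rmorph1 rmorphXn rmorph_sum/= cabsE.
have /matrixP/(_ ord_max ord_max) := pseudo_unitary_ctr gP.
rewrite sesquilinear_sum !mxE eqxx mulr1n -normCK => e.
have -> : `|corner g| ^+ 2 - 1 = `|corner g| ^+ 2 + (-1) by [].
rewrite -e addrC subrK; apply: eq_bigr => i _.
by rewrite rmorphXn/= cabsE !mxE -normCK.
Qed.

Lemma col_norm g : pseudo_unitary g ->
  \sum_(i < m) cabs (g (wd i) ord_max) ^+ 2 = cabs (corner g) ^+ 2 - 1.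
Proof.
move=> gP; apply: complexI; rewrite rmorphB rmorph1 rmorphXn rmorph_sum/= cabsE.
have /matrixP/(_ ord_max ord_max) := pseudo_unitaryE gP.
rewrite sesquilinear_sum !mxE eqxx mulr1n -normCKC => e.
have -> : `|corner g| ^+ 2 - 1 = `|corner g| ^+ 2 + (-1) by [].
rewrite -e addrC subrK; apply: eq_bigr => i _.
by rewrite rmorphXn/= cabsE !mxE -normCKC.
Qed.

Lemma corner_ge1 g : pseudo_unitary g -> 1 <= cabs (corner g).
Proof.
move=> gP; rewrite -(@ler_pXn2r _ 2)// ?nnegrE ?cabs_ge0// expr1n -subr_ge0.
by rewrite -row_norm// sumr_ge0// => i _; exact: sqr_ge0.
Qed.

Lemma cabs_cornerV g : pseudo_unitary g -> cabs (corner (invmx g)) = cabs (corner g).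
Proof.
move=> gP; rewrite pseudo_unitaryVE// /corner /hform_mx mul_mx_diag mul_diag_mx !mxE eqxx.
by rewrite mulN1r mulrN1 opprK cabs_conj.
Qed.

Lemma cabs_row_mul g (x : 'cV[C]_m.+1) (b : R) : pseudo_unitary g -> 0 < b ->
  \sum_(i < m) cabs (x (wd i) 0) ^+ 2 <= b ^+ 2 ->
  cabs (\sum_(i < m) g ord_max (wd i) * x (wd i) 0) <= cabs (corner g) * b.
Proof.
move=> gP b0 xb; apply: le_trans (cabs_sum _ _ _) _.
under eq_bigr do rewrite cabsM.
apply: cauchy_schwarz_le => //; first by apply: lt_le_trans (corner_ge1 gP).
by rewrite row_norm// gerBl.
Qed.

Lemma cabs_cornerM g l : pseudo_unitary g -> pseudo_unitary l ->
  cabs (corner (g *m l)) <= 2 * (cabs (corner g) * cabs (corner l)).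
Proof.
move=> gP lP; rewrite /corner mxE big_ord_recr/= mulr_natl mulr2n.
apply: le_trans (cabsD _ _) _; rewrite cabsM lerD2r.
have := @cabs_row_mul g (col ord_max l) (cabs (corner l)) gP (lt_le_trans ltr01 (corner_ge1 lP)).
rewrite (eq_bigr (fun i => cabs (l (wd i) ord_max) ^+ 2)); last by move=> i _; rewrite mxE.
rewrite col_norm// gerBl// => /(_ ler01).
by rewrite (eq_bigr (fun i => g ord_max (wd i) * l (wd i) ord_max))// => i _; rewrite mxE.
Qed.

(** The left side is the last row of [b] applied to [y = l w], where [w] is chosen so that the last
    entry of [y] vanishes. Thus the squared norm of [y] is [hform y = hform w], at most that of the
    upper part of [w], which is [corner l] times a column of [a]. *)
Lemma cabs_corner_cross b l a : pseudo_unitary b -> pseudo_unitary l -> pseudo_unitary a ->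
  cabs (corner (b *m l *m a) * corner l - corner (b *m l) * corner (l *m a)) <=
  cabs (corner b) * (cabs (corner l) * cabs (corner a)).
Proof.
move=> bP lP aP; pose e : 'cV[C]_m.+1 := delta_mx ord_max 0.
pose w := corner l *: col ord_max a - corner (l *m a) *: e.
pose y := l *m w.
have yE i : y i 0 = corner l * (l *m a) i ord_max - corner (l *m a) * l i ord_max.
  rewrite /y /w mulmxBr -!scalemxAr -!colE.
  by rewrite !mxE; congr (_ * _ - _); apply: eq_bigr => k _; rewrite mxE.
have y0 : y ord_max 0 = 0 by rewrite yE /corner mulrC subrr.
have -> : corner (b *m l *m a) * corner l - corner (b *m l) * corner (l *m a) =
    \sum_(i < m) b ord_max (wd i) * y (wd i) 0.
  have E (A B : 'M[C]_m.+1) i j : (A *m B) i j = \sum_k A i k * B k j by rewrite mxE.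
  rewrite /corner -mulmxA (E b (l *m a)) (E b l) !mulr_suml -sumrB big_ord_recr/=.
  rewrite [X in _ + X = _](_ : _ = 0) ?addr0; last by ring.
  by apply: eq_bigr => i _; rewrite yE /corner; ring.
apply: cabs_row_mul => //.
  by rewrite mulr_gt0// (lt_le_trans ltr01)// corner_ge1.
have hy : hform y = hform w by rewrite /y lP.2.
have yR : \sum_(i < m) cabs (y (wd i) 0) ^+ 2 + cabs (w ord_max 0) ^+ 2 =
    \sum_(i < m) cabs (w (wd i) 0) ^+ 2.
  apply: complexI; rewrite rmorphD !rmorph_sum rmorphXn/= cabsE.
  have sq (x : 'cV[C]_m.+1) : \sum_(i < m) (cabs (x (wd i) 0) ^+ 2)%:C%C =
      \sum_(i < m) `|x (wd i) 0| ^+ 2.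
    by apply: eq_bigr => i _; rewrite rmorphXn/= cabsE.
  rewrite !sq; move: hy; rewrite /hform y0 normr0 expr0n/= subr0 => ->.
  by rewrite subrK.
have wE i : cabs (w (wd i) 0) ^+ 2 = cabs (corner l) ^+ 2 * cabs (a (wd i) ord_max) ^+ 2.
  by rewrite /w !mxE wd_max mulr0 subr0 cabsM exprMn.
apply: (@le_trans _ _ (\sum_(i < m) cabs (w (wd i) 0) ^+ 2)).
  by rewrite -yR lerDl sqr_ge0.
rewrite (eq_bigr _ (fun i _ => wE i)) -mulr_sumr col_norm// exprMn ler_wpM2l ?sqr_ge0//.
by rewrite gerBl.
Qed.

End PseudoUnitaryMatrices.

Lemma hform_real_complex (R : realType) m (x : 'cV[R[i]]_m.+1) :
  hform x = (hform (map_mx (@complex.Re R) x) + hform (map_mx (@complex.Im R) x))%:C%C.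
Proof.
have sq (z : R[i]) : `|z| ^+ 2 = (`|complex.Re z| ^+ 2 + `|complex.Im z| ^+ 2)%:C%C.
  by rewrite -add_Re2_Im2 !real_normK ?num_real.
rewrite /hform !mxE sq (eq_bigr _ (fun i _ => sq _)) -rmorph_sum -rmorphB/=; congr (_%:C)%C.
rewrite big_split/= opprD addrACA; congr (_ - _ + (_ - _)); apply: eq_bigr => i _;
  by rewrite !mxE.
Qed.

(** It lets the real group be treated inside complex matrices, so both cases share one estimate of
    the corner. *)
Lemma pseudo_unitary_real (R : realType) m (g : 'M[R]_m.+1) :
  pseudo_unitary (map_mx (real_complex R) g) <-> pseudo_unitary g.
Proof.
have Re_mul (x : 'cV[R[i]]_m.+1) : map_mx (@complex.Re R) (map_mx (real_complex R) g *m x) =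
    g *m map_mx (@complex.Re R) x.
  apply/matrixP => i j; rewrite !mxE raddf_sum; apply: eq_bigr => k _; rewrite !mxE.
  by case: (x k j) => u v; rewrite /= mul0r subr0.
have Im_mul (x : 'cV[R[i]]_m.+1) : map_mx (@complex.Im R) (map_mx (real_complex R) g *m x) =
    g *m map_mx (@complex.Im R) x.
  apply/matrixP => i j; rewrite !mxE raddf_sum; apply: eq_bigr => k _; rewrite !mxE.
  by case: (x k j) => u v; rewrite /= mul0r addr0.
split=> -[dg hg]; split.
- by apply: complexI; rewrite -det_map_mx dg rmorph1.
- move=> x; have := hg (map_mx (real_complex R) x).
  rewrite !hform_real_complex Re_mul Im_mul.
  have -> : map_mx (@complex.Re R) (map_mx (real_complex R) x) = x.
    by apply/matrixP => i j; rewrite !mxE.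
  have -> : map_mx (@complex.Im R) (map_mx (real_complex R) x) = 0.
    by apply/matrixP => i j; rewrite !mxE.
  by rewrite mulmx0 => /complexI; apply: addIr.
- by rewrite det_map_mx dg rmorph1.
- by move=> x; rewrite !hform_real_complex Re_mul Im_mul !hg.
Qed.

Section CornerLength.
Context (R : realType) (k : hyp_kind) (m : nat).
Local Notation H := (hypGroup R k m).
Implicit Types (a b l : H).

Lemma hypMx_pseudo_unitary l : pseudo_unitary (hypMx l).
Proof.
case: k l => l; last exact: mxgroupP l.
apply/pseudo_unitary_real; exact: connected_component_sub (mxgroupP l).
Qed.

Lemma hypMxM a b : hypMx (a * b)%g = hypMx a *m hypMx b.
Proof. by case: k a b => a b //=; rewrite -map_mxM. Qed.

Lemma hypMx1 : hypMx (1%g : H) = 1%:M.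
Proof. by case: k => //=; rewrite map_mx1. Qed.

Lemma hypMxV l : hypMx l^-1%g = invmx (hypMx l).
Proof.
have u : hypMx l \in unitmx by rewrite unitmxE (hypMx_pseudo_unitary l).1 unitr1.
by apply: (can_inj (mulKmx u)); rewrite -hypMxM mulgV hypMx1 mulmxV.
Qed.

(* If [d] is the distance from [l o] to [o], then [corner_size l] is [cosh d]. *)
Definition corner_size l : R := cabs (corner (hypMx l)).

Definition corner_length l : R := ln (corner_size l).
Local Notation F := corner_length.

Lemma corner_size_ge1 l : 1 <= corner_size l.
Proof. exact/corner_ge1/hypMx_pseudo_unitary. Qed.

Lemma corner_size_gt0 l : 0 < corner_size l.
Proof. exact: lt_le_trans (corner_size_ge1 l). Qed.

Lemma corner_length_ge0 l : 0 <= F l.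
Proof. exact/ln_ge0/corner_size_ge1. Qed.

Lemma corner_lengthV l : F l^-1%g = F l.
Proof. by rewrite /F /corner_size hypMxV cabs_cornerV//; exact: hypMx_pseudo_unitary. Qed.

Lemma corner_lengthM a b : F (a * b)%g <= F a + F b + ln 2.
Proof.
have := corner_size_gt0; rewrite /F => s0.
rewrite addrC -!lnM ?posrE ?mulr_gt0// ler_ln ?posrE ?mulr_gt0//.
by rewrite /corner_size hypMxM; apply: cabs_cornerM; exact: hypMx_pseudo_unitary.
Qed.

Lemma expR_corner_length l : expR (F l) = corner_size l.
Proof. by rewrite lnK// posrE corner_size_gt0. Qed.

(** [cabs_corner_cross] bounds the difference of the two corner products by a constant times
    [expR (F l)], while the products themselves are at least a constant times [expR (2 * F l)];
    their ratio is therefore within a constant times [expR (- F l)] of 1. *)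
Lemma corner_length_cross (C : R) : exists2 D : R, 0 <= D & forall a b l,
  F a <= C -> F b <= C ->
  `|F (b * l * a)%g - F (b * l)%g - F (l * a)%g + F l| <= D * expR (- F l).
Proof.
exists (expR (4 * C + 2 * ln 2)) => [|a b l Fa Fb]; first exact: expR_ge0.
pose u := corner (hypMx (b * l * a)%g); pose v := corner (hypMx l).
pose u' := corner (hypMx (b * l)%g); pose v' := corner (hypMx (l * a)%g).
have cross : cabs (u * v - u' * v') <= expR (2 * C + F l).
  rewrite /u /u' /v' /v !hypMxM.
  apply: le_trans (cabs_corner_cross (hypMx_pseudo_unitary b) (hypMx_pseudo_unitary l)
    (hypMx_pseudo_unitary a)) _.
  rewrite -!/(corner_size _) -!expR_corner_length -!expRD ler_expR; lra.
(* [ln x <= x - 1], applied both to the cross ratio and to its inverse. *)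
have side (z z' : R[i]) : 0 < cabs z -> 0 < cabs z' -> cabs (z - z') <= expR (2 * C + F l) ->
    2 * F l - 2 * C - 2 * ln 2 <= ln (cabs z') ->
    ln (cabs z) - ln (cabs z') <= expR (4 * C + 2 * ln 2) * expR (- F l).
  move=> z0 z0' zz' big; set x := ln (cabs z') in big *; set y := ln (cabs z).
  have ex : expR x = cabs z' by rewrite lnK.
  have ey : expR y = cabs z by rewrite lnK.
  rewrite -expRD -(lerD2l 1); apply: le_trans (expR_ge1Dx _) _.
  rewrite [X in X <= _]expRD expRN ex ey.
  rewrite ler_pdivrMr// mulrDl mul1r.
  have -> : cabs z = cabs (z' + (z - z')) by rewrite addrC subrK.
  apply: le_trans (cabsD _ _) _; rewrite lerD2l; apply: le_trans zz' _.
  rewrite -ex -expRD ler_expR; lra.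
have Fl1 : F l <= F (b * l)%g + F b + ln 2.
  rewrite -{1}(mulKg b l); apply: le_trans (corner_lengthM _ _) _.
  by rewrite corner_lengthV; lra.
have Fl2 : F l <= F (l * a)%g + F a + ln 2.
  rewrite -{1}(mulgK a l); apply: le_trans (corner_lengthM _ _) _.
  by rewrite corner_lengthV; lra.
have Fl3 : F (b * l)%g <= F (b * l * a)%g + F a + ln 2.
  rewrite -{1}(mulgK a (b * l)%g); apply: le_trans (corner_lengthM _ _) _.
  by rewrite corner_lengthV; lra.
have uv0 : 0 < cabs (u * v) by rewrite cabsM mulr_gt0 ?corner_size_gt0.
have uv0' : 0 < cabs (u' * v') by rewrite cabsM mulr_gt0 ?corner_size_gt0.
have uvE : ln (cabs (u * v)) = F (b * l * a)%g + F l.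
  by rewrite cabsM lnM// posrE corner_size_gt0.
have uvE' : ln (cabs (u' * v')) = F (b * l)%g + F (l * a)%g.
  by rewrite cabsM lnM// posrE corner_size_gt0.
have crossN : cabs (u' * v' - u * v) <= expR (2 * C + F l).
  by rewrite -opprB (_ : cabs _ = cabs (u * v - u' * v'))// /cabs normrN.
have s1 := side _ _ uv0 uv0' cross; have s2 := side _ _ uv0' uv0 crossN.
rewrite uvE uvE' in s1 s2; rewrite ler_norml; apply/andP; split.
  have h : 2 * F l - 2 * C - 2 * ln 2 <= F (b * l * a)%g + F l by lra.
  move: (s2 h); lra.
have h : 2 * F l - 2 * C - 2 * ln 2 <= F (b * l)%g + F (l * a)%g by lra.
move: (s1 h); lra.
Qed.

End CornerLength.

(** * Geodesics and the distance *)

Lemma ctrD (C : numClosedFieldType) m n (A B : 'M[C]_(m, n)) : ctr (A + B) = ctr A + ctr B.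
Proof. by apply/matrixP => i j; rewrite !mxE rmorphD. Qed.

Lemma ctrZ (C : numClosedFieldType) m n (a : C) (A : 'M[C]_(m, n)) :
  ctr (a *: A) = a^* *: ctr A.
Proof. by apply/matrixP => i j; rewrite !mxE rmorphM. Qed.

Lemma ctr_delta (C : numClosedFieldType) m n (i : 'I_m) (j : 'I_n) :
  ctr (delta_mx i j) = delta_mx j i :> 'M[C]_(n, m).
Proof. by apply/matrixP => a b; rewrite !mxE andbC rmorph_nat. Qed.

Lemma ctr1 (C : numClosedFieldType) n : ctr 1%:M = 1%:M :> 'M[C]_n.
Proof. by apply/matrixP => i j; rewrite !mxE eq_sym rmorph_nat. Qed.

Section ComplexBoost.
Context (C : numClosedFieldType) (n : nat).
Variables (e u : 'cV[C]_n).
Hypotheses (ee : ctr e *m e = 1%:M) (uu : ctr u *m u = 1%:M) (eu : ctr e *m u = 0)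
  (ue : ctr u *m e = 0).

(** For [s = 1] and [s = -1] these are the orthogonal projections onto the lines of [e + u] and
    [e - u]; [2^-1] normalizes vectors of squared length 2. *)
Definition boost_proj (s : C) : 'M[C]_n := 2^-1 *: ((e + s *: u) *m ctr (e + s *: u)).

Let ctrE (s : C) : s^* = s -> ctr (e + s *: u) = ctr e + s *: ctr u.
Proof. by move=> sR; rewrite ctrD ctrZ sR. Qed.

Let vv (s t : C) : s^* = s -> ctr (e + s *: u) *m (e + t *: u) = (1 + s * t)%:M.
Proof.
move=> sR; rewrite ctrE// mulmxDl !mulmxDr -!(scalemxAl, scalemxAr) ee uu eu ue.
by rewrite !scaler0 addr0 add0r !scale_scalar_mx mulr1 -raddfD.
Qed.

Lemma boost_projM (s t : C) : s^* = s ->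
  boost_proj s *m boost_proj t = (2^-1 * (1 + s * t)) *: (2^-1 *: ((e + s *: u) *m ctr (e + t *: u))).
Proof.
move=> sR; rewrite /boost_proj -!(scalemxAl, scalemxAr) mulmxA -(mulmxA (e + s *: u)) vv//.
rewrite mul_mx_scalar -scalemxAl !scalerA; congr (_ *: _); ring.
Qed.

Lemma boost_proj_idem (s : C) : s^* = s -> s * s = 1 ->
  boost_proj s *m boost_proj s = boost_proj s.
Proof. by move=> sR ss; rewrite boost_projM// ss mulVf ?scale1r// pnatr_eq0. Qed.

Lemma boost_proj_orth (s t : C) : s^* = s -> s * t = -1 ->
  boost_proj s *m boost_proj t = 0.
Proof. by move=> sR st; rewrite boost_projM// st subrr mulr0 scale0r. Qed.

Lemma ctr_boost_proj (s : C) : ctr (boost_proj s) = boost_proj s.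
Proof.
by rewrite /boost_proj ctrZ ctrM ctrK fmorphV rmorph_nat.
Qed.

End ComplexBoost.

Section ExpProjections.
Context (R : realType) (C : fieldType) (toC : {rmorphism R -> C}) (n : nat).
Variables (P Q : 'M[C]_n).
Hypotheses (PP : P *m P = P) (QQ : Q *m Q = Q) (PQ : P *m Q = 0) (QP : Q *m P = 0).

(* The exponential of [t *: (P - Q)]. *)
Definition exp_proj (t : R) : 'M[C]_n :=
  1%:M + toC (expR t - 1) *: P + toC (expR (- t) - 1) *: Q.

Lemma exp_proj0 : exp_proj 0 = 1%:M.
Proof. by rewrite /exp_proj oppr0 expR0 subrr rmorph0 !scale0r !addr0. Qed.

Let addB1 (a : R) (A : 'M[C]_n) : A + toC (a - 1) *: A = toC a *: A.
Proof. by rewrite rmorphB rmorph1 scalerBl scale1r addrC subrK. Qed.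

Lemma mulP_exp_proj t : P *m exp_proj t = toC (expR t) *: P.
Proof. by rewrite /exp_proj !mulmxDr mulmx1 -!scalemxAr PP PQ scaler0 addr0 addB1. Qed.

Lemma mulQ_exp_proj t : Q *m exp_proj t = toC (expR (- t)) *: Q.
Proof. by rewrite /exp_proj !mulmxDr mulmx1 -!scalemxAr QQ QP scaler0 addr0 addB1. Qed.

Lemma exp_proj_entry t i j : exp_proj t i j = (1%:M i j - P i j - Q i j) +
  toC (expR t) * P i j + toC (expR (- t)) * Q i j.
Proof. by rewrite /exp_proj !rmorphB rmorph1 !mxE; ring. Qed.

Lemma exp_projD s t : exp_proj (s + t) = exp_proj s *m exp_proj t.
Proof.
rewrite [exp_proj s in RHS]/exp_proj !mulmxDl mul1mx -!scalemxAl mulP_exp_proj mulQ_exp_proj.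
rewrite !scalerA /exp_proj opprD !expRD !rmorphB !rmorphM rmorph1.
move: (toC (expR s)) (toC (expR t)) (toC (expR (- s))) (toC (expR (- t))) => a b a' b'.
by apply/matrixP => i j; rewrite !mxE; ring.
Qed.

Lemma exp_proj_unit t : exp_proj t \in unitmx.
Proof.
have := esym (exp_projD t (- t)).
by rewrite subrr exp_proj0 => /mulmx1_unit[].
Qed.

Lemma exp_proj_diff t :
  exp_proj t *m (P - Q) = toC (expR t) *: P - toC (expR (- t)) *: Q.
Proof.
rewrite /exp_proj !mulmxDl !mulmxBr !mul1mx -!scalemxAl PP QP PQ QQ !scaler0 subr0 sub0r.
rewrite !rmorphB rmorph1; by apply/matrixP => i j; rewrite !mxE; ring.
Qed.

Lemma involution_swap (J : 'M[C]_n) : J *m J = 1%:M -> J *m P = Q *m J ->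
  J *m Q = P *m J.
Proof.
move=> JJ JP; have <- : J *m P *m J = Q by rewrite JP -mulmxA JJ mulmx1.
by rewrite !mulmxA JJ mul1mx.
Qed.

Lemma exp_proj_swap (J : 'M[C]_n) t : J *m P = Q *m J -> J *m Q = P *m J ->
  J *m exp_proj t = exp_proj (- t) *m J.
Proof.
move=> JP JQ; rewrite /exp_proj !mulmxDr !mulmxDl mulmx1 mul1mx -!scalemxAr -!scalemxAl.
by rewrite JP JQ opprK addrAC.
Qed.

Lemma exp_proj_form (J : 'M[C]_n) t : J *m P = Q *m J -> J *m Q = P *m J ->
  exp_proj t *m J *m exp_proj t = J.
Proof.
by move=> JP JQ; rewrite -mulmxA exp_proj_swap// mulmxA -exp_projD subrr exp_proj0 mul1mx.
Qed.

End ExpProjections.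

Lemma map_exp_proj (R : realType) (C : fieldType) (toC : {rmorphism R -> C}) n
  (P Q : 'M[R]_n) t : map_mx toC (exp_proj idfun P Q t) =
  exp_proj toC (map_mx toC P) (map_mx toC Q) t.
Proof. by rewrite /exp_proj !map_mxD !map_mxZ map_mx1. Qed.

Lemma ctr_exp_proj (R : realType) (C : numClosedFieldType) (toC : {rmorphism R -> C}) n
  (P Q : 'M[C]_n) t : (forall a, (toC a)^* = toC a) -> ctr P = P -> ctr Q = Q ->
  ctr (exp_proj toC P Q t) = exp_proj toC P Q t.
Proof. by move=> cC cP cQ; rewrite /exp_proj !ctrD !ctrZ !cC cP cQ ctr1. Qed.

Lemma mx_combination_entry (K : pzRingType) m n (A B : 'M[K]_(m, n)) (x b d : K) i j :
  (x *: (b *: A - d *: B)) i j = 0 + x * b * A i j + - (x * d) * B i j.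
Proof. by rewrite !mxE add0r mulrBr mulNr !mulrA. Qed.

Section BoostCurve.
Context (R : realType) (m : nat).
Local Notation C := R[i].
Local Notation wd := (widen_ord (leqnSn m)).
Local Notation J := (hform_mx R m).
Variable u : 'cV[C]_m.+1.
Hypotheses (u0 : u ord_max 0 = 0) (uu : ctr u *m u = 1%:M).
Let e : 'cV[C]_m.+1 := delta_mx ord_max 0.

Let ctr_e : ctr e = delta_mx 0 ord_max.
Proof. by apply/matrixP => a b; rewrite !mxE andbC; case: andP; rewrite ?rmorph1 ?rmorph0. Qed.

Let ee : ctr e *m e = 1%:M.
Proof.
rewrite ctr_e mul_delta_mx; apply/matrixP => i j; rewrite !mxE !ord1 eqxx//.
Qed.

Let eu : ctr e *m u = 0.
Proof. by rewrite ctr_e -rowE; apply/matrixP => i j; rewrite !mxE ord1 u0. Qed.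

Let ue : ctr u *m e = 0.
Proof. by rewrite -[ctr u *m e]ctrK ctrM ctrK eu; apply/matrixP => i j; rewrite !mxE rmorph0. Qed.

Definition pplus : 'M[C]_m.+1 := boost_proj e u 1.
Definition pminus : 'M[C]_m.+1 := boost_proj e u (-1).
Local Notation P := pplus.
Local Notation Q := pminus.

Let conjN1 : (-1)^* = -1 :> C. Proof. by rewrite rmorphN rmorph1. Qed.

Lemma pplus_idem : P *m P = P. Proof. by apply: boost_proj_idem; rewrite ?conjC1 ?mulr1. Qed.
Lemma pminus_idem : Q *m Q = Q. Proof. by apply: boost_proj_idem; rewrite ?mulrNN ?mulr1. Qed.
Lemma pplus_pminus : P *m Q = 0. Proof. by apply: boost_proj_orth; rewrite ?conjC1 ?mul1r. Qed.
Lemma pminus_pplus : Q *m P = 0. Proof. by apply: boost_proj_orth; rewrite ?mulr1. Qed.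

Definition cboost (t : R) : 'M[C]_m.+1 := exp_proj (real_complex R) P Q t.

Lemma cboost0 : cboost 0 = 1%:M. Proof. exact: exp_proj0. Qed.

Lemma cboostD s t : cboost (s + t) = cboost s *m cboost t.
Proof. exact (exp_projD (real_complex R) pplus_idem pminus_idem pplus_pminus pminus_pplus s t). Qed.

Let Je : J *m e = - e.
Proof.
apply/matrixP => i j; rewrite /hform_mx mul_diag_mx !mxE.
by case: (i == ord_max); rewrite ?mulN1r// mul1r oppr0.
Qed.

Let Ju : J *m u = u.
Proof.
apply/matrixP => i j; rewrite /hform_mx mul_diag_mx !mxE ord1.
by case: eqP => [->|]; rewrite ?u0 ?mulr0// mul1r.
Qed.

Let ctrJ (x y : 'cV[C]_m.+1) : J *m x = y -> ctr x *m J = ctr y.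
Proof.
move=> <-; rewrite ctrM; congr (_ *m _); apply/matrixP => i j; rewrite !mxE.
rewrite [j == i]eq_sym; case: (eqVneq i j) => [->|_]; last by rewrite !mulr0n rmorph0.
by rewrite !mulr1n; case: (j == ord_max); rewrite ?conjN1 ?conjC1.
Qed.

Let Jplus : J *m (e + 1 *: u) = -1 *: (e + -1 *: u).
Proof. by rewrite mulmxDr -scalemxAr Je Ju scale1r !scaleN1r opprD opprK. Qed.

Let Jminus : J *m (e + -1 *: u) = -1 *: (e + 1 *: u).
Proof. by rewrite mulmxDr -scalemxAr Je Ju scale1r !scaleN1r opprD. Qed.

Let JP : J *m P = Q *m J.
Proof.
rewrite /P /Q /boost_proj -scalemxAr -scalemxAl; congr (_ *: _).
rewrite mulmxA Jplus -[in RHS]mulmxA (ctrJ Jminus) -scalemxAl.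
have -> : ctr (-1 *: (e + 1 *: u)) = -1 *: ctr (e + 1 *: u) by rewrite ctrZ conjN1.
by rewrite scalemxAr.
Qed.

Let JQ : J *m Q = P *m J.
Proof. exact (involution_swap (hform_mx_sqr R m) JP). Qed.

Lemma ctr_cboost t : ctr (cboost t) = cboost t.
Proof.
apply: ctr_exp_proj; try exact: ctr_boost_proj.
by move=> a; apply: conj_Creal; apply/complex_realP; exists a.
Qed.

Lemma cboost_hform t : cboost t *m J *m cboost t = J.
Proof. exact (exp_proj_form (real_complex R) pplus_idem pminus_idem pplus_pminus pminus_pplus t JP JQ). Qed.

Lemma det_cboost t : \det (cboost t) = 1.
Proof.
rewrite (splitr t) cboostD det_mulmx.
have := congr1 determinant (hform_mx_sqr R m); rewrite det_mulmx det1.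
have := congr1 determinant (cboost_hform (t / 2)); rewrite !det_mulmx.
move: (\det _) (\det J) => x y; rewrite mulrAC => h yy.
by rewrite -[LHS]mulr1 -yy mulrA h yy.
Qed.

Lemma cboost_pseudo_unitary t : pseudo_unitary (cboost t).
Proof.
apply: pseudo_unitary_intro; first exact: det_cboost.
by rewrite ctr_cboost cboost_hform.
Qed.

End BoostCurve.

Lemma Re_combination (R : realType) (x y z : R[i]) (a b : R) :
  complex.Re (x + a%:C%C * y + b%:C%C * z) =
  complex.Re x + a * complex.Re y + b * complex.Re z.
Proof. by case: x y z => [x x'] [y y'] [z z']; rewrite /= !mul0r !subr0. Qed.

Lemma Im_combination (R : realType) (x y z : R[i]) (a b : R) :
  complex.Im (x + a%:C%C * y + b%:C%C * z) =
  complex.Im x + a * complex.Im y + b * complex.Im z.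
Proof. by case: x y z => [x x'] [y y'] [z z']; rewrite /= !mul0r !addr0. Qed.

Lemma is_derive_exp_pair (R : realType) (r a b d t : R) :
  is_derive t 1 (fun t : R => a + expR (r - r * t) * b + expR (- (r - r * t)) * d)
    (- r * (expR (r - r * t) * b - expR (- (r - r * t)) * d)).
Proof. by apply: is_derive_eq; rewrite /GRing.scale/=; ring. Qed.

Lemma continuous_exp_pair (R : realType) (r a b d : R) :
  continuous (fun t : R => a + expR (r - r * t) * b + expR (- (r - r * t)) * d).
Proof.
move=> t; have [h _] := is_derive_exp_pair r a b d t.
exact/differentiable_continuous/derivable1_diffP.
Qed.

Lemma C1_exp_pair (R : realType) (r a b d : R) :
  C1_fun (fun t : R => a + expR (r - r * t) * b + expR (- (r - r * t)) * d) /\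
  forall t, derive1 (fun t : R => a + expR (r - r * t) * b + expR (- (r - r * t)) * d) t =
    - r * (expR (r - r * t) * b - expR (- (r - r * t)) * d).
Proof.
have dE t : derive1 (fun t : R => a + expR (r - r * t) * b + expR (- (r - r * t)) * d) t =
    - r * (expR (r - r * t) * b - expR (- (r - r * t)) * d).
  by have h := is_derive_exp_pair r a b d t; rewrite derive1E derive_val.
split=> //; split=> [t|]; first by have [] := is_derive_exp_pair r a b d t.
rewrite (_ : derive1 _ = fun t => 0 + expR (r - r * t) * (- r * b) +
    expR (- (r - r * t)) * (r * d)); first exact: continuous_exp_pair.
by apply/funext => t; rewrite dE; ring.
Qed.

Section CurveLength.
Context (R : realType) (k : hyp_kind) (m : nat).
Local Notation C := R[i].
Local Notation wd := (widen_ord (leqnSn m)).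
Local Notation H := (hypGroup R k m).
Variables (P Q : 'M[C]_m.+1) (u : 'cV[C]_m.+1).
Hypotheses (PP : P *m P = P) (QQ : Q *m Q = Q) (PQ : P *m Q = 0) (QP : Q *m P = 0).
Hypothesis P_col : forall i, P (wd i) ord_max = 2^-1 * u (wd i) 0.
Hypothesis Q_col : forall i, Q (wd i) ord_max = - (2^-1 * u (wd i) 0).
Hypotheses (u0 : u ord_max 0 = 0) (uu : ctr u *m u = 1%:M).
Local Notation cboost := (exp_proj (real_complex R) P Q).
Variables (r : R) (c : R -> H).
Hypothesis r_ge0 : 0 <= r.
Hypothesis cE : forall t, hypMx (c t) = cboost (r - r * t).

Lemma sum_sqr_unit : \sum_(i < m) (complex.Re (u (wd i) 0) ^+ 2 + complex.Im (u (wd i) 0) ^+ 2) = 1.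
Proof.
apply: complexI; have /matrixP/(_ 0 0) := uu; rewrite !mxE eqxx mulr1n rmorph1 => <-.
rewrite big_ord_recr/= u0 mulr0 addr0 rmorph_sum; apply: eq_bigr => i _.
by transitivity (`|u (wd i) 0| ^+ 2); [exact: add_Re2_Im2|rewrite !mxE normCKC].
Qed.

Let entryE t i j : cboost t i j = (1%:M i j - P i j - Q i j) +
  (expR t)%:C%C * P i j + (expR (- t))%:C%C * Q i j.
Proof. exact: exp_proj_entry. Qed.

Lemma exp_proj_corner (t : R) : P ord_max ord_max = 2^-1 -> Q ord_max ord_max = 2^-1 ->
  cboost t ord_max ord_max = ((expR t + expR (- t)) / 2)%:C%C.
Proof.
move=> p q; rewrite entryE p q [1%:M _ _]mxE eqxx mulr1n.
rewrite [X in X - _ - _ + _](splitr 1) mul1r addrK subrr add0r.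
by rewrite rmorphM rmorphD fmorphV rmorph_nat mulrDl.
Qed.

Lemma exp_proj_col i (t : R) :
  cboost t (wd i) ord_max = ((expR t - expR (- t)) / 2)%:C%C * u (wd i) 0.
Proof.
rewrite entryE P_col Q_col [1%:M _ _]mxE wd_max mulr0n.
rewrite rmorphM rmorphB fmorphV rmorph_nat; ring.
Qed.

Let ReE i j : (fun s => complex.Re (hypMx (c s) i j)) = fun t =>
  complex.Re (1%:M i j - P i j - Q i j) + expR (r - r * t) * complex.Re (P i j) +
  expR (- (r - r * t)) * complex.Re (Q i j).
Proof. by apply/funext => t; rewrite cE entryE Re_combination. Qed.

Let ImE i j : (fun s => complex.Im (hypMx (c s) i j)) = fun t =>
  complex.Im (1%:M i j - P i j - Q i j) + expR (r - r * t) * complex.Im (P i j) +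
  expR (- (r - r * t)) * complex.Im (Q i j).
Proof. by apply/funext => t; rewrite cE entryE Im_combination. Qed.

Lemma boost_curve_C1 : C1_curve c.
Proof. by move=> i j; rewrite ReE ImE; split; exact: (C1_exp_pair _ _ _ _).1. Qed.

Lemma boost_curve_deriv t :
  curve_deriv c t = cboost (r - r * t) *m ((- r)%:C%C *: (P - Q)).
Proof.
have E : cboost (r - r * t) *m (P - Q) =
    (expR (r - r * t))%:C%C *: P - (expR (- (r - r * t)))%:C%C *: Q.
  exact: exp_proj_diff.
rewrite -scalemxAr E.
apply/matrixP => i j; rewrite mxE ReE ImE !(C1_exp_pair _ _ _ _).2.
have -> (a b d : R) : ((- a)%:C%C *: (b%:C%C *: P - d%:C%C *: Q)) i j =
    0 + (- a * b)%:C%C * P i j + (a * d)%:C%C * Q i j.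
  rewrite rmorphM (_ : (a * d)%:C%C = - ((- a)%:C%C * d%:C%C)); last first.
    by rewrite -rmorphM -rmorphN mulNr opprK.
  exact: mx_combination_entry.
apply/eqP; rewrite eq_complex Re_combination Im_combination/=.
by apply/andP; split; apply/eqP; ring.
Qed.

(** The logarithmic derivative is the constant matrix [- r (P - Q)]; the upper part of its last
    column is [- r u], with [u] a unit vector. *)
Lemma boost_curve_speed t : curve_speed c t = r.
Proof.
have XE i : (invmx (hypMx (c t)) *m curve_deriv c t) (wd i) ord_max =
    (- r)%:C%C * u (wd i) 0.
  rewrite boost_curve_deriv cE mulKmx ?(exp_proj_unit _ PP QQ PQ QP)// mxE; congr (_ * _).
  rewrite mxE P_col [(- Q) _ _]mxE Q_col opprK -mulrDl.
  by rewrite -mulr2n -[_ *+ 2]mulr_natr mulVf ?mul1r// pnatr_eq0.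
have sq (z : C) : complex.Re ((- r)%:C%C * z) ^+ 2 + complex.Im ((- r)%:C%C * z) ^+ 2 =
    r ^+ 2 * (complex.Re z ^+ 2 + complex.Im z ^+ 2).
  by case: z => x y /=; ring.
rewrite /curve_speed; under eq_bigr do rewrite XE sq.
by rewrite -mulr_sumr sum_sqr_unit mulr1 sqrtr_sqr ger0_norm.
Qed.

Lemma boost_curve_length : curve_length c = r.
Proof.
rewrite /curve_length (_ : curve_speed c = fun=> r); last first.
  by apply/funext => t; exact: boost_curve_speed.
have I1 : lebesgue_measure (`[0, 1]%classic : set R) = 1%E.
  by rewrite lebesgue_measure_itv/= lte_fin ltr01 oppr0 adde0.
by rewrite Rintegral_cst// [X in fine X]I1 mulr1.
Qed.

End CurveLength.

Section BoostDistance.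
Context (R : realType) (k : hyp_kind) (m : nat).
Local Notation C := R[i].
Local Notation wd := (widen_ord (leqnSn m)).
Local Notation H := (hypGroup R k m).

(** Keeps track of the real entries that a direction must have for its boosts to lie in [SO] when
    both groups are written as complex matrices. *)
Definition real_if_real (n p : nat) (A : 'M[C]_(n, p)) : Prop :=
  k = RealHyp -> exists B : 'M[R]_(n, p), A = map_mx (real_complex R) B.

Variable u : 'cV[C]_m.+1.
Hypotheses (u0 : u ord_max 0 = 0) (uu : ctr u *m u = 1%:M) (uR : real_if_real u).
Local Notation P := (pplus u).
Local Notation Q := (pminus u).

Lemma boost_proj_real n (e v : 'cV[R]_n) (s : R) :
  boost_proj (map_mx (real_complex R) e) (map_mx (real_complex R) v) s%:C%C =
  map_mx (real_complex R) (2^-1 *: ((e + s *: v) *m (e + s *: v)^T)).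
Proof.
have cR p q (A : 'M[R]_(p, q)) : ctr (map_mx (real_complex R) A) = map_mx (real_complex R) A^T.
  apply/matrixP => i j; rewrite !mxE; apply: conj_Creal.
  by apply/complex_realP; exists (A j i).
rewrite /boost_proj -map_mxZ -map_mxD cR -map_mxM map_mxZ; congr (_ *: _).
by rewrite fmorphV rmorph_nat.
Qed.

(** The parameter [r - r * t] runs from the boost of length [r] at time 0 to the identity at time 1.
    In the real case the path to the identity also gives membership in the identity component. *)
Lemma boost_curve_exists (r : R) :
  exists c : R -> H, forall t, hypMx (c t) = cboost u (r - r * t).
Proof.
move: uR; rewrite /real_if_real; case: k => uR'; last first.
  by exists (fun t => mxgroup_mk (A := SU R m) (cboost_pseudo_unitary u0 uu (r - r * t))).
have [v uv] := uR' erefl.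
have eR : delta_mx ord_max 0 = map_mx (real_complex R) (delta_mx ord_max 0 : 'cV[R]_m.+1).
  by rewrite map_delta_mx.
pose p s : 'M[R]_m.+1 := 2^-1 *: ((delta_mx ord_max 0 + s *: v) *m (delta_mx ord_max 0 + s *: v)^T).
have PE : P = map_mx (real_complex R) (p 1).
  by rewrite /p -boost_proj_real -eR -uv.
have QE : Q = map_mx (real_complex R) (p (-1)).
  by rewrite /p -boost_proj_real -eR -uv rmorphN.
pose g t := exp_proj idfun (p 1) (p (-1)) t.
have gE t : map_mx (real_complex R) (g t) = cboost u t.
  by rewrite /g map_exp_proj -PE -QE.
have gI t : identity_component (g t).
  apply: path_identity_component.
  - apply: mx_continuous => i j; under eq_fun do rewrite exp_proj_entry/=.
    move=> s; apply: cvgD; [apply: cvgD; first exact: cvg_cst|].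
      by apply: cvgM; [exact: continuous_expR|exact: cvg_cst].
    apply: cvgM; last exact: cvg_cst.
    by apply: continuous_comp; [exact: cvgN|exact: continuous_expR].
  - exact: exp_proj0.
  - by move=> s; apply/pseudo_unitary_real; rewrite gE; exact: cboost_pseudo_unitary.
exists (fun t => mxgroup_mk (A := SO R m) (gI (r - r * t))).
by move=> t; rewrite /= gE.
Qed.

Lemma pplus_col i : P (wd i) ord_max = 2^-1 * u (wd i) 0 /\ Q (wd i) ord_max = - (2^-1 * u (wd i) 0).
Proof.
rewrite /pplus /pminus /boost_proj; split; rewrite mxE [X in _ * X]mxE big_ord1 !mxE wd_max eqxx u0;
  rewrite ?mulr0 !addr0 conjC1 ?add0r ?mul1r ?mulr1 ?mulN1r ?mulrN//.
Qed.

Lemma pplus_corner : P ord_max ord_max = 2^-1 /\ Q ord_max ord_max = 2^-1.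
Proof.
rewrite /pplus /pminus /boost_proj; split; rewrite mxE [X in _ * X]mxE big_ord1 !mxE eqxx u0;
  by rewrite ?mulr0 !addr0 conjC1 !mulr1.
Qed.

End BoostDistance.

Section Distance.
Context (R : realType) (k : hyp_kind) (m : nat).
Hypothesis m0 : (0 < m)%N.
Local Notation C := R[i].
Local Notation wd := (widen_ord (leqnSn m)).
Local Notation H := (hypGroup R k m).
Implicit Types l : H.

Lemma curve_length_ge0 (c : R -> H) : 0 <= curve_length c.
Proof. by apply: Rintegral_ge0 => t _; exact: sqrtr_ge0. Qed.

(** The distance is an infimum of lengths, so one explicit curve bounds it above. Proportional last
    columns mean that the curve starts in the coset of [l]. *)
Lemma hyp_dist_le l (r : R) (u : 'cV[C]_m.+1) (a : C) :
  u ord_max 0 = 0 -> ctr u *m u = 1%:M -> real_if_real k u -> 0 <= r ->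
  (forall i, cboost u r i ord_max = a * hypMx l i ord_max) ->
  hyp_dist l 1%g <= r /\ 0 <= hyp_dist l 1%g.
Proof.
move=> u0 uu uR r0 ul; have [c cE] := boost_curve_exists u0 uu uR r.
have Pc i := (pplus_col u0 i).1; have Qc i := (pplus_col u0 i).2.
have mem : [set curve_length c | c in [set c : R -> H |
    [/\ C1_curve c, hypK (l^-1 * c 0%R)%g & hypK (1%g^-1 * c 1%R)%g]]] r.
  exists c; last first.
    exact: (boost_curve_length (pplus_idem u0 uu) (pminus_idem u0 uu) (pplus_pminus u0 uu)
      (pminus_pplus u0 uu) Pc Qc u0 uu r0 cE).
  split; first exact: (boost_curve_C1 cE).
    move=> i; rewrite hypMxM hypMxV cE mulr0 subr0.
    have ug : hypMx l \in unitmx by rewrite unitmxE (hypMx_pseudo_unitary l).1 unitr1.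
    have E : col ord_max (cboost u r) = hypMx l *m (a *: delta_mx ord_max 0).
      by rewrite -scalemxAr -colE; apply/matrixP => j j'; rewrite mxE ul !mxE.
    have -> : (invmx (hypMx l) *m cboost u r) (wd i) ord_max =
        (invmx (hypMx l) *m col ord_max (cboost u r)) (wd i) 0.
      by rewrite colE mulmxA -colE [RHS]mxE.
    by rewrite E mulKmx// !mxE wd_max mulr0.
  move=> i; rewrite invg1 mul1g cE mulr1 subrr cboost0 mxE wd_max mulr0n//.
have lb : lbound [set curve_length c | c in [set c : R -> H |
    [/\ C1_curve c, hypK (l^-1 * c 0%R)%g & hypK (1%g^-1 * c 1%R)%g]]] 0.
  by move=> _ [c' _ <-]; exact: curve_length_ge0.
split; first by apply: ge_inf => //; exists 0.
by apply: lb_le_inf => //; exists r.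
Qed.

Lemma hypMx_real l : real_if_real k (hypMx l).
Proof. by rewrite /real_if_real; case: k l => // l _; exists (val l). Qed.

Lemma hyp_dist_corner l : 0 <= hyp_dist l 1%g <= corner_length l + ln 2.
Proof.
have lP := hypMx_pseudo_unitary l.
(* [s] and [q] are the hyperbolic cosine and sine of [r = ln (s + q)]; as [q <= s], [r] is at most
   [ln (2 * s)]. *)
pose x := corner (hypMx l); pose s := corner_size l; pose q := Num.sqrt (s ^+ 2 - 1).
have s1 : 1 <= s := corner_size_ge1 l.
have s2 : 0 <= s ^+ 2 - 1 by rewrite subr_ge0 exprn_ege1.
have qq : q ^+ 2 = s ^+ 2 - 1 by rewrite sqr_sqrtr.
have q0 : 0 <= q := sqrtr_ge0 _.
have qs : q <= s by rewrite -(@ler_pXn2r _ 2)// ?nnegrE// ?(le_trans _ s1)// qq gerBl.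
pose r := ln (s + q).
have sq1 : 1 <= s + q by rewrite (le_trans s1)// lerDl.
have er : expR r = s + q by rewrite lnK// posrE (lt_le_trans ltr01).
have er' : expR (- r) = s - q.
  rewrite expRN er; apply: (mulfI (lt0r_neq0 (lt_le_trans ltr01 sq1))).
  by rewrite mulfV ?gt_eqF ?(lt_le_trans ltr01)// mulrC -subr_sqr qq opprB addrC subrK.
have r_le : r <= corner_length l + ln 2.
  rewrite /corner_length -lnM ?posrE ?corner_size_gt0// ler_ln ?posrE ?(lt_le_trans ltr01 sq1)//.
    by rewrite mulr_natr mulr2n lerD2l.
  by rewrite mulr_gt0 ?corner_size_gt0.
have r0 : 0 <= r by exact: ln_ge0.
have x0 : x != 0 by rewrite -cabs_eq0 gt_eqF// (lt_le_trans ltr01).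
have colq : \sum_(i < m) `|hypMx l (wd i) ord_max| ^+ 2 = (q ^+ 2)%:C%C.
  rewrite qq -(col_norm lP) rmorph_sum; apply: eq_bigr => i _.
  by rewrite rmorphXn/= cabsE.
have [u [u0 uu uR ul]] : exists u : 'cV[C]_m.+1, [/\ u ord_max 0 = 0, ctr u *m u = 1%:M,
    real_if_real k u & forall i, q%:C%C * u (wd i) 0 = s%:C%C / x * hypMx l (wd i) ord_max].
  (* If [q = 0], then [l] fixes the base point and any unit direction serves. Otherwise [u] is the
     normalized column of [l], with the phase [s / x] making its last entry positive. *)
  have [q00|qn0] := eqVneq q 0.
    exists (delta_mx (wd (Ordinal m0)) 0); split.
    - by rewrite mxE eq_sym wd_max.
    - by rewrite ctr_delta mul_delta_mx; apply/matrixP => i j; rewrite !ord1 !mxE eqxx.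
    - by move=> _; exists (delta_mx (wd (Ordinal m0)) 0); rewrite map_delta_mx.
    - move=> i; rewrite q00 rmorph0 mul0r; move: colq; rewrite q00 expr0n/= rmorph0 => /psumr_eq0P.
      move=> /(_ (fun i _ => exprn_ge0 _ (normr_ge0 _)) i isT) /eqP.
      by rewrite expf_eq0/= normr_eq0 => /eqP ->; rewrite mulr0.
  exists (\col_i (if i == ord_max then 0 else s%:C%C / (q%:C%C * x) * hypMx l i ord_max)); split.
  - by rewrite mxE eqxx.
  - apply/matrixP => i j; rewrite !ord1 [RHS]mxE eqxx mulr1n mxE big_ord_recr/=.
    have nx : `|s%:C%C / (q%:C%C * x)| = q%:C%C^-1.
      have sE : `|x| = s%:C%C by rewrite -cabsE.
      have sn : `|s%:C%C| = s%:C%C :> C by rewrite ger0_norm// ler0c (le_trans ler01).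
      have qn : `|q%:C%C| = q%:C%C :> C by rewrite ger0_norm// ler0c.
      rewrite normrM normfV normrM sn qn sE invfM mulrCA mulfV ?mulr1//.
      by rewrite -sE normr_eq0.
    rewrite [X in _ + X](_ : _ = 0) ?addr0; last by rewrite [X in _ * X]mxE eqxx mulr0.
    rewrite (eq_bigr (fun i => (q%:C%C^-1) ^+ 2 * `|hypMx l (wd i) ord_max| ^+ 2)); last first.
      by move=> k' _; rewrite !mxE wd_max -normCKC normrM exprMn nx.
    by rewrite -mulr_sumr colq rmorphXn -exprMn mulVf ?expr1n// fmorph_eq0.
  - move=> kR; have [B lB] := hypMx_real l kR.
    exists (\col_i (if i == ord_max then 0 else s / (q * B ord_max ord_max) * B i ord_max)).
    apply/matrixP => i j; rewrite !mxE; case: ifP => _; first by rewrite rmorph0.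
    by rewrite /x /corner lB !mxE !rmorphM fmorphV rmorphM.
  - move=> i; rewrite mxE wd_max mulrA; congr (_ * _).
    by rewrite invfM mulrCA [X in _ * X]mulrA mulfV ?mul1r// fmorph_eq0.
have hl i : cboost u r i ord_max = s%:C%C / x * hypMx l i ord_max.
  have [j ->|->] := unliftP ord_max i.
    have -> : lift ord_max j = wd j by apply: val_inj; rewrite /= /bump leqNgt ltn_ord.
    rewrite (exp_proj_col (fun i => (pplus_col u0 i).1) (fun i => (pplus_col u0 i).2)).
    rewrite -ul er er'; congr (_%:C%C * _); lra.
  have [p p'] := pplus_corner u0; rewrite [LHS](exp_proj_corner r p p') er er'.
  rewrite -/(corner _) -/x divfK//; congr (_%:C%C); lra.
by have [h1 h2] := hyp_dist_le u0 uu uR r0 hl; rewrite h2 (le_trans h1).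
Qed.

End Distance.

(** * From the critical exponent to a convergent sum *)

Lemma esum_finite_bound (R : realType) (T : choiceType) (L : set T) (f : T -> R) :
  (forall x, 0 <= f x) -> (\esum_(x in L) (f x)%:E < +oo)%E ->
  exists S, forall s : seq T, uniq s -> (forall x, x \in s -> L x) ->
    \sum_(x <- s) f x <= S.
Proof.
move=> f0 fin; exists (fine (\esum_(x in L) (f x)%:E)) => s us sL.
rewrite -lee_fin fineK; last first.
  by rewrite ge0_fin_numE//; apply: esum_ge0 => x _; rewrite lee_fin.
rewrite -sumEFin; apply: esum_ge; exists [set` s].
  by split; [exact: finite_seq|move=> x /= /sL].
by rewrite -fsbig_seq.
Qed.

(** As the distance is at most [corner_length + ln 2], passing to [corner_length] costs the factor
    [expR (p * ln 2)]; as it is nonnegative, the exponent may be raised above both 1 and [e]. *)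
Lemma critical_exponent_summable (R : realType) (k : hyp_kind) (m : nat)
    (L : set (hypGroup R k m)) (b : R) :
  (0 < m)%N -> 1 < b -> (critical_exponent L < b%:E)%E ->
  exists p S : R, [/\ 1 < p, p < b & forall s : seq (hypGroup R k m), uniq s ->
    (forall l, l \in s -> L l) -> \sum_(l <- s) expR (- (p * corner_length l)) <= S].
Proof.
move=> m0 b1 /ereal_inf_lt[_ [e [e0 fin] <-]]; rewrite lte_fin => eb.
have [S HS] := esum_finite_bound (fun l => expR_ge0 (- (e * hyp_dist l 1%g))) fin.
pose p := (Num.max 1 e + b) / 2.
have M1 : 1 <= Num.max 1 e by rewrite le_max lexx.
have Me : e <= Num.max 1 e by rewrite le_max lexx orbT.
have Mb : Num.max 1 e < b by rewrite gt_max b1 eb.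
have p1 : 1 < p by rewrite /p; lra.
have ep : e <= p by rewrite /p; lra.
exists p, (expR (p * ln 2) * S); split=> [//||s us sL]; first by rewrite /p; lra.
apply: le_trans (_ : expR (p * ln 2) * \sum_(l <- s) expR (- (e * hyp_dist l 1%g)) <= _); last first.
  by rewrite ler_wpM2l ?expR_ge0// HS.
rewrite mulr_sumr; apply: ler_sum => l _; rewrite -expRD ler_expR.
have /andP[d0 dF] := hyp_dist_corner m0 l.
have h1 : e * hyp_dist l 1%g <= p * hyp_dist l 1%g by rewrite ler_wpM2r.
have h2 : p * hyp_dist l 1%g <= p * (corner_length l + ln 2) by rewrite ler_wpM2l// ltW// (lt_trans ltr01).
rewrite mulrDr in h2; lra.
Qed.

(** * Bounded return sets *)

Lemma compact_increasing_cover (T : topologicalType) (K : set T) (V : nat -> set T) :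
  compact K -> (forall i, open (V i)) -> (forall i j, (i <= j)%N -> V i `<=` V j) ->
  K `<=` \bigcup_i V i -> exists i, K `<=` V i.
Proof.
move=> /compact_near_coveringP cK oV incV KV.
have near_V x : K x -> \forall x' \near x & i \near \oo, V i x'.
  move=> /KV[j _ Vj]; exists (V j, [set i | (j <= i)%N]) => /=; last first.
    by move=> [y i] /= [Vy ji]; exact: incV Vy.
  split; last exact: nbhs_infty_ge.
  by apply: open_nbhs_nbhs; split.
have [i _ Ki] := cK nat \oo (fun i x => V i x) _ near_V.
by exists i; exact: Ki (leqnn i).
Qed.

Lemma compact_bounded_nat (R : realType) (T : topologicalType) (K : set T) (f : T -> R) :
  compact K -> continuous f -> exists i : nat, forall x, K x -> f x < i%:R.
Proof.
move=> cK cf; have [|i j ij x /= fx|x _|i Ki] :=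
  @compact_increasing_cover T K (fun i => f @^-1` [set y | y < i%:R]) cK; last by exists i.
- by move=> i; apply: preimage_open => //; exact: open_lt.
- by rewrite (lt_le_trans fx)// ler_nat.
- by exists (Num.truncn (f x)).+1 => //; exact: truncnS_gt.
Qed.

(** Properness makes the return set compact in the quotient by the stabilizer, which bounds
    [f (g * h)] for some [h] in the stabilizer; compactness of the stabilizer then bounds [f g] by
    [f (g * h) * f h^-1]. *)
Lemma proper_orbit_bounded (R : realType) (G : topGroupType) (M : topologicalType)
    (a : contAction G M) (x : M) (f : G -> R) (K : set M) :
  continuous f -> (forall g, 0 <= f g) -> (forall g h, f (g * h)%g <= f g * f h) ->
  compact (stabilizer a x) -> proper_map (@orbital_map G M a x) -> compact K ->
  exists T : nat, forall g, K (a g x) -> f g <= T%:R.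
Proof.
move=> cf f0 fM cS [_ pK] cK; have {}cK := pK _ cK.
have [s Ss] := compact_bounded_nat cS cf.
(* The sublevel sets of [f] are saturated under the stabilizer, so that they descend to open sets of
   the quotient. *)
pose Vg (i : nat) := \bigcup_(h in stabilizer a x) (fun g => f (g * h)%g) @^-1` [set y | y < i%:R].
have oVg i : open (Vg i).
  apply: bigcup_open => h _; apply: preimage_open; last exact: open_lt.
  move=> g; apply: (continuous_comp (f := fun g => (g * h)%g)); last exact: cf.
  apply: (continuous_comp (f := fun g => (g, h)) (g := fun x => (x.1 * x.2)%g)).
    exact: (cvg_pair cvg_id (cvg_cst h)).
  exact: mulg_continuous.
have VgE g h : a g x = a h x -> forall i, Vg i g -> Vg i h.
  move=> gh i [s' Ss' fs]; exists (h^-1 * g * s')%g => /=; last by rewrite !mulgA mulgV mul1g.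
  by rewrite /stabilizer/= !actM Ss' gh -actM mulVg act1.
pose V i : set (stab_quotient a x) := [set c | Vg i (repr c)].
have pV i : \pi_(stab_quotient a x)%qT @^-1` V i = Vg i.
  apply/seteqP; split=> g; rewrite /V /=; apply: VgE.
    by rewrite -[LHS]/(orbital_map (\pi g)%qT) orbital_mapE.
  by rewrite -[RHS]/(orbital_map (\pi g)%qT) orbital_mapE.
have oV i : open (V i) by rewrite /open/= /quotient_open pV; exact: oVg.
have incV i j : (i <= j)%N -> V i `<=` V j.
  move=> ij c [h Sh fh]; exists h => //; apply: lt_le_trans fh _; by rewrite ler_nat.
have [|i Ki] := compact_increasing_cover cK oV incV.
  move=> c _; exists (Num.truncn (f (repr c * 1)%g)).+1 => //.
  by exists 1%g; [exact: act1|exact: truncnS_gt].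
exists (i * s)%N => g Kg.
have : Vg i g by rewrite -pV; apply: Ki; rewrite /= orbital_mapE.
move=> [h Sh fh]; rewrite -(mulgK h g); apply: le_trans (fM _ _) _.
rewrite natrM ler_pM// ltW//; apply: Ss.
by rewrite /stabilizer/= -{1}Sh -actM mulVg act1.
Qed.

Lemma gsize_continuous (R : realType) (N : nat) (Gt : topGroupType)
    (q : Gt -> mxgroup_type (SO R N.+1)) : continuous q -> continuous (gsize q).
Proof.
move=> cq.
have cs (h : Gt -> Gt) : continuous h -> continuous (fun g => mxsize (val (q (h g)))).
  move=> ch; have c : continuous (fun g => val (q (h g))).
    move=> g; apply: (continuous_comp (f := fun g => q (h g))); last exact: mxgroup_val_continuous.
    by apply: (continuous_comp (f := h)); [exact: ch|exact: cq].
  rewrite /mxsize; apply: fsum_continuous => i _; apply: fsum_continuous => j _ g.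
  apply: cvg_norm; exact: (entry_continuous (i := i) (j := j) c).
have c1 : continuous (fun g => mxsize (val (q g))) by apply: (cs id) => x; exact: cvg_id.
have c2 := cs _ (@invg_continuous Gt).
by move=> g; exact: (cvgD (c1 g) (c2 g)).
Qed.

Lemma finite_image_bounded (R : realType) (T : eqType) (A : set T) (F : T -> R) :
  finite_set A -> exists C, forall x, A x -> F x <= C.
Proof.
move=> /finite_seqP[s ->]; exists (\sum_(x <- s) `|F x|) => x /= xs.
by rewrite (big_rem x)//= (le_trans (ler_norm _))// lerDl sumr_ge0.
Qed.

Lemma act_borel (G : topGroupType) (M : ptopologicalType) (a : contAction G M) g :
  @measurable_fun _ _ (borel M) (borel M) setT (a g).
Proof.
apply: (@measurability _ _ (borel M) (borel M) setT (a g) (@open M)) => // _ [Q oQ <-].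
rewrite setTI; apply: open_borel; apply: preimage_open => //; exact: act_continuousr.
Qed.

Lemma natvD (K : pzRingType) N (v w : 'I_N -> nat) : natv K (vadd v w) = natv K v + natv K w.
Proof. by apply/matrixP => i j; rewrite !mxE natrD. Qed.

Lemma natv_scale (K : pzRingType) N a (w : 'I_N -> nat) :
  natv K (vscale a w) = a%:R *: natv K w.
Proof. by apply/matrixP => i j; rewrite !mxE natrM. Qed.

Lemma natv0 (K : pzRingType) N : natv K (fun=> 0%N) = 0 :> 'cV[K]_N.
Proof. by apply/matrixP => i j; rewrite !mxE. Qed.

Theorem theorem1p2 (R : realType) (n : nat) (hn : (3 <= n)%N)
  (M : ptopologicalType) (d : nat) (M_manifold : manifold R d M)
  (M_compact : compact [set: M]) (M_connected : connected [set: M])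
  (a : contAction (mxgroup_type (SO R n)) M)
  (mu : {finite_measure set (borel M) -> \bar R})
  (mu_neq0 : mu [set: borel M] != 0%E) (mu_inv : invariant_measure a mu)
  (Gt : topGroupType) (q : Gt -> mxgroup_type (SO R n))
  (q_morph : {morph q : g h / (g * h)%g}) (q_univ : universal_covering R q)
  (Mt : ptopologicalType) (p : Mt -> M) (p_univ : universal_covering R p)
  (b : contAction Gt Mt) (b_lift : lifted_action q p a b)
  (mut : {measure set (borel Mt) -> \bar R}) (mut_lift : natural_lift p mu mut)
  (b_proper : measurably_proper b mut)
  (k : hyp_kind) (m : nat) (hm : (2 <= m)%N) (Lambda : set (hypGroup R k m))
  (Lambda_subgroup : subgroup Lambda) (Lambda_discrete : discrete_set Lambda)
  (Lambda_infinite : infinite_set Lambda)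
  (x0 : M) (pi1_iso : pi1_isomorphic R x0 Lambda) :
  ((delta_SO R n)%:E <= critical_exponent Lambda)%E.
Proof.
rewrite leNgt; apply/negP.
(* With [n = N.+1] the horospheres have dimension [N], which is also [delta_SO R n]. *)
case: n hn a mu_inv q q_morph q_univ b_lift => // N hN a mu_inv q qM q_univ b_lift.
rewrite /delta_SO -natr1 addrK => exponent_lt.
(* The assumption [3 <= n] enters here: it leaves room for an exponent strictly between 1 and
   [N]. *)
have N1 : 1 < N%:R :> R by rewrite ltr1n -ltnS.
have [r [S [r1 rN summable]]] := critical_exponent_summable (ltnW hm) N1 exponent_lt.
have [q_cov [_ q_path _]] := q_univ.
have [p_cov _] := p_univ.
have [q_cont q_surj _] := q_cov.
have [At _ qAt] : [set q g | g in [set: Gt]] (gboost N (ln 2)) by apply: q_surj.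
have [xt0 _ p_xt0] : [set p y | y in [set: Mt]] x0 by case: p_cov => _ + _; apply.
have [phi [phi_in _ phi_eq phiM]] := pi1_iso.
have [K [U [W [V [s [oU UW pcW evW [hV [sP Ucov]]]]]]]] :=
  evenly_covered_cover p_cov M_manifold M_compact.
pose c : Gt -> borel M -> hypGroup R k m := deck_cocycle p_univ phi xt0 UW sP Ucov b.
pose nt := family_lift qM q_cov (@gunipD R N) (@gunip_continuous R N).
have c_bounded (Q : set Gt) : compact Q -> exists C : R, forall g (x : borel M),
    Q g -> corner_length (c g x) <= C.
  move=> cQ; have := deck_cocycle_compact p_univ phi_eq phiM p_xt0 UW pcW evW hV sP Ucov b
    M_compact cQ.
  move=> /(finite_image_bounded (@corner_length R k m))[C HC].
  by exists C => g x Qg; apply: HC; exists g => //; exists x.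
have D_compact : compact (domain K U s) by exact: (domain_compact UW hV sP).
have count e sg := horosphere_count_family qM q_cov qAt sg e c_bounded.
apply: (@cocycle_contradiction R _ (borel M) mu Gt (hypGroup R k m) (fun g x => a (q g) x)
  _ _ _ _ (@corner_length R k m) (ln 2) _ (@corner_length_ge0 R k m)
  (@corner_lengthV R k m) (@corner_lengthM R k m) (@corner_length_cross R k m)
  Lambda N r S r1 rN summable c _ _ _ (range (opposite_product qM q_cov)) (gsize q)
  (@countable_opposite_products R N Gt q qM q_cov) _ At (fun w => nt (natv R w)) mu_neq0).
- by move=> x; rewrite (morph_one qM) act1.
- by move=> g h x; rewrite qM actM.
- by move=> g; exact: act_borel.
- by move=> g A mA; exact: mu_inv.
- by rewrite ln_ge0// ler1n.
- by move=> g x; exact: (deck_cocycle_in p_univ phi_in p_xt0 UW sP Ucov b).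
- by move=> g h x; exact: (deck_cocycleM p_univ phi_eq phiM p_xt0 UW sP Ucov b_lift (q_path 1%g)).
- by move=> g; exact: (deck_cocycle_simple p_univ phi_eq phiM p_xt0 oU UW pcW evW hV sP Ucov b_lift).
(* For almost every [x] the orbit map at [sigma x] is proper, and [c g x = 1] puts [b g (sigma x)]
   in the compact [domain], which bounds [gsize g]. *)
- have [A [mA A0 sA]] := natural_lift_ae p_univ oU UW hV sP Ucov mut_lift b_proper.
  exists A; split=> // x not_tame; apply: sA => -[stab_compact orbit_proper].
  apply: not_tame.
  have [T HT] := proper_orbit_bounded (gsize_continuous q_cont) (gsize_ge0 q)
    (gsizeM qM) stab_compact orbit_proper D_compact.
  by exists T => g _ c1; apply: HT; exact: (deck_cocycle1 phi_eq phiM p_xt0 c1).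
- by move=> v w; rewrite natvD; exact: family_liftD.
- by move=> w; rewrite natv_scale; exact: (lift_boost_unip qM q_cov qAt).
(* The untwisted boost is the case [e = 0] with positive sign; the negative sign gives the inverted
   family with all the twists. *)
- have := count (fun=> 0%N) false; rewrite natv0 family_lift0 invg1 mul1g expr0.
  rewrite (_ : (fun u => _) = fun w => nt (natv R w))//.
  by apply/funext => w; rewrite scale1r.
- move=> e; have := count e true; rewrite expr1.
  rewrite (_ : (fun u => _) = fun w => (nt (natv R w))^-1%g)//.
  by apply/funext => w; rewrite scaleN1r; exact: family_liftN.
Qed.
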